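(* Let $W=(W_t)_{t\ge0}$ be a standard Brownian motion and let $f:\mathbb{R}\to\mathbb{R}$. The following assertions are equivalent: (i) $f$ is a measurable, strictly positive solution of the D'Alembert functional equation $f(x+y)+f(x-y)=2f(x)f(y)$ for all $x,y\in\mathbb{R}$; (ii) $f$ is a strictly positive even function with $f(0)=1$ such that $f(W_t)$ is integrable for every $t\ge0$ and the process $N_t=\dfrac{f(W_t)}{E f(W_t)}$, $t\ge0$, is a right-continuous martingale; (iii) $f(x)=\cosh(\lambda x)=\tfrac12\big(e^{\lambda x}+e^{-\lambda x}\big)$ for all $x\in\mathbb{R}$, for some constant $\lambda\in\mathbb{R}$.
   Context: $W$ is a standard Brownian motion on a complete probability space $(\Omega,\mathcal{F},P)$, and $(\mathcal{F}_t)_{t\ge0}$ is the filtration generated by $W$; ''martingale'' means martingale with respect to this filtration. *)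

(* Defs.v *)
From HB Require Import structures.
From mathcomp Require Import all_boot all_order all_algebra.
From mathcomp Require Import all_classical all_reals all_analysis.
Set Implicit Arguments. Unset Strict Implicit. Unset Printing Implicit Defensive.
Import Order.TTheory GRing.Theory Num.Theory.
Import numFieldNormedType.Exports.
Local Open Scope classical_set_scope.
Local Open Scope ring_scope.

Section BM.
Context {R : realType} {d : measure_display} {T : measurableType d}.
Variable (P : probability T R).

Definition incr (W : R -> T -> R) (s t : R) : T -> R := fun w => W t w - W s w.

(* Standard (one-dimensional) Brownian motion on [0, +oo), indexed by R
   (only the values at t >= 0 matter). *)
Definition standard_BM (W : R -> T -> R) : Prop :=
  (forall t, 0 <= t -> measurable_fun setT (W t)) /\
  (forall w, W 0 w = 0) /\
  (forall w, {within `[0, +oo[, continuous (fun t => W t w)}) /\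
  (forall s t, 0 <= s -> s < t -> forall B : set R, measurable B ->
     P (incr W s t @^-1` B) = normal_prob 0 (Num.sqrt (t - s)) B) /\
  (forall (n : nat) (tt : nat -> R), 0 <= tt 0%N ->
     (forall i, (i < n)%N -> tt i < tt i.+1) ->
     forall B : nat -> set R, (forall i, measurable (B i)) ->
     P (\bigcap_(i in [set i | (i < n)%N]) (incr W (tt i) (tt i.+1) @^-1` B i))
     = (\prod_(i < n) P (incr W (tt i) (tt i.+1) @^-1` B i))%E).

Definition nat_filtration (W : R -> T -> R) (t : R) : set (set T) :=
  <<s [set A | exists r, 0 <= r /\ r <= t /\
        exists B : set R, measurable B /\ A = W r @^-1` B] >>.

Definition martingale (Fl : R -> set (set T)) (N : R -> T -> R) : Prop :=
  (forall t, 0 <= t -> forall B : set R, measurable B -> Fl t (N t @^-1` B)) /\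
  (forall t, 0 <= t -> P.-integrable setT (fun w => (N t w)%:E)) /\
  (forall s t, 0 <= s -> s <= t -> forall A, Fl s A ->
     (\int[P]_(w in A) (N t w)%:E = \int[P]_(w in A) (N s w)%:E)%E).

Definition right_continuous_process (N : R -> T -> R) : Prop :=
  forall w t, 0 <= t -> (fun s => N s w) @ t^'+ --> N t w.

End BM.

(* Main.v *)
Require Import Defs.
From HB Require Import structures.
From mathcomp Require Import all_boot all_order all_algebra.
From mathcomp Require Import all_classical all_reals all_analysis.
From mathcomp Require Import measurable_realfun.
From mathcomp Require Import zify ring lra.
Set Implicit Arguments. Unset Strict Implicit. Unset Printing Implicit Defensive.
Import Order.TTheory GRing.Theory Num.Theory.
Import numFieldNormedType.Exports.
Local Open Scope classical_set_scope.
Local Open Scope ring_scope.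

(** (ii) => (iii). In (ii), [f] is not assumed measurable, so all regularity has to come from
the right-continuity of [N t = f (W t) / c t], where [c t = E f (W t)].  For three
independent Brownian paths, a second-moment estimate on finer and finer grids shows that,
with probability bounded below uniformly in [h], there are times [s], [s'] in [[t, t + 5h]]
at which the first path is back at its value at [t], the second path has equal values at
[s] and [s'], and the third path takes at [s'] its value at [t + h].  Along such meetings
[f] cancels from the ratios, so [c (t + h) / c t] is controlled by the oscillation of the
three right-continuous paths of [N]; hence [c] is right-continuous, hence so is [f] along
Brownian paths, and [f] itself, being even, is continuous.  The Markov property then makes
[f] an eigenfunction of the heat semigroup with eigenvalues [c h = exp (mu h)].  By
comparison with [exp (- k x)], [mu >= 0], and by comparison with [cosh (l x)], where
[l ^ 2 / 2 = mu], through a maximum principle, [f = cosh (l x)].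

(i) => (iii). A measurable solution is bounded near 0 by Steinhaus' argument, which makes it
continuous; it is at least 1 and its value at 1 determines it on the dyadics.

(iii) => (ii). Increments after [s] are independent of the past of [s], and
[exp (l x)] is integrated explicitly against the Gaussian law. *)

(** * Normal probabilities *)

(** The normalizer [c] is deterministic, hence common to all paths, whereas values of [f] at
    unrelated points cannot be compared. So two values of [c] are compared through a path taking the
    same value at both times. A single path does not lead from [t] to a prescribed [t + h]: chaining
    its equalities would force [W t = W (t + h)]. Changing paths at intermediate times removes this
    constraint. Each equality of Brownian values costs codimension 1/2 in time. One intermediate
    time and two paths would cost 1 in dimension 1, the critical case in which planar Brownian
    motion misses points; two intermediate times and three paths cost 3/2 in dimension 2. On a grid
    with [n] points for each time, the [n ^ 2] pairs succeed with probability of order [n ^ (-3/2)]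
    each, so the mean number of meetings grows like [sqrt n], and its second moment is of the order
    of the squared mean. *)

Lemma normal_peak_le (R : realType) (s : R) : 0 < s -> normal_peak s <= s^-1.
Proof.
move=> s0; have pi2 := pi_ge2 R.
rewrite /normal_peak lef_pV2 ?posrE//; last first.
  by rewrite sqrtr_gt0 mulrn_wgt0// mulr_gt0 ?pi_gt0// exprn_gt0.
rewrite -{1}(gtr0_norm s0) -sqrtr_sqr ler_wsqrtr//.
have : 0 < s ^+ 2 by rewrite exprn_gt0.
nra.
Qed.

Lemma normal_peak_ge (R : realType) (s : R) : 0 < s -> (3 * s)^-1 <= normal_peak s.
Proof.
move=> s0; have pi4 : pi <= 4 :> R by have [] := pihalf_02_cos_pihalf R; lra.
rewrite /normal_peak lef_pV2 ?posrE ?mulr_gt0//; last first.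
  by rewrite sqrtr_gt0 mulrn_wgt0// mulr_gt0 ?pi_gt0// exprn_gt0.
have s3 : 0 < 3 * s by lra.
rewrite -{1}(gtr0_norm s3) -sqrtr_sqr ler_wsqrtr// exprMn.
have : 0 < s ^+ 2 by rewrite exprn_gt0.
nra.
Qed.

Lemma normal_prob_le (R : realType) (s : R) (B : set R) (l : \bar R) : 0 < s ->
  measurable B -> (lebesgue_measure B <= l)%E ->
  (normal_prob 0 s B <= s^-1%:E * l)%E.
Proof.
move=> s0 mB Bl; have s1 : s != 0 by rewrite gt_eqF.
apply: (@le_trans _ _ (\int[lebesgue_measure]_(x in B) (cst (s^-1%:E) x)))%E.
  apply: ge0_le_integral => //=.
  - by move=> x _; rewrite lee_fin normal_pdf_ge0.
  - apply/measurable_EFinP/measurable_funTS; exact: measurable_normal_pdf.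
  - by move=> x _; rewrite lee_fin (le_trans (normal_pdf_ub _ _ _))// normal_peak_le.
rewrite integral_cst// lee_wpmul2l// lee_fin invr_ge0 ltW//.
Qed.

(** On [[- e, e]] the exponential factor is at least 1/2, because [exp (- u / 2) >= 1 - u / 2] with
    [u <= 1], and the peak is at least [1 / (3 s)]. *)
Lemma normal_prob_ge (R : realType) (s e : R) : 0 < e -> e <= s ->
  ((e / (3 * s))%:E <= normal_prob 0 s [set x : R | (`|x| <= e)%R])%E.
Proof.
move=> e0 es; have s0 : 0 < s by lra.
have s1 : s != 0 by rewrite gt_eqF.
have -> : [set x : R | `|x| <= e] = `[- e, e]%classic.
  by apply/seteqP; split => x /=; rewrite in_itv/= ler_norml.
apply: (@le_trans _ _ (\int[lebesgue_measure]_(x in `[(- e)%R, e]%classic) (cst ((6 * s)^-1%:E) x))%E).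
  rewrite integral_cst//= lebesgue_measure_itv/= lte_fin ifT; last lra.
  rewrite -EFinB -EFinM lee_fin (_ : e / _ = (6 * s)^-1 * (e - - e))//.
  by field.
apply: ge0_le_integral => //=.
- by move=> x _; rewrite lee_fin invr_ge0; lra.
- apply/measurable_EFinP/measurable_funTS; exact: measurable_normal_pdf.
- move=> x; rewrite in_itv/= -ler_norml => xe; rewrite lee_fin normal_pdfE//.
  rewrite (_ : (6 * s)^-1 = (3 * s)^-1 * 2^-1); last by field.
  apply: ler_pM; rewrite ?invr_ge0 ?normal_peak_ge//; [lra|].
  rewrite /normal_fun subr0.
  have x2 : x ^+ 2 <= s ^+ 2.
    rewrite -(real_normK (num_real x)) lerXn2r ?nnegrE//; lra.
  apply: le_trans (expR_ge1Dx _).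
  have -> : - x ^+ 2 / (s ^+ 2 *+ 2) = - (x ^+ 2 / s ^+ 2) / 2.
    by rewrite -mulr_natr; field.
  have : x ^+ 2 / s ^+ 2 <= 1 by rewrite ler_pdivrMr ?mul1r// exprn_gt0.
  lra.
Qed.

(** * Brownian increments *)

Section BrownianIncrements.
Context (R : realType) (d : measure_display) (T : measurableType d).
Variables (P : probability T R) (W : R -> T -> R).
Hypothesis BM : standard_BM P W.

Lemma measurable_BM t : 0 <= t -> measurable_fun setT (W t).
Proof. by case: BM => + _; apply. Qed.

Lemma BM0 w : W 0 w = 0.
Proof. by case: BM => _ [+ _]; apply. Qed.

Lemma measurable_incr s t : 0 <= s -> 0 <= t -> measurable_fun setT (incr W s t).
Proof. by move=> s0 t0; apply: measurable_funB; exact: measurable_BM. Qed.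

Lemma measurable_preimage_incr s t B : 0 <= s -> 0 <= t -> measurable B ->
  measurable (incr W s t @^-1` B).
Proof.
by move=> s0 t0 mB; rewrite -[_ @^-1` _]setTI; exact: measurable_incr.
Qed.

Lemma incr_indep3 a b c e B1 B2 B3 : 0 <= a -> a < b -> b < c -> c < e ->
  measurable B1 -> measurable B2 -> measurable B3 ->
  P (incr W a b @^-1` B1 `&` (incr W b c @^-1` B2 `&` incr W c e @^-1` B3)) =
  (P (incr W a b @^-1` B1) * (P (incr W b c @^-1` B2) * P (incr W c e @^-1` B3)))%E.
Proof.
move=> a0 ab bc ce m1 m2 m3; case: BM => _ [_ [_ [_ ind]]].
(* The default value [e] of [nth] is the fourth time, read at index 3. *)
have := ind 3%N (nth e [:: a; b; c]) a0 _ (nth setT [:: B1; B2; B3]) _.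
rewrite !big_ord_recl big_ord0 /= mule1.
have -> : \bigcap_(i in [set i | (i < 3)%N])
    (incr W (nth e [:: a; b; c] i) (nth e [:: a; b; c] i.+1) @^-1` nth setT [:: B1; B2; B3] i) =
    incr W a b @^-1` B1 `&` (incr W b c @^-1` B2 `&` incr W c e @^-1` B3).
  apply/seteqP; split => w /=.
    by move=> h; split; [exact: (h 0%N)|split; [exact: (h 1%N)|exact: (h 2%N)]].
  by move=> [h1 [h2 h3]] [|[|[|i]]] //=.
apply.
- by move=> [|[|[|i]]] //=.
- by move=> [|[|[|[|i]]]] //=.
Qed.

Lemma incr_indep2 a b c B1 B2 : 0 <= a -> a < b -> b < c ->
  measurable B1 -> measurable B2 ->
  P (incr W a b @^-1` B1 `&` incr W b c @^-1` B2) =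
  (P (incr W a b @^-1` B1) * P (incr W b c @^-1` B2))%E.
Proof.
move=> a0 ab bc m1 m2.
have := incr_indep3 a0 ab bc (_ : c < c + 1) m1 m2 measurableT.
by rewrite !preimage_setT setIT probability_setT mule1; apply; rewrite ltrDl.
Qed.

Lemma incr_prob_le s t B (l : \bar R) : 0 <= s -> s < t -> measurable B ->
  (lebesgue_measure B <= l)%E ->
  (P (incr W s t @^-1` B) <= (Num.sqrt (t - s))^-1%:E * l)%E.
Proof.
move=> s0 st mB Bl; case: BM => _ [_ [_ [law _]]]; rewrite law//.
by apply: normal_prob_le => //; rewrite sqrtr_gt0 subr_gt0.
Qed.

Lemma measurable_ball_norm (e : R) : measurable [set x : R | `|x| <= e].
Proof.
have -> : [set x : R | `|x| <= e] = `[- e, e]%classic.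
  by apply/seteqP; split => x /=; rewrite in_itv/= ler_norml.
exact: measurable_itv.
Qed.

Lemma lebesgue_measure_ball_norm (e : R) : 0 <= e ->
  (lebesgue_measure [set x : R | `|x| <= e]%R <= (2 * e)%:E)%E.
Proof.
move=> e0; have -> : [set x : R | `|x| <= e] = `[- e, e]%classic.
  by apply/seteqP; split => x /=; rewrite in_itv/= ler_norml.
rewrite lebesgue_measure_itv/=; case: ifPn => _; last by rewrite lee_fin; lra.
by rewrite -EFinB lee_fin; lra.
Qed.

Lemma incr_ball_le s t e : 0 <= s -> s < t -> 0 <= e ->
  (P [set w | `|W t w - W s w| <= e]%R <= (2 * e / Num.sqrt (t - s))%:E)%E.
Proof.
move=> s0 st e0.
have -> : (2 * e / Num.sqrt (t - s))%:E =
  ((Num.sqrt (t - s))^-1%:E * (2 * e)%:E)%E by rewrite -EFinM mulrC.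
apply: (@incr_prob_le s t [set x : R | `|x| <= e]) => //.
- exact: measurable_ball_norm.
- exact: lebesgue_measure_ball_norm.
Qed.

Lemma incr_ball_ge s t e : 0 <= s -> 0 < e -> e <= Num.sqrt (t - s) ->
  ((e / (3 * Num.sqrt (t - s)))%:E <= P [set w | `|W t w - W s w| <= e]%R)%E.
Proof.
move=> s0 e0 es; case: BM => _ [_ [_ [law _]]].
have st : s < t by rewrite -subr_gt0 -sqrtr_gt0; lra.
rewrite (law s t s0 st [set x : R | `|x| <= e]); last exact: measurable_ball_norm.
exact: normal_prob_ge.
Qed.

Lemma measurable_near_event s t e : 0 <= s -> 0 <= t ->
  measurable [set w | `|W t w - W s w| <= e].
Proof.
by move=> s0 t0; apply: (@measurable_preimage_incr s t [set x : R | `|x| <= e]) => //;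
  exact: measurable_ball_norm.
Qed.

(** The two visits are dependent, but together they force the increment over [[a, b]] to be at most
    [2 e], and that increment is independent of the first visit. *)
Lemma incr_ball2_le t a b e : 0 <= t -> t < a -> a < b -> 0 <= e ->
  (P ([set w | `|W a w - W t w| <= e]%R `&` [set w | `|W b w - W t w| <= e]%R) <=
    (2 * e / Num.sqrt (a - t) * (4 * e / Num.sqrt (b - a)))%:E)%E.
Proof.
move=> t0 ta ab e0.
have a0 : 0 <= a by lra. have b0 : 0 <= b by lra. have e2 : 0 <= 2 * e by lra.
apply: (@le_trans _ _ (P (incr W t a @^-1` [set x : R | `|x| <= e]%R `&`
   incr W a b @^-1` [set x : R | `|x| <= 2 * e]%R))).
  apply: le_measure; rewrite ?inE.
  - by apply: measurableI; exact: measurable_near_event.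
  - by apply: measurableI; apply: measurable_preimage_incr => //; exact: measurable_ball_norm.
  - move=> w /= [h1 h2]; split; first exact: h1.
    rewrite /incr (_ : W b w - W a w = (W b w - W t w) - (W a w - W t w)); last by ring.
    by rewrite (le_trans (ler_normB _ _))//; lra.
rewrite incr_indep2//; [|exact: measurable_ball_norm..].
rewrite EFinM; apply: lee_pmul => //; first exact: incr_ball_le.
rewrite (_ : 4 * e = 2 * (2 * e)); last by ring.
exact: incr_ball_le.
Qed.

End BrownianIncrements.

(* [Y] and [Z] are pinned near multiples of [X], so once [X] is localized at scale [e]
   both lie in boxes of size O(e); independence then multiplies the two small-ball bounds. *)
Lemma prob_pinned_le (R : realType) (d : measure_display) (T : measurableType d)
  (P : probability T R) (X Y Z : T -> R) (E : set T) (a b e py pz : R) :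
  measurable_fun setT X -> measurable_fun setT Y -> measurable_fun setT Z ->
  measurable E -> 0 < e -> 0 <= py -> 0 <= pz ->
  `|a| <= 1 -> `|b| <= 1 ->
  (forall B1 B2 B3, measurable B1 -> measurable B2 -> measurable B3 ->
    P (X @^-1` B1 `&` (Y @^-1` B2 `&` Z @^-1` B3)) =
    (P (X @^-1` B1) * (P (Y @^-1` B2) * P (Z @^-1` B3)))%E) ->
  (forall B : set R, measurable B -> (lebesgue_measure B <= (12 * e)%:E)%E ->
     (P (Y @^-1` B) <= py%:E)%E) ->
  (forall B : set R, measurable B -> (lebesgue_measure B <= (12 * e)%:E)%E ->
     (P (Z @^-1` B) <= pz%:E)%E) ->
  (forall w, E w -> `|Y w - a * X w| <= 2 * e /\ `|Z w - b * X w| <= 2 * e) ->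
  (P E <= (py * pz)%:E)%E.
Proof.
move=> mX mY mZ mE e0 py0 pz0 a1 b1 ind hY hZ hE.
(* Cells of [|X|] are indexed by [nat]. [J] has half-width [3 e]: [2 e] from the pinning and [e]
   from the cell, as [|c| <= 1]. Its two mirror bands of length [6 e] give the [12 e] of the
   hypotheses. *)
pose I (k : nat) := [set x : R | e * k%:R <= `|x| < e * k.+1%:R].
pose J (c : R) (k : nat) := [set x : R | `| `|x| - `|c| * (e * k%:R)| <= 3 * e].
have mI k : measurable (I k).
  rewrite (_ : I k = (fun x : R => `|x|) @^-1` `[e * k%:R, e * k.+1%:R[%classic); last first.
    by apply/seteqP; split => x /=; rewrite in_itv.
  by rewrite -[_ @^-1` _]setTI; exact: normr_measurable.
have mJ c k : measurable (J c k).
  rewrite (_ : J c k = (fun x : R => `|x|) @^-1` `[`|c| * (e * k%:R) - 3 * e, `|c| * (e * k%:R) + 3 * e]%classic); last first.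
    by apply/seteqP; split => x; rewrite /J /= in_itv/= ler_distl.
  by rewrite -[_ @^-1` _]setTI; exact: normr_measurable.
have lJ c k : (lebesgue_measure (J c k) <= (12 * e)%:E)%E.
  set r := `|c| * (e * k%:R).
  have sub : J c k `<=` `[r - 3 * e, r + 3 * e]%classic `|` `[- r - 3 * e, - r + 3 * e]%classic.
    move=> x; rewrite /J /= -/r !in_itv/= ler_distl => /andP[h1 h2].
    have [x0|x0] := leP 0 x.
      by left; rewrite ger0_norm// in h1 h2; apply/andP.
    by right; rewrite ltr0_norm// in h1 h2; apply/andP; split; lra.
  apply: (le_trans (le_measure lebesgue_measure _ _ sub)); rewrite ?inE; [exact: mJ|by apply: measurableU; exact: measurable_itv|].
  apply: (le_trans (measureU2 lebesgue_measure _ _)) => //.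
  have l6 (p : R) : (lebesgue_measure `[(p - 3 * e)%R, (p + 3 * e)%R]%classic <= (6 * e)%:E)%E.
    by rewrite lebesgue_measure_itv/= lte_fin ifT; [rewrite -EFinB lee_fin; lra|lra].
  rewrite (_ : 12 * e = 6 * e + 6 * e); last by ring.
  by rewrite EFinD; apply: leeD; exact: l6.
have subE : E `<=` \bigcup_k (E `&` X @^-1` I k).
  move=> w Ew; exists (Num.trunc (`|X w| / e)) => //; split => //=.
  have /truncn_itv/andP[h1 h2] : 0 <= `|X w| / e by rewrite divr_ge0// ltW.
  rewrite /I /= -ler_pdivlMl// -ltr_pdivrMl// ![e^-1 * _]mulrC.
  by rewrite h1 h2.
have mXI k : measurable (X @^-1` I k) by rewrite -[_ @^-1` _]setTI; exact: mX.
have mYJ c k : measurable (Y @^-1` J c k) by rewrite -[_ @^-1` _]setTI; exact: mY.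
have mZJ c k : measurable (Z @^-1` J c k) by rewrite -[_ @^-1` _]setTI; exact: mZ.
have mEX k : measurable (E `&` X @^-1` I k) by exact: measurableI.
apply: le_trans (measure_sigma_subadditive _ mEX mE subE) _.
have key k : (P (E `&` X @^-1` I k) <= (py * pz)%:E * P (X @^-1` I k))%E.
  apply: (@le_trans _ _ (P (X @^-1` I k `&` (Y @^-1` J a k `&` Z @^-1` J b k)))).
    apply: le_measure; rewrite ?inE; [exact: mEX| |].
      by apply: measurableI => //; exact: measurableI.
    have aux c y x : `|c| <= 1 -> `|y - c * x| <= 2 * e -> I k x -> J c k y.
      move=> c1 h /= /andP[k1 k2].
      have h1 : `| `|y| - `|c| * `|x| | <= 2 * e.
        by rewrite -normrM (le_trans (ler_dist_dist _ _)).
      have h2 : `| `|c| * `|x| - `|c| * (e * k%:R)| <= e.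
        rewrite -mulrBr normrM normr_id.
        rewrite -natr1 mulrDr mulr1 in k2.
        rewrite [X in _ * X]ger0_norm; last lra.
        have c0 := normr_ge0 c.
        have : 0 <= `|x| - e * k%:R by lra.
        nra.
      rewrite /J /= (_ : _ - _ = (`|y| - `|c| * `|x|) + (`|c| * `|x| - `|c| * (e * k%:R))); last by ring.
      by rewrite (le_trans (ler_normD _ _))//; lra.
    by move=> w /= [Ew Iw]; have [h1 h2] := hE _ Ew; split => //; split;
      [exact: aux h1 Iw|exact: aux h2 Iw].
  rewrite ind// muleC; apply: lee_wpmul2r => //.
  rewrite EFinM; apply: lee_pmul => //; [exact: hY|exact: hZ].
apply: (@le_trans _ _ (\sum_(0 <= k <oo) ((py * pz)%:E * P (X @^-1` I k)))%E).
  by apply: lee_nneseries => [k *|k *]; [exact: measure_ge0|exact: key].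
rewrite nneseriesZl//.
rewrite -[leRHS]mule1; apply: lee_wpmul2l; first by rewrite lee_fin mulr_ge0.
have tI : trivIset setT (fun k => X @^-1` I k).
  move=> i j _ _ [w [/= /andP[h1 h2] /andP[h3 h4]]].
  apply/eqP; rewrite eqn_leq; apply/andP; split.
    by rewrite -ltnS -(ltr_nat R) -(ltr_pM2l e0); lra.
  by rewrite -ltnS -(ltr_nat R) -(ltr_pM2l e0); lra.
have <- : P (\bigcup_k (X @^-1` I k)) = (\sum_(0 <= k <oo) P (X @^-1` I k))%E.
  by rewrite measure_bigcup//; apply: eq_eseriesl => k; rewrite in_setT.
by apply: probability_le1; exact: bigcup_measurable.
Qed.

(** * Sums of inverse square roots and a second-moment bound *)

Section InverseRootSums.
Context (R : realType).

Definition ndist (i j : nat) : nat := (i - j + (j - i))%N.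

(** Up to constants, the price of a second meeting [k] grid steps after a first one; the value 1 at
    [k = 0] says that a repeated time costs nothing. *)
Definition invsqrt (k : nat) : R := if k == 0%N then 1 else (Num.sqrt k%:R)^-1.

Lemma invsqrt_gt0 k : 0 < invsqrt k.
Proof. by rewrite /invsqrt; case: k => //= k; rewrite invr_gt0 sqrtr_gt0 ltr0n. Qed.

(** Telescoping: for consecutive square roots, [a ^ 2 - b ^ 2 = 1] gives [1 / a <= 2 (a - b)]. *)
Lemma sum_invsqrt_le n : \sum_(k < n.+1) invsqrt k <= 1 + 2 * Num.sqrt n%:R.
Proof.
elim: n => [|n IH]; first by rewrite big_ord_recl big_ord0 /invsqrt/= sqrtr0; lra.
rewrite big_ord_recr/= (le_trans (lerD IH (lexx _)))// /invsqrt/=.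
set a := Num.sqrt n.+1%:R; set b := Num.sqrt n%:R.
have a0 : 0 < a by rewrite sqrtr_gt0 ltr0n.
have b0 : 0 <= b by rewrite sqrtr_ge0.
have ab : a ^+ 2 - b ^+ 2 = 1 by rewrite !sqr_sqrtr// -natr1; ring.
have : a^-1 <= 2 * (a - b).
  rewrite -[leLHS]mul1r ler_pdivrMr// -[leLHS]ab -subr_ge0.
  rewrite (_ : _ - _ = (a - b) ^+ 2) ?sqr_ge0//; ring.
lra.
Qed.

(** The terms are [k ^ (-3/4)]. For consecutive fourth roots, [a ^ 4 - b ^ 4 = 1] gives
    [1 / a ^ 3 <= 4 (a - b)], which telescopes. *)
Lemma sum_invsqrt32_le n :
  \sum_(k < n.+1) invsqrt k * Num.sqrt (invsqrt k) <= 1 + 4 * Num.sqrt (Num.sqrt n%:R).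
Proof.
elim: n => [|n IH].
  by rewrite big_ord_recl big_ord0 /invsqrt/= !sqrtr0 sqrtr1; lra.
rewrite big_ord_recr/= (le_trans (lerD IH (lexx _)))// /invsqrt/=.
rewrite sqrtrV ?sqrtr_ge0//.
set a2 := Num.sqrt n.+1%:R; set b2 := Num.sqrt n%:R.
have a20 : 0 < a2 by rewrite sqrtr_gt0 ltr0n.
have b20 : 0 <= b2 by rewrite sqrtr_ge0.
have ab : a2 ^+ 2 - b2 ^+ 2 = 1 by rewrite !sqr_sqrtr// -natr1; ring.
set a := Num.sqrt a2; set b := Num.sqrt b2.
have a0 : 0 < a by rewrite sqrtr_gt0.
have b0 : 0 <= b by rewrite sqrtr_ge0.
have a2E : a2 = a ^+ 2 by rewrite sqr_sqrtr// ltW.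
have b2E : b2 = b ^+ 2 by rewrite sqr_sqrtr.
have : a2^-1 * a^-1 <= 4 * (a - b).
  rewrite -invfM -[leLHS]mul1r ler_pdivrMr ?mulr_gt0// -[leLHS]ab a2E b2E.
  have ba : b <= a.
    by rewrite /a /b ler_wsqrtr// ler_wsqrtr// ler_nat.
  have h0 : 0 <= a - b by lra.
  have h1 : b * a ^+ 2 <= a ^+ 3 by rewrite (exprS a 2) ler_wpM2r// sqr_ge0.
  have h2 : b ^+ 2 * a <= a ^+ 3.
    by rewrite (exprSr a 2) ler_wpM2r ?(ltW a0)// lerXn2r// nnegrE ltW.
  have h3 : b ^+ 3 <= a ^+ 3 by rewrite lerXn2r// nnegrE ltW.
  rewrite (_ : (a ^+ 2) ^+ 2 - (b ^+ 2) ^+ 2 =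
    (a - b) * (a ^+ 3 + b * a ^+ 2 + b ^+ 2 * a + b ^+ 3)); last by ring.
  rewrite (_ : 4 * (a - b) * (a ^+ 2 * a) = (a - b) * (4 * a ^+ 3)); last by ring.
  by apply: ler_wpM2l => //; lra.
lra.
Qed.

Lemma sum_ndist_le (g : nat -> R) n : (forall k, 0 <= g k) ->
  \sum_(i < n) \sum_(j < n) g (ndist i j) <= n%:R * (2 * \sum_(k < n) g k).
Proof.
move=> g0; rewrite mulr_natl -[X in _ *+ X](card_ord n) -sumr_const.
apply: ler_sum => i _.
have -> : \sum_(j < n) g (ndist i j) =
    \sum_(0 <= j < i) g (ndist i j) + \sum_(i <= j < n) g (ndist i j).
  by rewrite -(big_mkord xpredT (fun j => g (ndist i j))) -big_cat_nat//= ltnW.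
have sub m : (m <= n)%N -> \sum_(0 <= k < m) g k <= \sum_(k < n) g k.
  move=> mn; rewrite -(big_mkord xpredT g) [leRHS](big_cat_nat (n := m))//=.
  by rewrite lerDl sumr_ge0.
have h1 : \sum_(0 <= j < i) g (ndist i j) <= \sum_(k < n) g k.
  rewrite (le_trans _ (sub i.+1 (ltn_ord i)))//.
  rewrite big_nat_rev/= add0n [leRHS]big_nat_recl//=.
  rewrite -[leLHS]add0r; apply: lerD => //.
  rewrite !big_mkord; apply: ler_sum => j _.
  have ji := ltn_ord j.
  by rewrite (_ : ndist i (i - j.+1) = j.+1)// /ndist; lia.
have h2 : \sum_(i <= j < n) g (ndist i j) <= \sum_(k < n) g k.
  rewrite -{1}[i : nat]add0n big_addn (le_trans _ (sub (n - i)%N (leq_subr _ _)))//.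
  rewrite !big_mkord; apply: ler_sum => j _.
  by rewrite (_ : ndist i (j + i) = j)// /ndist; lia.
lra.
Qed.

Lemma ndistC i j : ndist i j = ndist j i.
Proof. by rewrite /ndist addnC. Qed.

(** The factors in front come from the first and third paths, the bracket from the second. Expanding
    the bracket separates the [i] from the [j]: with [S0 = n], [S1 <= 6 n ^ (3/2)] and
    [S2 <= 10 n ^ (5/4)] the constant is [6 + 6 + 100]. *)
Lemma second_moment_sum_le n : (0 < n)%N ->
  \sum_(i < n) \sum_(i' < n) \sum_(j < n) \sum_(j' < n)
    invsqrt (ndist i i') * invsqrt (ndist j j') *
    ((i == i')%:R + (j == j')%:R +
     Num.sqrt (invsqrt (ndist i i')) * Num.sqrt (invsqrt (ndist j j'))) <=
  112 * n%:R ^+ 2 * Num.sqrt n%:R.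
Proof.
move=> n0.
pose S1 : R := \sum_(i < n) \sum_(i' < n) invsqrt (ndist i i').
pose S2 : R := \sum_(i < n) \sum_(i' < n)
  (invsqrt (ndist i i') * Num.sqrt (invsqrt (ndist i i'))).
pose S0 : R := \sum_(i < n) \sum_(i' < n) (invsqrt (ndist i i') * (i == i')%:R).
have S0E : S0 = n%:R.
  rewrite /S0 -[in RHS](card_ord n) -sumr_const; apply: eq_bigr => i _.
  rewrite (bigD1 i)//= eqxx mulr1 big1 ?addr0.
    by rewrite /ndist subnn.
  by move=> j ji; rewrite eq_sym (negbTE ji) mulr0.
have -> : \sum_(i < n) \sum_(i' < n) \sum_(j < n) \sum_(j' < n)
    invsqrt (ndist i i') * invsqrt (ndist j j') *
    ((i == i')%:R + (j == j')%:R +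
     Num.sqrt (invsqrt (ndist i i')) * Num.sqrt (invsqrt (ndist j j'))) =
    S0 * S1 + S1 * S0 + S2 * S2.
  have prodE (u v : 'I_n -> 'I_n -> R) :
     (\sum_i \sum_i' u i i') * (\sum_j \sum_j' v j j') =
     \sum_i \sum_i' \sum_j \sum_j' (u i i' * v j j').
    rewrite mulr_suml; apply: eq_bigr => i _.
    rewrite mulr_suml; apply: eq_bigr => i' _.
    rewrite mulr_sumr; apply: eq_bigr => j _.
    by rewrite mulr_sumr.
  rewrite /S0 /S1 /S2 !prodE -!big_split/=; apply: eq_bigr => i _.
  rewrite -!big_split/=; apply: eq_bigr => i' _.
  rewrite -!big_split/=; apply: eq_bigr => j _.
  rewrite -!big_split/=; apply: eq_bigr => j' _.
  by ring.
case: n n0 @S0 S0E @S1 @S2 => // n _ S0 S0E S1 S2.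
set N : R := n.+1%:R; set r := Num.sqrt N; set v := Num.sqrt r.
have N1 : 1 <= N by rewrite ler1n.
have r1 : 1 <= r by rewrite -{1}sqrtr1 ler_wsqrtr.
have v1 : 1 <= v by rewrite -{1}sqrtr1 ler_wsqrtr.
have rn : Num.sqrt n%:R <= r by rewrite ler_wsqrtr// ler_nat.
have vn : Num.sqrt (Num.sqrt n%:R) <= v by rewrite ler_wsqrtr.
have vr : v ^+ 2 = r by rewrite sqr_sqrtr//; lra.
have S1le : S1 <= 6 * N * r.
  apply: (le_trans (sum_ndist_le _ _)) => [k|]; first exact/ltW/invsqrt_gt0.
  have := sum_invsqrt_le n; rewrite -/N => h.
  rewrite (_ : 6 * N * r = N * (2 * (3 * r))); last by ring.
  by apply: ler_wpM2l; lra.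
have S2le : S2 <= 10 * N * v.
  apply: (le_trans (sum_ndist_le (g := fun k => invsqrt k * Num.sqrt (invsqrt k)) _ _)) => [k|].
    by rewrite mulr_ge0 ?sqrtr_ge0// ltW// invsqrt_gt0.
  have := sum_invsqrt32_le n; rewrite -/N => h.
  rewrite (_ : 10 * N * v = N * (2 * (5 * v))); last by ring.
  by apply: ler_wpM2l; lra.
have S20 : 0 <= S2.
  by do 2 (apply: sumr_ge0 => ? _); rewrite mulr_ge0 ?sqrtr_ge0// ltW// invsqrt_gt0.
have S22 : S2 * S2 <= 100 * N ^+ 2 * r.
  rewrite (_ : 100 * N ^+ 2 * r = (10 * N * v) * (10 * N * v)); last by rewrite -vr; ring.
  exact: ler_pM.
rewrite S0E -/N.
have : N * S1 <= N * (6 * N * r) by apply: ler_wpM2l; lra.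
rewrite expr2 in S22 *; nra.
Qed.

End InverseRootSums.

(** A linearized Cauchy-Schwarz inequality: the number [S] of events that occur vanishes off their
    union [U], so [2 l S <= S ^ 2 + l ^ 2 1_U]. Integrating with the optimal [l = K m] gives the
    bound. *)
Lemma second_moment_prob_ge (R : realType) (d : measure_display) (T : measurableType d)
  (P : probability T R) (I : finType) (E : I -> set T) (m K : R) :
  (forall i, measurable (E i)) -> 0 < m -> 0 < K ->
  (m%:E <= \sum_(i : I) P (E i))%E ->
  (\sum_(i : I) \sum_(j : I) P (E i `&` E j) <= (K * m ^+ 2)%:E)%E ->
  ((K^-1)%:E <= P (\bigcup_(i in [set: I]) E i))%E.
Proof.
move=> mE m0 K0 h1 h2.
set U := \bigcup_(i in _) E i.
have mU : measurable U by apply: fin_bigcup_measurable => //; exact: finite_finset.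
pose l := K * m.
have l0 : 0 < l by rewrite mulr_gt0.
pose S (w : T) : R := \sum_(i : I) \1_(E i) w.
have ptw w : 2 * l * S w <= S w ^+ 2 + l ^+ 2 * \1_U w.
  have [Uw|nUw] := pselect (U w).
    rewrite indicE mem_set// mulr1.
    have := sqr_ge0 (S w - l); nra.
  have -> : S w = 0.
    apply: big1 => i _; rewrite indicE memNset// => Eiw; apply: nUw.
    by exists i.
  by rewrite indicE memNset// !mulr0 expr0n/= addr0.
have h3 : ((2 * l)%:E * \sum_(i : I) P (E i) <=
    \sum_(i : I) \sum_(j : I) P (E i `&` E j) + (l ^+ 2)%:E * P U)%E.
  have e1 : ((2 * l)%:E * \sum_(i : I) P (E i))%E = (\int[P]_w (2 * l * S w)%:E)%E.
    under eq_integral do rewrite EFinM.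
    rewrite ge0_integralZl//; last 3 first.
    - apply/measurable_EFinP; apply: measurable_sum => i; exact: measurable_indic.
    - by move=> w _; rewrite lee_fin sumr_ge0.
    - by rewrite lee_fin; lra.
    congr (_ * _)%E.
    under eq_integral do rewrite -sumEFin.
    rewrite ge0_integral_sum//=.
    - by apply: eq_bigr => i _; rewrite integral_indic// setIT.
    - by move=> i; apply/measurable_EFinP; exact: measurable_indic.
  have mS : measurable_fun setT S.
    by apply: measurable_sum => i; exact: measurable_indic.
  have e2 : (\sum_(i : I) \sum_(j : I) P (E i `&` E j))%E = (\int[P]_w (S w ^+ 2)%:E)%E.
    transitivity (\int[P]_w (\sum_(i : I) (\sum_(j : I) (\1_(E i `&` E j) w)%:E)))%E.
      rewrite ge0_integral_sum//=.
      - apply: eq_bigr => i _; rewrite ge0_integral_sum//=.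
        + by apply: eq_bigr => j _; rewrite integral_indic// ?setIT//; exact: measurableI.
        + by move=> j; apply/measurable_EFinP/measurable_indic; exact: measurableI.
      - move=> i; apply: emeasurable_sum => j.
        by apply/measurable_EFinP/measurable_indic; exact: measurableI.
      - by move=> i w _; apply: sume_ge0 => j _; rewrite lee_fin.
    apply: eq_integral => w _; rewrite expr2 /S mulr_suml -sumEFin.
    apply: eq_bigr => i _; rewrite mulr_sumr -sumEFin; apply: eq_bigr => j _.
    by rewrite indicI.
  have e3 : ((l ^+ 2)%:E * P U)%E = (\int[P]_w (l ^+ 2 * \1_U w)%:E)%E.
    under eq_integral do rewrite EFinM.
    rewrite ge0_integralZl//; last 2 first.
    - by apply/measurable_EFinP; exact: measurable_indic.
    - by rewrite lee_fin sqr_ge0.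
    by rewrite integral_indic// setIT.
  rewrite e1 e2 e3 -ge0_integralD//; last 4 first.
  - by move=> w _; rewrite lee_fin sqr_ge0.
  - by apply/measurable_EFinP; exact: measurable_funX.
  - by move=> w _; rewrite lee_fin mulr_ge0// sqr_ge0.
  - by apply/measurable_EFinP; apply: measurable_funM => //; exact: measurable_indic.
  apply: ge0_le_integral => //.
  - by move=> w _; rewrite lee_fin mulr_ge0 ?sumr_ge0//; lra.
  - by apply/measurable_EFinP; apply: measurable_funM.
  - apply: emeasurable_funD.
      by apply/measurable_EFinP; exact: measurable_funX.
    by apply/measurable_EFinP; apply: measurable_funM => //; exact: measurable_indic.
  - by move=> w _; rewrite -EFinD lee_fin.
have h4 : ((2 * l * m)%:E <= (K * m ^+ 2)%:E + (l ^+ 2)%:E * P U)%E.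
  apply: le_trans (le_trans _ h3) _.
    by rewrite EFinM lee_wpmul2l// lee_fin; lra.
  exact: leeD.
rewrite -(fineK (fin_num_measure P _ mU)) -EFinM -EFinD !lee_fin in h4 *.
rewrite -[leLHS]mul1r ler_pdivrMr//.
move: h4; set p := fine _; rewrite /l => h4.
have km : 0 < K * m ^+ 2 by rewrite mulr_gt0// exprn_gt0.
rewrite -(ler_pM2l km); nra.
Qed.

(** * Meetings of independent Brownian pieces *)

Section MeetingGrid.
Context (R : realType) (d : measure_display) (T : measurableType d).
Variables (P : probability T R) (W : R -> T -> R).
Hypothesis BM : standard_BM P W.

Variables (dl : R) (n : nat).
Hypotheses (dl0 : 0 < dl) (n0 : (0 < n)%N).

Let D := Num.sqrt dl.
Let r : R := Num.sqrt n%:R.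
(** The standard deviation of the increment over one grid step [dl / n]. *)
Let e := D / r.

Let D0 : 0 < D. Proof. by rewrite sqrtr_gt0. Qed.
Let r0 : 0 < r. Proof. by rewrite sqrtr_gt0 ltr0n. Qed.
Let r1 : 1 <= r. Proof. by rewrite -{1}sqrtr1 ler_wsqrtr// ler1n. Qed.
Let e0 : 0 < e. Proof. by rewrite divr_gt0. Qed.
Let eD : e <= D. Proof. by rewrite ler_pdivrMr// ler_peMr// ltW. Qed.

Let gpt (x : R) (i : nat) : R := x + dl * (i%:R / n%:R).

Let gpt_ge x i : x <= gpt x i.
Proof. by rewrite lerDl mulr_ge0 ?divr_ge0// ltW. Qed.

Let gpt_le x (i : 'I_n) : gpt x i <= x + dl.
Proof.
rewrite lerD2l ler_piMr ?(ltW dl0)// ler_pdivrMr ?ltr0n// mul1r ler_nat.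
exact: ltnW.
Qed.

Let gpt_lt x (i j : nat) : (i < j)%N -> gpt x i < gpt x j.
Proof. by move=> ij; rewrite ltrD2l ltr_pM2l// ltr_pM2r ?invr_gt0 ?ltr0n// ltr_nat. Qed.

Let sqrt_gpt x (i j : nat) : (i < j)%N ->
  (Num.sqrt (gpt x j - gpt x i))^-1 = r / D * invsqrt R (ndist i j).
Proof.
move=> ij.
have -> : gpt x j - gpt x i = dl * ((j - i)%:R / n%:R).
  by rewrite natrB ?(ltnW ij)// /gpt; field; rewrite pnatr_eq0; lia.
rewrite sqrtrM ?(ltW dl0)// sqrtrM ?ler0n// sqrtrV ?ler0n// -/r -/D.
have -> : ndist i j = (j - i)%N by rewrite /ndist; lia.
rewrite /invsqrt ifF; last by apply/eqP; lia.
have s0 : 0 < Num.sqrt (j - i)%:R :> R by rewrite sqrtr_gt0 ltr0n subn_gt0.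
by field; rewrite !gt_eqF.
Qed.

Definition meet (a b : R) : set T := [set w | `|W b w - W a w| <= e].

Lemma measurable_meet a b : 0 <= a -> 0 <= b -> measurable (meet a b).
Proof. by move=> a0' b0'; exact: (measurable_near_event BM). Qed.

Let sqrt_lo x : dl <= x -> D <= Num.sqrt x.
Proof. exact: ler_wsqrtr. Qed.

Let sqrt_hi x : x <= 4 * dl -> Num.sqrt x <= 2 * D.
Proof.
move=> x4; rewrite (le_trans (ler_wsqrtr x4))// sqrtrM//.
rewrite (_ : 4 = 2 ^+ 2 :> R); last by ring.
by rewrite sqrtr_sqr ger0_norm.
Qed.

Lemma meet_ge a b : 0 <= a -> dl <= b - a -> b - a <= 4 * dl ->
  (((6 * r)^-1)%:E <= P (meet a b))%E.
Proof.
have [hD hr he hd] := And4 D0 r0 e0 dl0.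
move=> a0 h1 h2; have h3 := sqrt_lo h1; have h4 := sqrt_hi h2.
apply: le_trans (incr_ball_ge BM a0 e0 _); last exact: le_trans eD h3.
rewrite lee_fin (_ : (6 * r)^-1 = e / (6 * D)); last first.
  by rewrite /e; field; rewrite !gt_eqF.
apply: ler_wpM2l; first exact: ltW.
by rewrite lef_pV2 ?posrE; lra.
Qed.

Lemma meet_le a b : 0 <= a -> dl <= b - a -> (P (meet a b) <= (2 / r)%:E)%E.
Proof.
have [hD hr he hd] := And4 D0 r0 e0 dl0.
move=> a0 h1; have h3 := sqrt_lo h1.
have ab : a < b by lra.
apply: le_trans (incr_ball_le BM a0 ab (ltW e0)) _.
rewrite lee_fin (_ : 2 / r = 2 * e / D); last by rewrite /e; field; rewrite !gt_eqF.
apply: ler_wpM2l; first lra.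
by rewrite lef_pV2 ?posrE; lra.
Qed.

Lemma meet2_le a x (i j : 'I_n) : 0 <= a -> dl <= x - a ->
  (P (meet a (gpt x i) `&` meet a (gpt x j)) <= (8 / r * invsqrt R (ndist i j))%:E)%E.
Proof.
have [hD hr he hd] := And4 D0 r0 e0 dl0.
move=> a0 h1.
wlog ij : i j / (i <= j)%N => [hw|].
  have [ij|ij] := leqP i j; first exact: hw.
  by rewrite setIC ndistC; apply: hw; exact: ltnW.
have hi : dl <= gpt x i - a by have := gpt_ge x i; lra.
move: ij; rewrite leq_eqVlt => /orP[/eqP/val_inj <-|ij].
  rewrite setIid (le_trans (meet_le a0 hi))// lee_fin.
  have -> : invsqrt R (ndist i i) = 1 by rewrite /ndist subnn.
  by rewrite mulr1 ler_pM2r ?invr_gt0//; lra.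
have ai : a < gpt x i by lra.
apply: le_trans (incr_ball2_le BM a0 ai (gpt_lt _ ij) (ltW e0)) _.
rewrite lee_fin sqrt_gpt//.
set v := invsqrt R _.
have v0 : 0 < v by exact: invsqrt_gt0.
rewrite (_ : 8 / r * v = 2 * e / D * (4 * e * (r / D * v))); last first.
  by rewrite /e; field; rewrite !gt_eqF.
apply: ler_wpM2r.
  by apply: mulr_ge0; [lra|apply: mulr_ge0; [apply: divr_ge0|]; exact: ltW].
apply: ler_wpM2l; first lra.
have := sqrt_lo hi => h; rewrite lef_pV2 ?posrE; lra.
Qed.

Let box_le a b v : 0 <= a -> a < b -> (Num.sqrt (b - a))^-1 <= v ->
  forall B : set R, measurable B -> (lebesgue_measure B <= (12 * e)%:E)%E ->
     (P (incr W a b @^-1` B) <= (12 * e * v)%:E)%E.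
Proof.
have [hD hr he hd] := And4 D0 r0 e0 dl0.
move=> a0 ab h B mB lB; apply: le_trans (incr_prob_le BM a0 ab mB lB) _.
rewrite -EFinM lee_fin mulrC; apply: ler_wpM2l => //; lra.
Qed.

(** Three independent increments are tied by two approximate linear relations. One outer increment
    is conditioned on; the middle one, over a time at least [dl], then costs [12 / r] and the other
    outer one [12 v]. Either outer increment may be the one that pays, so the relations are required
    in both directions. *)
Lemma pinned_increments_le a b c f (al be v : R) (E : set T) :
  0 <= a -> a < b -> dl <= c - b -> c < f -> measurable E ->
  `|al| <= 1 -> `|be| <= 1 ->
  (forall w, E w ->
    [/\ `|incr W b c w - al * incr W a b w| <= 2 * e,
        `|incr W c f w - be * incr W a b w| <= 2 * e,
        `|incr W b c w - al * incr W c f w| <= 2 * e &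
        `|incr W a b w - be * incr W c f w| <= 2 * e]) ->
  (Num.sqrt (b - a))^-1 <= r / D * v \/ (Num.sqrt (f - c))^-1 <= r / D * v ->
  (P E <= (144 / r * v)%:E)%E.
Proof.
have [hD hr he hd] := And4 D0 r0 e0 dl0.
move=> a0 ab hbc cf mE al1 be1 hE hv.
have b0 : 0 <= b by lra. have bc : b < c by lra.
have c0 : 0 <= c by lra. have f0 : 0 <= f by lra.
have v0 : 0 <= v.
  have rD : 0 < r / D by rewrite divr_gt0.
  rewrite -(pmulr_rge0 _ rD).
  by case: hv => h; apply: le_trans h; rewrite invr_ge0 sqrtr_ge0.
have midv : (Num.sqrt (c - b))^-1 <= D^-1.
  by have := sqrt_lo hbc => h; rewrite lef_pV2 ?posrE; lra.
have p1 : 0 <= 12 * e * D^-1 by apply: mulr_ge0; [lra|rewrite ?mulr_ge0 ?invr_ge0 ?(ltW hD) ?(ltW hr)].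
have p2 : 0 <= 12 * e * (r / D * v) by apply: mulr_ge0; [lra|rewrite ?mulr_ge0 ?invr_ge0 ?(ltW hD) ?(ltW hr)].
have -> : 144 / r * v = (12 * e * D^-1) * (12 * e * (r / D * v)).
  by rewrite /e; field; rewrite !gt_eqF.
case: hv => hv.
  apply: (@prob_pinned_le _ _ _ P (incr W c f) (incr W b c) (incr W a b) E al be e) => //;
    try exact: (measurable_incr BM).
  - move=> B1 B2 B3 m1 m2 m3.
    rewrite setIA setIC [X in _ `&` X]setIC (incr_indep3 BM)//.
    by rewrite muleA muleC [X in (_ * X)%E]muleC.
  - exact: box_le.
  - exact: box_le.
  - by move=> w /hE[].
apply: (@prob_pinned_le _ _ _ P (incr W a b) (incr W b c) (incr W c f) E al be e) => //;
    try exact: (measurable_incr BM).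
- by move=> B1 B2 B3 m1 m2 m3; rewrite (incr_indep3 BM).
- exact: box_le.
- exact: box_le.
- by move=> w /hE[].
Qed.

(** When no index is shared, either gap can be made to pay. The smaller of the two bounds is relaxed
    to their geometric mean, a product of a function of [i, i'] and one of [j, j'], so that the
    fourfold sum factorizes. *)
Lemma meet_pairs_le x y (i i' j j' : 'I_n) : 0 <= x -> x + dl + dl <= y ->
  (P (meet (gpt x i) (gpt y j) `&` meet (gpt x i') (gpt y j')) <=
   (144 / r * ((i == i')%:R + (j == j')%:R +
     Num.sqrt (invsqrt R (ndist i i')) * Num.sqrt (invsqrt R (ndist j j'))))%:E)%E.
Proof.
have [hD hr he hd] := And4 D0 r0 e0 dl0.
move=> x0 xy.
set ri := invsqrt R (ndist i i'); set rj := invsqrt R (ndist j j').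
have ri0 : 0 < ri by exact: invsqrt_gt0.
have rj0 : 0 < rj by exact: invsqrt_gt0.
have g0 : 0 <= Num.sqrt ri * Num.sqrt rj by rewrite mulr_ge0 ?sqrtr_ge0.
have xi k : 0 <= gpt x k by rewrite (le_trans x0).
have yi k : 0 <= gpt y k by have := gpt_ge y k; lra.
have gap (k l : 'I_n) : dl <= gpt y l - gpt x k.
  by have := gpt_ge y l; have := gpt_le x k; lra.
have [tie|] := boolP ((i == i') || (j == j')).
  apply: (@le_trans _ _ (P (meet (gpt x i) (gpt y j)))).
    by apply: le_measure; rewrite ?inE//; [apply: measurableI|]; exact: measurable_meet.
  rewrite (le_trans (meet_le (xi i) (gap i j)))// lee_fin mulrAC.
  rewrite ler_pM2r ?invr_gt0//.
  have : 1 <= (i == i')%:R + (j == j')%:R :> R.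
    by case/orP: tie => ->; rewrite ?lerDl ?lerDr.
  lra.
rewrite negb_or => /andP[ni nj].
rewrite (negbTE ni) (negbTE nj) !add0r.
have key : (P (meet (gpt x i) (gpt y j) `&` meet (gpt x i') (gpt y j')) <= (144 / r * ri)%:E)%E
    /\ (P (meet (gpt x i) (gpt y j) `&` meet (gpt x i') (gpt y j')) <= (144 / r * rj)%:E)%E.
  rewrite /ri /rj {ri rj ri0 rj0 g0}.
  wlog ii : i j i' j' ni nj / (i < i')%N => [hw|].
    have [ii|ii] := ltnP i i'; first exact: hw.
    rewrite setIC ndistC (ndistC j j'); apply: hw; rewrite 1?eq_sym//.
    by rewrite ltn_neqAle ii andbT eq_sym.
  have mE : measurable (meet (gpt x i) (gpt y j) `&` meet (gpt x i') (gpt y j')).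
    by apply: measurableI; exact: measurable_meet.
  (* Crossed pairs: along [x_i < x_i' < y_j < y_j'] the middle increment is nearly opposite to the
     first and the last nearly equal to it. *)
  have [jj|jj] := ltnP j j'.
    have hw w : (meet (gpt x i) (gpt y j) `&` meet (gpt x i') (gpt y j')) w ->
      [/\ `|incr W (gpt x i') (gpt y j) w - (-1) * incr W (gpt x i) (gpt x i') w| <= 2 * e,
        `|incr W (gpt y j) (gpt y j') w - 1 * incr W (gpt x i) (gpt x i') w| <= 2 * e,
        `|incr W (gpt x i') (gpt y j) w - (-1) * incr W (gpt y j) (gpt y j') w| <= 2 * e &
        `|incr W (gpt x i) (gpt x i') w - 1 * incr W (gpt y j) (gpt y j') w| <= 2 * e].
      by rewrite /meet /incr /= !ler_norml => -[/andP[? ?] /andP[? ?]];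
        split; apply/andP; split; lra.
    have nrm1 : `|-1 : R| <= 1 by rewrite normrN normr1.
    by split; apply: (pinned_increments_le (al := -1) (be := 1) (xi i) (gpt_lt x ii)
        (gap i' j) (gpt_lt y jj)) => //; rewrite ?normr1// !sqrt_gpt//; [left|right].
  (* Nested pairs: along [x_i < x_i' < y_j' < y_j] the middle increment is nearly 0 and the outer
     two are nearly opposite. *)
  have {}jj : (j' < j)%N by rewrite ltn_neqAle jj andbT eq_sym.
  have hw w : (meet (gpt x i) (gpt y j) `&` meet (gpt x i') (gpt y j')) w ->
      [/\ `|incr W (gpt x i') (gpt y j') w - 0 * incr W (gpt x i) (gpt x i') w| <= 2 * e,
        `|incr W (gpt y j') (gpt y j) w - (-1) * incr W (gpt x i) (gpt x i') w| <= 2 * e,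
        `|incr W (gpt x i') (gpt y j') w - 0 * incr W (gpt y j') (gpt y j) w| <= 2 * e &
        `|incr W (gpt x i) (gpt x i') w - (-1) * incr W (gpt y j') (gpt y j) w| <= 2 * e].
    by rewrite /meet /incr /= !ler_norml => -[/andP[? ?] /andP[? ?]];
        split; apply/andP; split; lra.
  have nrm1 : `|-1 : R| <= 1 by rewrite normrN normr1.
  rewrite (ndistC j j').
  by split; apply: (pinned_increments_le (al := 0) (be := -1) (xi i) (gpt_lt x ii)
        (gap i' j') (gpt_lt y jj)) => //; rewrite ?normr0// !sqrt_gpt//; [left|right].
case: key => ki kj.
have [rij|rij] := leP ri rj.
  apply: le_trans ki _; rewrite lee_fin ler_pM2l ?divr_gt0//.
  rewrite -{1}(sqr_sqrtr (ltW ri0)) expr2; apply: ler_wpM2l; rewrite ?sqrtr_ge0//.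
  exact: ler_wsqrtr.
apply: le_trans kj _; rewrite lee_fin ler_pM2l ?divr_gt0//.
rewrite -{1}(sqr_sqrtr (ltW rj0)) expr2; apply: ler_wpM2r; rewrite ?sqrtr_ge0//.
by apply: ler_wsqrtr; exact: ltW.
Qed.

End MeetingGrid.

(** * Meetings of three independent paths *)

Section MeetingProbability.
Context (R : realType) (d : measure_display) (T : measurableType d).
Variables (P : probability T R) (W : R -> T -> R).
Hypothesis BM : standard_BM P W.

Definition prob2 : probability (T * T)%type R := (P \x P)%E.
Definition prob3 : probability (T * (T * T))%type R := (P \x prob2)%E.

Lemma prob3_rect (A B C : set T) : measurable A -> measurable B -> measurable C ->
  prob3 (A `*` (B `*` C)) = (P A * (P B * P C))%E.
Proof.
move=> mA mB mC.
have -> : prob3 (A `*` (B `*` C)) = (P A * prob2 (B `*` C))%E.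
  by apply: (product_measure1E P prob2) => //; exact: measurableX.
by congr (_ * _)%E; exact: product_measure1E.
Qed.

Definition gridpt (dl : R) (n : nat) (x : R) (i : nat) : R := x + dl * (i%:R / n%:R).

(* Up to [e = sqrt (dl / n)], the first path at grid time [x] is back at its value at [t], the
   second has equal values at the grid times [x] and [y], and the third takes at [y] its
   value at [t + dl]. *)
Definition meeting (t dl : R) (n : nat) (k : 'I_n * 'I_n) : set (T * (T * T)) :=
  let x := gridpt dl n (t + dl * 2) k.1 in
  let y := gridpt dl n (t + dl * 4) k.2 in
  meet W dl n t x `*` (meet W dl n x y `*` meet W dl n (t + dl) y).

Lemma gridpt_itv dl n x (i : 'I_n) : 0 < dl -> x <= gridpt dl n x i <= x + dl.
Proof.
move=> dl0; have n0 : (0 < n)%N by case: n i => [[]|].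
apply/andP; split; first by rewrite lerDl mulr_ge0 ?divr_ge0// ltW.
rewrite lerD2l ler_piMr ?(ltW dl0)// ler_pdivrMr ?ltr0n// mul1r ler_nat.
exact: ltnW.
Qed.

(** [216 = 6 ^ 3] comes from three uses of [meet_ge], [9216 = 8 * 144 * 8] from the pair bounds on
    the three paths, 112 from [second_moment_sum_le]. The point is that the bound depends on neither
    [n] nor [dl]. *)
Lemma meeting_prob_ge t dl n : 0 <= t -> 0 < dl -> (0 < n)%N ->
  (((9216 * 112 * 216 ^+ 2)^-1)%:E <=
   prob3 (\bigcup_(k in [set: 'I_n * 'I_n]) meeting t dl k))%E.
Proof.
move=> t0 dl0 n0.
set r : R := Num.sqrt n%:R.
have r0 : 0 < r by rewrite sqrtr_gt0 ltr0n.
have r2 : n%:R = r ^+ 2 by rewrite sqr_sqrtr.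
pose m : R := r / 216.
(* The windows [[t + 2 dl, t + 3 dl]] and [[t + 4 dl, t + 5 dl]] keep the two times of each of the
   three meetings between [dl] and [4 dl] apart. *)
have xi (i : 'I_n) := gridpt_itv (t + dl * 2) i dl0.
have yi (i : 'I_n) := gridpt_itv (t + dl * 4) i dl0.
have mrect (A B C : set T) : measurable A -> measurable B -> measurable C ->
    measurable (A `*` (B `*` C)).
  by move=> mA mB mC; apply: measurableX => //; exact: measurableX.
have mm a b : 0 <= a -> 0 <= b -> measurable (meet W dl n a b).
  by move=> ? ?; exact: (measurable_meet BM).
have x0 i : 0 <= gridpt dl n (t + dl * 2) i by rewrite addr_ge0// ?mulr_ge0 ?divr_ge0//; lra.
have y0 i : 0 <= gridpt dl n (t + dl * 4) i by rewrite addr_ge0// ?mulr_ge0 ?divr_ge0//; lra.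
have tdl : 0 <= t + dl by lra.
apply: (@second_moment_prob_ge _ _ _ prob3 _ (@meeting t dl n) m).
- by move=> k; apply: mrect; exact: mm.
- by apply: divr_gt0 => //; rewrite ltr0n.
- by apply: mulr_gt0; [apply: mulr_gt0|apply: exprn_gt0]; rewrite ltr0n.
- have lo k : (((6 * r)^-1 ^+ 3)%:E <= prob3 (@meeting t dl n k))%E.
    have /andP[h1 h2] := xi k.1; have /andP[h3 h4] := yi k.2.
    rewrite prob3_rect; [|exact: mm..].
    rewrite !exprS expr0 mulr1 !EFinM.
    have p0 : (0%R <= ((6 * r)^-1)%:E)%E by rewrite lee_fin invr_ge0; lra.
    apply: lee_pmul => //; [exact: mule_ge0|apply: meet_ge => //; lra|].
    by apply: lee_pmul => //; apply: meet_ge => //; lra.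
  apply: le_trans (lee_sum _ (fun k _ => lo k)).
  rewrite sumEFin lee_fin sumr_const card_prod card_ord -[leRHS]mulr_natr natrM r2.
  rewrite /m (_ : _ * (r ^+ 2 * r ^+ 2) = r / 216)//; field; lra.
- have hi (k l : 'I_n * 'I_n) :
     (prob3 (@meeting t dl n k `&` @meeting t dl n l) <=
      (9216 / r ^+ 3 * (invsqrt R (ndist k.1 l.1) * invsqrt R (ndist k.2 l.2) *
    ((k.1 == l.1)%:R + (k.2 == l.2)%:R +
     Num.sqrt (invsqrt R (ndist k.1 l.1)) * Num.sqrt (invsqrt R (ndist k.2 l.2)))))%:E)%E.
    rewrite /meeting -!setXI prob3_rect; [|by apply: measurableI; exact: mm..].
    rewrite (_ : 9216 / r ^+ 3 * _ = 8 / r * invsqrt R (ndist k.1 l.1) *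
      (144 / r * ((k.1 == l.1)%:R + (k.2 == l.2)%:R +
       Num.sqrt (invsqrt R (ndist k.1 l.1)) * Num.sqrt (invsqrt R (ndist k.2 l.2))) *
       (8 / r * invsqrt R (ndist k.2 l.2)))); last by field; lra.
    rewrite !EFinM.
    apply: lee_pmul => //; first exact: mule_ge0.
      by rewrite -!EFinM; apply: meet2_le => //; lra.
    apply: lee_pmul => //.
      by rewrite -!EFinM; apply: meet_pairs_le => //; lra.
    by rewrite -!EFinM; apply: meet2_le => //; lra.
  apply: (le_trans (lee_sum _ (fun k _ => lee_sum _ (fun l _ => hi k l)))).
  under eq_bigr do rewrite sumEFin.
  rewrite sumEFin lee_fin.
  pose G (i i' j j' : 'I_n) : R := invsqrt R (ndist i i') * invsqrt R (ndist j j') *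
    ((i == i')%:R + (j == j')%:R +
     Num.sqrt (invsqrt R (ndist i i')) * Num.sqrt (invsqrt R (ndist j j'))).
  have -> : \sum_(k : 'I_n * 'I_n) \sum_(l : 'I_n * 'I_n) (9216 / r ^+ 3 * G k.1 l.1 k.2 l.2)
     = 9216 / r ^+ 3 * \sum_(i < n) \sum_(i' < n) \sum_(j < n) \sum_(j' < n) G i i' j j'.
    rewrite mulr_sumr -(pair_big xpredT xpredT (fun i j =>
       \sum_(l : 'I_n * 'I_n) (9216 / r ^+ 3 * G i l.1 j l.2)))/=.
    apply: eq_bigr => i _; rewrite mulr_sumr.
    transitivity (\sum_(i' < n) \sum_(j < n) \sum_(j' < n) 9216 / r ^+ 3 * G i i' j j').
      by rewrite [RHS]exchange_big/=; apply: eq_bigr => j _; rewrite pair_big.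
    apply: eq_bigr => i' _; rewrite mulr_sumr; apply: eq_bigr => j _.
    by rewrite mulr_sumr.
  have := @second_moment_sum_le R n n0; rewrite -/r r2 => h.
  rewrite (_ : 9216 * 112 * 216 ^+ 2 * m ^+ 2 = 9216 / r ^+ 3 * (112 * (r ^+ 2) ^+ 2 * r)); last first.
    by rewrite /m; field; lra.
  apply: ler_wpM2l; last exact: h.
  by apply: divr_ge0; [rewrite ler0n|apply: exprn_ge0; exact: ltW].
Qed.

End MeetingProbability.

(** * Exact meetings and continuity *)

Lemma cvg_rightP (R : realType) (g : R -> R) (t l : R) :
  g s @[s --> t^'+] --> l <->
  (forall e, 0 < e -> exists2 dl, 0 < dl & forall s, t < s -> s < t + dl -> `|g s - l| < e).
Proof.
split => [/cvgrPdist_lt h e e0|h].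
  have [dl /= dl0 hdl] := h e e0.
  exists dl => // s ts sd; rewrite distrC; apply: hdl => //=.
  by rewrite distrC gtr0_norm; lra.
apply/cvgrPdist_lt => e e0; have [dl dl0 hdl] := h e e0.
exists dl => //= s /=; rewrite distrC => sd ts.
by rewrite distrC; apply: hdl => //; rewrite gtr0_norm in sd; lra.
Qed.

Lemma prob_lim_sup_set_ge (R : realType) (d : measure_display) (T : measurableType d)
  (P : probability T R) (F : (set T)^nat) (p : \bar R) :
  (forall k, measurable (F k)) -> (forall k, (p <= P (F k))%E) ->
  (p <= P (lim_sup_set F))%E.
Proof.
move=> mF hF.
have mU n : measurable (\bigcup_(k >= n) F k) by exact: bigcup_measurable.
apply: (cvge_to_ge (lim_sup_set_cvg P F mF _)); last first.
  apply: nearW => n; apply: le_trans (hF n) _.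
  apply: le_measure; rewrite ?inE; [exact: mF|exact: mU|].
  by move=> x Fx; exists n => /=.
by apply: (le_lt_trans (probability_le1 _ (mU 0%N))); rewrite ltry.
Qed.

Section ExactMeeting.
Context (R : realType) (d : measure_display) (T : measurableType d).
Variables (P : probability T R) (W : R -> T -> R).
Hypothesis BM : standard_BM P W.

(** Paths are continuous only within [[0, +oo[]; freezing them at negative times gives functions
    continuous on all of [R], fit for compactness and intermediate values. *)
Lemma continuous_BM_max w : continuous (fun s : R => W (Num.max 0 s) w : R).
Proof.
case: BM => _ [_ [+ _]] => /(_ w) /subspace_continuousP cW x.
have mx0 : [set` `[0, +oo[] (Num.max 0 x) by rewrite /= in_itv/= andbT le_max lexx.
move=> S /(cW _ mx0) h.
have {}h : \forall z \near Num.max 0 x, [set` `[0, +oo[] z -> S (W z w) by exact: h.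
have cmx : Num.max 0 y @[y --> x] --> Num.max 0 x.
  by apply: (@continuous_max _ _ (cst 0) id) => z; [exact: cvg_cst|exact: cvg_id].
have h2 : \forall y \near x, [set` `[0, +oo[] (Num.max 0 y) -> S (W (Num.max 0 y) w).
  exact: (cmx _ h).
apply: filterS h2 => y; apply.
by rewrite /= in_itv/= andbT le_max lexx.
Qed.

Definition meeting_near (t dl : R) (n : nat) : set (T * (T * T)) :=
  \bigcup_(k in [set: 'I_n.+1 * 'I_n.+1]) meeting W t dl k.

Lemma measurable_meeting_near t dl n : 0 <= t -> 0 < dl ->
  measurable (meeting_near t dl n).
Proof.
move=> t0 dl0; apply: fin_bigcup_measurable => [|k _]; first exact: finite_finset.
have g0 x (i : 'I_n.+1) : 0 <= x -> 0 <= gridpt dl n.+1 x i.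
  by move=> x0; have /andP[+ _] := gridpt_itv x i dl0; exact: le_trans.
have x0 := g0 (t + dl * 2) k.1; have y0 := g0 (t + dl * 4) k.2.
by apply: measurableX; [|apply: measurableX]; apply: (measurable_meet BM) => //;
  rewrite ?x0 ?y0//; lra.
Qed.

(** [Phi] adds up the three defects. It attains its minimum on the compact square of times, and
    approximate meetings at arbitrarily fine scales [sqrt (dl / (n + 1))] force this minimum to be
    0. *)
Lemma exact_meeting t dl w : 0 <= t -> 0 < dl ->
  lim_sup_set (meeting_near t dl) w ->
  exists s s' : R, [/\ t <= s <= t + dl * 5, t <= s' <= t + dl * 5,
    W s w.1 = W t w.1, W s w.2.1 = W s' w.2.1 & W s' w.2.2 = W (t + dl) w.2.2].
Proof.
move=> t0 dl0 hw.
pose V w (s : R) : R := W (Num.max 0 s) w.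
pose A : set R := `[t, t + dl * 5]%classic.
pose Phi (z : R * R) : R := `|V w.1 z.1 - W t w.1| + `|V w.2.1 z.1 - V w.2.1 z.2| +
  `|V w.2.2 z.2 - W (t + dl) w.2.2|.
have cV w' : continuous (V w') by exact: continuous_BM_max.
have cPhi : continuous Phi.
  move=> z.
  have c1 w' : (fun z : R * R => V w' z.1) @ z --> V w' z.1.
    by apply: (cvg_comp (fun z : R * R => z.1) (V w')); [exact: cvg_fst|exact: cV].
  have c2 w' : (fun z : R * R => V w' z.2) @ z --> V w' z.2.
    by apply: (cvg_comp (fun z : R * R => z.2) (V w')); [exact: cvg_snd|exact: cV].
  by apply: cvgD; [apply: cvgD|]; apply: cvg_norm; apply: cvgB => //; exact: cvg_cst.
have [|||z /set_mem Az zmin] := @compact_EVT_min _ R Phi (A `*` A).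
- by exists (t, t) => /=; rewrite /A /= in_itv/= lexx; split; lra.
- by apply: compact_setX; exact: segment_compact.
- exact: continuous_subspaceT.
have V_eq w' s : t <= s -> V w' s = W s w'.
  by move=> ts; rewrite /V max_r//; lra.
have Phi0 : Phi z = 0.
  apply/eqP; rewrite eq_le; apply/andP; split; last by rewrite !addr_ge0.
  rewrite leNgt; apply/negP => Pz.
  have D0 : 0 < Num.sqrt dl by rewrite sqrtr_gt0.
  pose N := Num.trunc ((3 * Num.sqrt dl / Phi z) ^+ 2).
  have [n /= Nn [[i j] _]] := hw N I.
  rewrite /meeting /meet /= => -[h1 [h2 h3]].
  set e := Num.sqrt dl / _ in h1 h2 h3.
  have eP : 3 * e < Phi z.
    rewrite /e mulrA ltr_pdivrMr ?sqrtr_gt0 ?ltr0n// [ltRHS]mulrC -ltr_pdivrMr//.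
    have pos : 0 <= 3 * Num.sqrt dl / Phi z by rewrite divr_ge0 ?mulr_ge0// ltW.
    rewrite -(ger0_norm pos) -sqrtr_sqr ltr_sqrt ?ltr0n//.
    have /truncn_itv/andP[_ h] : 0 <= (3 * Num.sqrt dl / Phi z) ^+ 2 by exact: sqr_ge0.
    by apply: lt_le_trans h _; rewrite ler_nat ltnS.
  set x := gridpt _ _ _ i in h1 h2; set y := gridpt _ _ _ j in h2 h3.
  have /andP[x1 x2] := gridpt_itv (t + dl * 2) i dl0.
  have /andP[y1 y2] := gridpt_itv (t + dl * 4) j dl0.
  rewrite -/x -/y in x1 x2 y1 y2.
  have Axy : (x, y) \in A `*` A.
    by rewrite inE /A /= !in_itv/=; split; apply/andP; split; lra.
  have := zmin _ Axy; rewrite {2}/Phi /= !V_eq; try lra.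
  rewrite distrC in h2.
  lra.
exists z.1, z.2; case: Az; rewrite /A /= !in_itv/= => z1 z2.
have /andP[z1t _] := z1; have /andP[z2t _] := z2.
move: Phi0; rewrite /Phi !V_eq// => /eqP.
rewrite paddr_eq0 ?addr_ge0// paddr_eq0// !normr_eq0 !subr_eq0.
by move=> /andP[/andP[/eqP e1 /eqP e2] /eqP e3].
Qed.

(** The bound [p] does not depend on [k], so infinitely many [F k] occur together with probability
    at least [p]: one triple of paths serves for infinitely many of the times [u k]. *)
Lemma exact_meeting_often t (u : nat -> R) : 0 <= t -> (forall k, t < u k) ->
  exists w : T * (T * T), forall K : nat, exists2 k, (K <= k)%N &
  exists s s' : R, [/\ t <= s <= t + (u k - t) * 5, t <= s' <= t + (u k - t) * 5,
    W s w.1 = W t w.1, W s w.2.1 = W s' w.2.1 & W s' w.2.2 = W (u k) w.2.2].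
Proof.
move=> t0 ut.
have du k : 0 < u k - t by rewrite subr_gt0.
pose F k := lim_sup_set (meeting_near t (u k - t)).
pose p : R := (9216 * 112 * 216 ^+ 2)^-1.
have p0 : 0 < p.
  by rewrite invr_gt0; apply: mulr_gt0; [apply: mulr_gt0|apply: exprn_gt0]; rewrite ltr0n.
have mM k n : measurable (meeting_near t (u k - t) n) by exact: measurable_meeting_near.
have mF k : measurable (F k).
  by apply: bigcap_measurable => // n _; exact: bigcup_measurable.
have pF k : (p%:E <= prob3 P (F k))%E.
  by apply: prob_lim_sup_set_ge => // n; exact: (meeting_prob_ge BM).
have : (p%:E <= prob3 P (lim_sup_set F))%E by exact: prob_lim_sup_set_ge.
have [[w hw] _|h] := pselect (lim_sup_set F !=set0).
  exists w => K; have [k /= Kk Fk] := hw K I; exists k => //.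
  have [s [s' h]] := exact_meeting t0 (du k) Fk.
  by exists s, s'; rewrite (_ : t + (u k - t) = u k) in h; last by ring.
have -> : lim_sup_set F = set0 by apply/eqP/negPn/negP => /set0P.
by rewrite measure0 lee_fin leNgt p0.
Qed.

(* If [c] jumped at [t], exact meetings at times shrinking to [t] would chain
   [c t], [c s], [c s'] and [c (u k)] through values of the right-continuous [N]. *)
Lemma right_continuous_normalizer (f c : R -> R) :
  (forall x, 0 < f x) -> (forall s, 0 < c s) ->
  right_continuous_process (fun s w => f (W s w) / c s) ->
  forall t, 0 <= t -> c s @[s --> t^'+] --> c t.
Proof.
move=> f0 c0 rc t t0.
have N0 s w : 0 < f (W s w) / c s by rewrite divr_gt0.
pose n s w := ln (f (W s w) / c s).
have lnE s w : ln (c s) = ln (f (W s w)) - n s w.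
  by rewrite /n ln_div ?posrE//; ring.
have nr w : n s w @[s --> t^'+] --> n t w.
  apply: (cvg_comp (fun s => f (W s w) / c s) (@ln R)); first exact: rc.
  exact: continuous_ln.
suff h : ln (c s) @[s --> t^'+] --> ln (c t).
  rewrite -(lnK (x := c t)) ?posrE//.
  under eq_cvg do rewrite -(lnK (x := c _)) ?posrE//.
  by apply: (cvg_comp (fun s => ln (c s)) expR h); exact: continuous_expR.
apply/cvg_rightP => e e0; apply: contrapT => /forall2NP hn.
have {}hn k : exists s : R, [/\ t < s, s < t + k.+1%:R^-1 & e <= `|ln (c s) - ln (c t)|].
  have [/negP|] := hn (k.+1%:R^-1); first by rewrite invr_gt0 ltr0n.
  move/existsNP => [s /not_implyP[ts /not_implyP[st /negP]]].
  by rewrite -leNgt => h; exists s.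
have [u hu] := choice hn.
have [|w hw] := @exact_meeting_often t u t0; first by move=> k; have [] := hu k.
(* Five deviations from the value at [t] will add up: one on the first path, two on each of the
   others. *)
have e7 : 0 < e / 7 by rewrite divr_gt0.
have /cvg_rightP/(_ _ e7)[d1 d10 h1] := nr w.1.
have /cvg_rightP/(_ _ e7)[d2 d20 h2] := nr w.2.1.
have /cvg_rightP/(_ _ e7)[d3 d30 h3] := nr w.2.2.
pose dm := Num.min d1 (Num.min d2 d3).
have dm0 : 0 < dm by rewrite !lt_min d10 d20.
have close w' dw : (forall s, t < s -> s < t + dw -> `|n s w' - n t w'| < e / 7) ->
    forall s, t <= s -> s < t + dw -> `|n s w' - n t w'| < e / 7.
  move=> h s; rewrite le_eqVlt => /orP[/eqP<- _|ts]; last exact: h.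
  by rewrite subrr normr0.
have [k Kk [s [s' [/andP[s1 s2] /andP[s'1 s'2] e1 e2 e3]]]] := hw (Num.trunc (5 / dm)).
have [uk1 uk2 uk3] := hu k.
have win : (u k - t) * 5 < dm.
  have kdm : k.+1%:R^-1 * 5 < dm.
    rewrite mulrC ltr_pdivrMr ?ltr0n// mulrC -ltr_pdivrMr//.
    have /truncn_itv/andP[_ h] : 0 <= 5 / dm by rewrite divr_ge0// ltW.
    by apply: lt_le_trans h _; rewrite ler_nat ltnS.
  have : u k - t < k.+1%:R^-1 by rewrite ltrBlDl.
  by rewrite -(ltr_pM2r (_ : 0 < 5))// => /lt_trans; apply.
have [m1 m2 m3] : [/\ dm <= d1, dm <= d2 & dm <= d3].
  by rewrite /dm !ge_min !lexx !orbT.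
have a1 : `|n s w.1 - n t w.1| < e / 7 by apply: close h1 _ _ _ => //; lra.
have a2 : `|n s w.2.1 - n t w.2.1| < e / 7 by apply: close h2 _ _ _ => //; lra.
have a3 : `|n s' w.2.1 - n t w.2.1| < e / 7 by apply: close h2 _ _ _ => //; lra.
have a4 : `|n s' w.2.2 - n t w.2.2| < e / 7 by apply: close h3 _ _ _ => //; lra.
have a5 : `|n (u k) w.2.2 - n t w.2.2| < e / 7 by apply: close h3 _ _ _ => //; lra.
have b1 : ln (c s) - ln (c t) = n t w.1 - n s w.1.
  by rewrite (lnE s w.1) (lnE t w.1) e1; ring.
have b2 : ln (c s') - ln (c s) = n s w.2.1 - n s' w.2.1.
  by rewrite (lnE s w.2.1) (lnE s' w.2.1) e2; ring.
have b3 : ln (c (u k)) - ln (c s') = n s' w.2.2 - n (u k) w.2.2.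
  by rewrite (lnE s' w.2.2) (lnE (u k) w.2.2) e3; ring.
move: uk3; rewrite leNgt => /negP; apply.
rewrite !ltr_norml in a1 a2 a3 a4 a5 *.
move: a1 a2 a3 a4 a5 => /andP[? ?] /andP[? ?] /andP[? ?] /andP[? ?] /andP[? ?].
by apply/andP; split; lra.
Qed.

End ExactMeeting.

(** * From continuity in time to continuity in space *)

Lemma normal_prob_itv_gt0 (R : realType) (s a b : R) : 0 < s -> a < b ->
  (0 < normal_prob 0 s `]a, b[%classic)%E.
Proof.
move=> s0 ab; have s1 : s != 0 by rewrite gt_eqF.
pose M := `|a| + `|b|.
pose k := normal_peak s * expR (- M ^+ 2 / (s ^+ 2 *+ 2)).
have k0 : 0 < k by rewrite mulr_gt0 ?expR_gt0// normal_peak_gt0.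
apply: (@lt_le_trans _ _ (\int[lebesgue_measure]_(x in `]a, b[%classic) (cst (k%:E) x))%E).
  by rewrite integral_cst//= lebesgue_measure_itv/= lte_fin ab -EFinB -EFinM lte_fin mulr_gt0// subr_gt0.
apply: ge0_le_integral => //=.
- by move=> x _; rewrite lee_fin ltW.
- apply/measurable_EFinP/measurable_funTS; exact: measurable_normal_pdf.
- move=> x; rewrite in_itv/= => /andP[ax xb]; rewrite lee_fin normal_pdfE//.
  apply: ler_wpM2l; first exact: normal_peak_ge0.
  rewrite /normal_fun subr0 ler_expR ler_pM2r; last first.
    by rewrite invr_gt0 mulrn_wgt0// exprn_gt0.
  rewrite lerN2 -(real_normK (num_real x)) lerXn2r ?nnegrE ?addr_ge0//.
  rewrite /M; have := ler_norm b; have := ler_norm (- a); rewrite normrN => h1 h2.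
  have := normr_ge0 a; have := normr_ge0 b => h3 h4.
  by rewrite ler_norml; apply/andP; split; lra.
Qed.

Lemma right_continuous_of_path (R : realType) (f V : R -> R) (a b x : R) :
  continuous V -> a <= b -> V a <= x -> x < V b ->
  (forall t, a <= t -> f (V s) @[s --> t^'+] --> f (V t)) ->
  f y @[y --> x^'+] --> f x.
Proof.
move=> cV ab Va Vb rc.
(* [t0] is the last time at which [V <= x]; just after [t0], [V] takes all values just above [x]. *)
pose S := `[a, b]%classic `&` V @^-1` [set y | y <= x].
have [|||t0 /set_mem[t0ab Vt0] t0max] := @compact_EVT_max _ R id S.
- by exists a; split => //=; rewrite in_itv/= lexx.
- apply: (@subclosed_compact _ _ `[a, b]%classic); last exact: subIsetl.
    apply: closedI; first exact: itv_closed.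
    by apply: closed_comp => [z _|]; [exact: cV|exact: closed_le].
  exact: segment_compact.
- by apply: continuous_subspaceT => z; exact: cvg_id.
move: t0ab; rewrite /= in_itv/= => /andP[at0 t0b].
have t0S s : t0 <= s -> s <= b -> V s <= x -> s = t0.
  move=> ts sb Vs; apply/eqP; rewrite eq_le ts andbT.
  by apply: t0max; rewrite inE; split => //=; rewrite in_itv/= sb andbT (le_trans at0).
have ivt t1 y : t0 <= t1 -> x <= y -> y < V t1 -> exists2 s, t0 <= s <= t1 & V s = y.
  move=> tt xy yV; have [||s] := @IVT R V t0 t1 y tt.
  - exact: continuous_subspaceT.
  - by rewrite ge_min le_max (le_trans Vt0 xy) (ltW yV) orbT.
  by rewrite in_itv/= => ? ?; exists s.
have Vt0x : V t0 = x.
  have [s /andP[s1 s2] Vs] := ivt b x t0b (lexx _) Vb.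
  by rewrite -(t0S s)// Vs.
have t0b' : t0 < b.
  by rewrite lt_neqAle t0b andbT; apply: contraTneq Vb => <-; rewrite Vt0x ltxx.
apply/cvg_rightP => e e0.
have /cvg_rightP/(_ e e0)[dl dl0 hdl] := rc t0 at0.
pose t1 := Num.min b (t0 + dl / 2).
have t01 : t0 < t1 by rewrite lt_min t0b'/=; lra.
have t1b : t1 <= b by rewrite ge_min lexx.
have t1d : t1 <= t0 + dl / 2 by rewrite ge_min lexx orbT.
have Vt1 : x < V t1.
  rewrite ltNge; apply/negP => h.
  by have := t0S t1 (ltW t01) t1b h; lra.
exists (V t1 - x); first by rewrite subr_gt0.
move=> y xy yV; have yV1 : y < V t1 by lra.
have [s /andP[s1 s2] Vs] := ivt t1 y (ltW t01) (ltW xy) yV1.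
rewrite -Vs -Vt0x; apply: hdl; last lra.
by rewrite lt_neqAle s1 andbT; apply: contraTneq xy => e1; rewrite -Vs -e1 Vt0x ltxx.
Qed.

(** Reflection turns right-continuity at [- x] into left-continuity at [x]. *)
Lemma even_right_continuous (R : realType) (f : R -> R) :
  (forall x, f (- x) = f x) -> (forall x, f y @[y --> x^'+] --> f x) -> continuous f.
Proof.
move=> fe fr x; apply/cvgrPdist_lt => e e0.
have /cvg_rightP/(_ e e0)[d1 d10 h1] := fr x.
have /cvg_rightP/(_ e e0)[d2 d20 h2] := fr (- x).
exists (Num.min d1 d2); first by rewrite /= lt_min d10.
move=> y /=; rewrite lt_min => /andP[y1 y2].
have [xy|xy|<-] := ltgtP x y; last by rewrite subrr normr0.
  by rewrite distrC; apply: h1 => //; rewrite ltr0_norm in y1; lra.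
rewrite distrC -(fe y) -(fe x); apply: h2; first by rewrite ltrN2.
by rewrite gtr0_norm in y2; lra.
Qed.

Section ContinuityOfF.
Context (R : realType) (d : measure_display) (T : measurableType d).
Variables (P : probability T R) (W : R -> T -> R).
Hypothesis BM : standard_BM P W.

(** Increments in []x - 1, x[] and []1, 2[] suffice, since then [W 2 > (x - 1) + 1]. The positive
    probability only serves to exhibit one path. *)
Lemma crossing_path x : exists w, W 1 w < x /\ x < W 2 w.
Proof.
have h : (0 < P (incr W 0 1 @^-1` `](x - 1)%R, x[ `&` incr W 1 2 @^-1` `]1%R, 2%R[))%E.
  have h12 : 1 < 2 :> R by lra.
  rewrite (incr_indep2 BM (lexx 0) ltr01 h12 (measurable_itv _) (measurable_itv _)).
  case: BM => _ [_ [_ [law _]]].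
  rewrite (law _ _ (lexx 0) ltr01 _ (measurable_itv _)) (law _ _ ler01 h12 _ (measurable_itv _)).
  by rewrite mule_gt0//; apply: normal_prob_itv_gt0; rewrite ?sqrtr_gt0; lra.
have [[w [h1 h2]]|hn] := pselect ((incr W 0 1 @^-1` `](x - 1)%R, x[ `&`
    incr W 1 2 @^-1` `]1%R, 2%R[) !=set0).
  exists w; move: h1 h2; rewrite /incr /= !in_itv/= (BM0 BM) subr0.
  by move=> /andP[? ?] /andP[? ?]; split; lra.
move: h; rewrite (_ : _ `&` _ = set0) ?measure0 ?ltxx//.
by apply/eqP/negPn/negP => /set0P.
Qed.

Lemma continuous_of_martingale_ratio (f c : R -> R) :
  (forall x, 0 < f x) -> (forall x, f (- x) = f x) -> (forall s, 0 < c s) ->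
  right_continuous_process (fun s w => f (W s w) / c s) ->
  continuous f.
Proof.
move=> f0 fe c0 rc; apply: even_right_continuous => // x.
have cr := right_continuous_normalizer BM f0 c0 rc.
have [w [w1 w2]] := crossing_path x.
have r w' t : 0 <= t -> f (W s w') @[s --> t^'+] --> f (W t w').
  move=> t0.
  have e s : f (W s w') = f (W s w') / c s * c s by rewrite divfK// gt_eqF.
  rewrite e; under eq_cvg do rewrite e.
  by apply: cvgM; [exact: rc|exact: cr].
apply: (@right_continuous_of_path _ f (fun s => W (Num.max 0 s) w) 1 2 x).
- exact: (continuous_BM_max BM).
- lra.
- by rewrite max_r//; lra.
- by rewrite max_r//; lra.
- move=> t t1; have t0 : 0 <= t by lra.
  rewrite (max_r t0).
  apply/cvg_rightP => e e0; have /cvg_rightP/(_ e e0)[dl dl0 h] := r w t t0.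
  by exists dl => // s ts sd; rewrite max_r; [exact: h|lra].
Qed.

End ContinuityOfF.

(** * Independence of increments from the past *)

Section IndependentPair.
Local Open Scope ereal_scope.
Context (R : realType) (d d1 d2 : measure_display) (T : measurableType d)
  (T1 : measurableType d1) (T2 : measurableType d2).

(** The law of [(U, V)] and the product of the law of [U] with [Q] agree on rectangles, hence
    everywhere; Tonelli's theorem then splits the integral. *)
Lemma integral_independent_pair (P : probability T R) (Q : probability T2 R)
  (U : T -> T1) (V : T -> T2) (h : T1 * T2 -> \bar R) :
  measurable_fun setT U -> measurable_fun setT V ->
  (forall B C, measurable B -> measurable C ->
    P (U @^-1` B `&` V @^-1` C) = P (U @^-1` B) * Q C) ->
  measurable_fun setT h -> (forall z, 0 <= h z) ->
  \int[P]_w h (U w, V w) = \int[P]_w \int[Q]_y h (U w, y).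
Proof.
move=> mU mV ind mh h0.
pose X : {RV P >-> T1} := HB.pack U (isMeasurableFun.Build _ _ _ _ _ mU).
have mUV : measurable_fun setT (fun w => (U w, V w)) by exact: measurable_fun_pair.
pose Y : {RV P >-> (T1 * T2)%type} :=
  HB.pack (fun w => (U w, V w)) (isMeasurableFun.Build _ _ _ _ _ mUV).
transitivity (\int[distribution P Y]_z h z).
  by rewrite ge0_integral_distribution.
transitivity (\int[distribution P X \x Q]_z h z).
  apply: eq_measure_integral => A mA _; apply/esym.
  exact: product_measure_unique.
rewrite fubini_tonelli1// ge0_integral_distribution//.
- exact: measurable_fun_fubini_tonelli_F.
- by move=> x; exact: integral_ge0.
Qed.

End IndependentPair.

Section PiSystemIndependence.
Local Open Scope ereal_scope.
Context (R : realType) (d : measure_display) (T : measurableType d).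

(** For fixed [D] both sides are finite measures in [A], so agreement on the pi-system [G] extends
    to the sigma-algebra it generates. *)
Lemma pi_system_independence (P : probability T R) (G : set (set T)) (D : set T) :
  G `<=` measurable -> setI_closed G -> G setT -> measurable D ->
  (forall A, G A -> P (A `&` D) = P A * P D) ->
  forall A, <<s G >> A -> P (A `&` D) = P A * P D.
Proof.
move=> Gm GI GT mD ind A GA.
have PD0 : (0 <= fine (P D))%R by exact: fine_ge0.
have PDE : (NngNum PD0)%:num%:E = P D by rewrite /= fineK// fin_num_measure.
rewrite [RHS]muleC -PDE.
apply: (g_sigma_algebra_measure_unique G Gm (fun=> setT) (fun=> GT) _
  (mrestr P mD) (mscale (NngNum PD0) P) GI _ _ A GA).
- by rewrite bigcup_const.
- move=> B GB; transitivity (P B * P D); first exact: ind.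
  by rewrite muleC; congr (_ * _).
- move=> _; apply: (le_lt_trans (probability_le1 P (measurableI _ _ measurableT mD))).
  by rewrite ltry.
Qed.

End PiSystemIndependence.

Section FiltrationIndependence.
Context (R : realType) (d : measure_display) (T : measurableType d).
Variables (P : probability T R) (W : R -> T -> R).
Hypothesis BM : standard_BM P W.

Definition incr_rects (q : nat -> R) (m : nat) : set (set T) :=
  [set A | exists B : nat -> set R, (forall i, measurable (B i)) /\
     A = \bigcap_(i in [set i | (i < m)%N]) (incr W (q i) (q i.+1) @^-1` B i)].

Lemma incr_rects_independence (q : nat -> R) m s t A C :
  0 <= q 0%N -> (forall i, (i < m)%N -> q i < q i.+1) -> q m = s -> s < t ->
  <<s incr_rects q m >> A -> measurable C ->
  P (A `&` incr W s t @^-1` C) = (P A * P (incr W s t @^-1` C))%E.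
Proof.
move=> q0 qlt qm st GA mC.
have qge i : (i <= m)%N -> 0 <= q i.
  elim: i => // i IH im; apply: (le_trans (IH (ltnW im))); exact/ltW/qlt.
have s0 : 0 <= s by rewrite -qm qge.
have t0 : 0 <= t by lra.
have mrect B : (forall i, measurable (B i)) ->
    measurable (\bigcap_(i in [set i | (i < m)%N]) (incr W (q i) (q i.+1) @^-1` B i)).
  move=> mB; apply: bigcap_measurableType => i /= im.
  by apply: (measurable_preimage_incr BM) => //; apply: qge => //; exact: ltnW.
apply: (pi_system_independence (G := incr_rects q m)) => //.
- by move=> _ [B [mB ->]]; exact: mrect.
- move=> _ _ [B [mB ->]] [B' [mB' ->]]; exists (fun i => B i `&` B' i); split.
    by move=> i; exact: measurableI.
  by rewrite -bigcapI; apply: eq_bigcapr => i _; rewrite preimage_setI.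
- exists (fun=> setT); split => //.
  by apply/seteqP; split.
- exact: (measurable_preimage_incr BM).
move=> _ [B [mB ->]].
case: BM => _ [_ [_ [_ ind]]].
(* The grid [q] followed by [t] at index [m + 1]; later values are mere filling. *)
pose tt i := if (i <= m)%N then q i else t + (i - m.+1)%:R.
have tt0 : 0 <= tt 0%N by [].
have ttlt k : (k < m.+1)%N -> tt k < tt k.+1.
  rewrite ltnS => km; rewrite /tt km; case: ltnP => km'; first exact: qlt.
  have -> : k = m by lia.
  by rewrite qm subnn addr0.
have ttlt' k : (k < m)%N -> tt k < tt k.+1 by move=> km; apply: ttlt; lia.
have tt_q k : (k < m)%N -> tt k = q k /\ tt k.+1 = q k.+1.
  by move=> km; rewrite /tt (ltnW km) km.
pose B1 i := if (i < m)%N then B i else C.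
have mB1 i : measurable (B1 i) by rewrite /B1; case: ifP.
have := ind m.+1 tt tt0 ttlt B1 mB1; rewrite big_ord_recr/=.
have ttm : tt m = s by rewrite /tt leqnn.
have ttm1 : tt m.+1 = t by rewrite /tt ltnn subnn addr0.
rewrite ttm ttm1 {3}/B1 ltnn.
have e0 : \bigcap_(i in [set i | (i < m)%N]) (incr W (tt i) (tt i.+1) @^-1` B1 i) =
    \bigcap_(i in [set i | (i < m)%N]) (incr W (q i) (q i.+1) @^-1` B i).
  by apply: eq_bigcapr => i /= im; rewrite /B1 im; have [-> ->] := tt_q i im.
have -> : (\prod_(i < m) P (incr W (tt i) (tt i.+1) @^-1` B1 i))%E =
    P (\bigcap_(i in [set i | (i < m)%N]) (incr W (q i) (q i.+1) @^-1` B i)).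
  by rewrite -e0 (ind m tt tt0 ttlt' B1 mB1).
move=> <-; congr (P _).
rewrite -e0; apply/seteqP; split => w /=.
  move=> [h1 h2] k /=; rewrite ltnS leq_eqVlt => /orP[/eqP->|km]; last exact: h1.
  by rewrite ttm ttm1 /B1 ltnn.
move=> h; split => [k /= km|].
  by apply: h => /=; exact: ltnW.
by have := h m (ltnSn m); rewrite ttm ttm1 /B1 ltnn.
Qed.

Lemma measurable_BM_incr_rects (q : nat -> R) m i B : q 0%N = 0 -> (i <= m)%N ->
  measurable B -> <<s incr_rects q m >> (W (q i) @^-1` B).
Proof.
move=> q0 im mB.
pose T' := g_sigma_algebraType (incr_rects q m).
have mi : forall k, (k < m)%N ->
    measurable_fun [set: T'] (incr W (q k) (q k.+1) : T' -> R).
  move=> k km _ D mD; rewrite setTI; apply: sub_sigma_algebra.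
  exists (fun l => if l == k then D else setT); split => [l|].
    by case: ifP.
  apply/seteqP; split => w /=.
    by move=> h l /= lm; case: eqP => // ->.
  by move=> /(_ k km); rewrite eqxx.
have mW : measurable_fun [set: T'] (W (q i) : T' -> R).
  elim: i im => [|i IH] im.
    rewrite q0 (_ : W 0 = cst 0); last by apply/funext => w; exact: (BM0 BM).
    exact: measurable_cst.
  rewrite (_ : W (q i.+1) = fun w => W (q i) w + incr W (q i) (q i.+1) w); last first.
    by apply/funext => w; rewrite /incr; ring.
  by apply: (@measurable_funD _ T' R); [apply: IH; exact: ltnW|exact: mi].
by have := mW measurableT B mB; rewrite setTI.
Qed.

(** Unlike the generators of the filtration, these sets are closed under intersection, by
    concatenation of the lists, and each of them is an event about increments along one grid. *)
Definition BM_cylinders (s : R) : set (set T) :=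
  [set A | exists l : seq (R * set R),
    (forall p, List.In p l -> [/\ 0 <= p.1, p.1 <= s & measurable p.2]) /\
    A = [set w | forall p, List.In p l -> p.2 (W p.1 w)]].

(** Adding 0 to the times lets positions be recovered as sums of increments; adding [s] makes the
    next increment start where the grid ends. *)
Lemma sorted_grid (s : R) (rs : seq R) : 0 <= s ->
  (forall r, r \in rs -> 0 <= r <= s) ->
  exists (q : nat -> R) (m : nat), [/\ q 0%N = 0, q m = s,
    forall i, (i < m)%N -> q i < q i.+1 &
    forall r, r \in rs -> exists2 i, (i <= m)%N & q i = r].
Proof.
move=> s0 hrs.
pose l := sort <=%R (undup (0 :: s :: rs)).
have lE r : (r \in l) = (r \in 0 :: s :: rs) by rewrite mem_sort mem_undup.
have l_itv r : r \in l -> 0 <= r <= s.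
  rewrite lE !inE => /orP[/eqP->|/orP[/eqP->|/hrs//]]; by rewrite ?lexx s0.
have l_lt : sorted <%R l by rewrite sort_lt_sorted undup_uniq.
have l0 : (0 < size l)%N.
  rewrite lt0n size_eq0; apply/eqP => l0; have := lE 0.
  by rewrite l0 in_nil mem_head.
have idx r : r \in 0 :: s :: rs -> exists2 i, (i <= (size l).-1)%N & nth 0 l i = r.
  rewrite -lE => rl; exists (index r l); last exact: nth_index.
  by rewrite -ltnS prednK// index_mem.
have nthle i j : (i <= j)%N -> (j < size l)%N -> nth 0 l i <= nth 0 l j.
  by move=> ij jl; rewrite (lt_sorted_leq_nth 0 l_lt)// inE (leq_ltn_trans ij).
have nthin i : (i < size l)%N -> 0 <= nth 0 l i <= s by move=> il; apply: l_itv; exact: mem_nth.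
exists (nth 0 l), (size l).-1; split.
- have [i i1 i2] := idx 0 (mem_head _ _).
  have il : (i < size l)%N by lia.
  have := nthle 0%N i isT il; rewrite i2.
  by have /andP[h _] := nthin 0%N l0; lra.
- have [|i i1 i2] := idx s; first by rewrite !inE eqxx orbT.
  have ll : ((size l).-1 < size l)%N by lia.
  have := nthle i (size l).-1 i1 ll; rewrite i2.
  by have /andP[_ h] := nthin _ ll; lra.
- move=> i im; rewrite (lt_sorted_ltn_nth 0 l_lt) ?inE; lia.
- by move=> r rrs; apply: idx; rewrite !inE rrs !orbT.
Qed.

Lemma nat_filtration_cylinders s : 0 <= s ->
  nat_filtration W s `<=` <<s BM_cylinders s >>.
Proof.
move=> s0; apply: smallest_sub; first exact: smallest_sigma_algebra.
move=> A [r [r0 [rs [B [mB ->]]]]]; apply: sub_sigma_algebra.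
exists [:: (r, B)]; split => [p /= [<-|//]|]; first by [].
apply/seteqP; split => w /=; first by move=> h p [<-|//].
by move=> h; exact: (h (r, B) (or_introl erefl)).
Qed.

Lemma nat_filtration_measurable s : 0 <= s -> nat_filtration W s `<=` measurable.
Proof.
move=> s0; apply: smallest_sub; first exact: sigma_algebra_measurable.
move=> A [r [r0 [rs [B [mB ->]]]]]; rewrite -[_ @^-1` _]setTI.
exact: (measurable_BM BM).
Qed.

Lemma filtration_incr_independence s t A C : 0 <= s -> s < t ->
  nat_filtration W s A -> measurable C ->
  P (A `&` incr W s t @^-1` C) = (P A * P (incr W s t @^-1` C))%E.
Proof.
move=> s0 st /(nat_filtration_cylinders s0) FA mC.
have t0 : 0 <= t by lra.
have cyl B : BM_cylinders s B -> measurable B /\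
    P (B `&` incr W s t @^-1` C) = (P B * P (incr W s t @^-1` C))%E.
  move=> [l [hl ->]].
  have rs_itv r : r \in [seq p.1 | p <- l] -> 0 <= r <= s.
    move=> /mapP[p pl ->].
    have pin : List.In p l.
      by elim: l pl {hl} => // a l IH; rewrite inE => /orP[/eqP->|/IH]; [left|right].
    by have [-> -> _] := hl p pin.
  have [q [m [q0 qm qlt qr]]] := sorted_grid s0 rs_itv.
  have GB : <<s incr_rects q m >> [set w | forall p, List.In p l -> p.2 (W p.1 w)].
    pose T' := g_sigma_algebraType (incr_rects q m).
    elim: l hl rs_itv qr => [|p l IH] hl rs_itv qr.
      rewrite (_ : [set w | _] = setT); last by apply/seteqP; split => // w _ p [].
      exact: (@measurableT _ T').
    rewrite (_ : [set w | _] = W p.1 @^-1` p.2 `&`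
        [set w | forall p, List.In p l -> p.2 (W p.1 w)]); last first.
      apply/seteqP; split => w /=.
        by move=> h; split => [|p' p'l]; [exact: (h p (or_introl erefl))|exact: (h p' (or_intror p'l))].
      by move=> [h1 h2] p' [<-|p'l]; [exact: h1|exact: h2].
    apply: (@measurableI _ T').
      have [|i im <-] := qr p.1; first by rewrite inE eqxx.
      apply: measurable_BM_incr_rects => //.
      by have [] := hl p (or_introl erefl).
    apply: IH.
    - by move=> p' p'l; apply: hl; right.
    - by move=> r rl; apply: rs_itv; rewrite inE rl orbT.
    - by move=> r rl; apply: qr; rewrite inE rl orbT.
  split; last by apply: (incr_rects_independence _ qlt qm); rewrite ?q0.
  have : forall l, (forall p, List.In p l -> [/\ 0 <= p.1, p.1 <= s & measurable p.2]) ->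
      measurable [set w | forall p : R * set R, List.In p l -> p.2 (W p.1 w)].
    elim=> [|p l' IH] hl'.
      by rewrite (_ : [set w | _] = setT)//; apply/seteqP; split => // w _ p [].
    rewrite (_ : [set w | _] = W p.1 @^-1` p.2 `&`
        [set w | forall p, List.In p l' -> p.2 (W p.1 w)]); last first.
      apply/seteqP; split => w /=.
        by move=> h; split => [|p' p'l]; [exact: (h p (or_introl erefl))|exact: (h p' (or_intror p'l))].
      by move=> [h1 h2] p' [<-|p'l]; [exact: h1|exact: h2].
    apply: measurableI; last by apply: IH => p' p'l; apply: hl'; right.
    have [p0 _ mp] := hl' p (or_introl erefl).
    by rewrite -[_ @^-1` _]setTI; exact: (measurable_BM BM).
  exact.
apply: (pi_system_independence (G := BM_cylinders s)) => //.
- by move=> B /cyl[].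
- move=> _ _ [l [hl ->]] [l' [hl' ->]]; exists (l ++ l'); split.
    by move=> p pl; have [/hl|/hl'] := List.in_app_or _ _ _ pl.
  apply/seteqP; split => w /=.
    by move=> [h h'] p pl; have [/h|/h'] := List.in_app_or _ _ _ pl.
  by move=> h; split => p pl; apply: h; apply: List.in_or_app; [left|right].
- by exists [::]; split => //; apply/seteqP; split => // w _ p [].
- exact: (measurable_preimage_incr BM).
- by move=> B /cyl[].
Qed.

Definition past (s : R) : set (set T) :=
  [set A | exists r, 0 <= r /\ r <= s /\
     exists B : set R, measurable B /\ A = W r @^-1` B].

(** [U] is the identity from [T] to [T] carrying the sigma-algebra of the past, so [h] may depend on
    the whole past and no conditional expectation is needed. *)
Lemma integral_filtration_incr s t
  (h : g_sigma_algebraType (past s) * R -> \bar R) :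
  0 <= s -> s < t -> measurable_fun setT h -> (forall z, (0 <= h z)%E) ->
  (\int[P]_w h (w, incr W s t w) =
   \int[P]_w \int[normal_prob 0 (Num.sqrt (t - s))]_y h (w, y))%E.
Proof.
move=> s0 st mh h0; have t0 : 0 <= t by lra.
apply: (@integral_independent_pair _ _ _ _ T (g_sigma_algebraType (past s)) _ P
  (normal_prob 0 (Num.sqrt (t - s))) id (incr W s t) h) => //.
- by move=> _ B mB; rewrite setTI; exact: (nat_filtration_measurable s0).
- exact: (measurable_incr BM).
move=> B C mB mC.
have law : normal_prob 0 (Num.sqrt (t - s)) C = P (incr W s t @^-1` C).
  by case: BM => _ [_ [_ [law _]]]; rewrite law.
by rewrite [X in (_ * X)%E]law; exact: filtration_incr_independence.
Qed.

End FiltrationIndependence.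

(** * The functional equation *)

Lemma lebesgue_measure_shift (R : realType) (h : R) (A : set R) : measurable A ->
  lebesgue_measure ((fun x => x + h) @^-1` A) = lebesgue_measure A.
Proof.
have msh : measurable_fun [set: measurableTypeR R]
    ((fun x : R => x + h) : measurableTypeR R -> measurableTypeR R).
  by apply: (@measurable_funD _ _ R) => //; exact: measurable_id.
move=> mA; apply/esym.
pose mu : {measure set (measurableTypeR R) -> \bar R} :=
  measure_function_pushforward__canonical__measure_function_Measure lebesgue_measure msh.
apply: (@lebesgue_measure_unique R mu) => // _ [[a b] _ <-] /=.
rewrite /mu /= /pushforward.
rewrite (_ : _ @^-1` _ = `]a - h, b - h]%classic); last first.
  by apply/seteqP; split => x /=; rewrite !in_itv/= ltrBlDr lerBrDr.
rewrite !lebesgue_measure_itv/= !lte_fin ltrD2r.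
by case: ifP => // _; rewrite -!EFinB; congr EFin; ring.
Qed.

Section DAlembert.
Context (R : realType).

Definition dalembert (f : R -> R) := forall x y, f (x + y) + f (x - y) = 2 * f x * f y.

Definition hcos (x : R) : R := (expR x + expR (- x)) / 2.

Lemma hcos_gt0 x : 0 < hcos x.
Proof. by rewrite divr_gt0// addr_gt0// expR_gt0. Qed.

Lemma hcosN x : hcos (- x) = hcos x.
Proof. by rewrite /hcos opprK addrC. Qed.

Lemma hcos0 : hcos 0 = 1.
Proof. by rewrite /hcos oppr0 expR0; field. Qed.

Lemma continuous_hcos : continuous hcos.
Proof.
move=> x; apply: cvgM; last exact: cvg_cst.
apply: cvgD; first exact: continuous_expR.
by apply: (cvg_comp (fun y => - y) expR); [apply: cvgN; exact: cvg_id|exact: continuous_expR].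
Qed.

Lemma dalembert_hcos l : dalembert (fun x => hcos (l * x)).
Proof.
move=> x y; rewrite /hcos !mulrDr !mulrN !opprD !opprK !expRD !expRN.
have ex := expR_gt0 (l * x); have ey := expR_gt0 (l * y).
by field; rewrite !gt_eqF.
Qed.

(** The witness is the inverse hyperbolic cosine [ln (a + sqrt (a ^ 2 - 1))]. *)
Lemma hcos_surj a : 1 <= a -> exists l, hcos l = a.
Proof.
move=> a1; pose s := Num.sqrt (a ^+ 2 - 1).
have s2 : s ^+ 2 = a ^+ 2 - 1 by rewrite sqr_sqrtr// subr_ge0 exprn_ege1.
have s0 : 0 <= s by exact: sqrtr_ge0.
have as0 : 0 < a + s by lra.
exists (ln (a + s)); rewrite /hcos expRN lnK ?posrE//.
have -> : (a + s)^-1 = a - s.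
  apply: (mulfI (lt0r_neq0 as0)); rewrite divff ?gt_eqF//.
  by rewrite (_ : (a + s) * (a - s) = a ^+ 2 - s ^+ 2); [rewrite s2; ring|ring].
by field.
Qed.

Section PositiveSolution.
Variable f : R -> R.
Hypotheses (f_gt0 : forall x, 0 < f x) (fE : dalembert f).

Lemma dalembert0 : f 0 = 1.
Proof.
have := fE 0 0; rewrite addr0 subr0 => h.
by apply: (mulfI (lt0r_neq0 (f_gt0 0))); rewrite mulr1; lra.
Qed.

Lemma dalembertN x : f (- x) = f x.
Proof. by have := fE 0 x; rewrite add0r sub0r dalembert0; lra. Qed.

Lemma dalembert_double x : f (2 * x) = 2 * f x ^+ 2 - 1.
Proof.
have := fE x x; rewrite subrr dalembert0 (_ : x + x = 2 * x); last by ring.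
by rewrite expr2; lra.
Qed.

(** Where [0 < f x < 1], [1 - f (2 x) = 2 (1 - f x ^ 2) >= 2 (1 - f x)]: repeated doubling would
    push [f] below 0. *)
Lemma dalembert_ge1 x : 1 <= f x.
Proof.
rewrite leNgt; apply/negP => fx1.
have grow n : 2 ^+ n * (1 - f x) <= 1 - f (2 ^+ n * x).
  elim: n => [|n IH]; first by rewrite !expr0 !mul1r.
  rewrite !exprS -!mulrA dalembert_double.
  have := f_gt0 (2 ^+ n * x); set y := f (2 ^+ n * x) in IH * => y0.
  have h0 : 0 < 2 ^+ n * (1 - f x) by rewrite mulr_gt0 ?exprn_gt0// subr_gt0.
  have y2 : y ^+ 2 <= y by rewrite expr2 ler_piMr ?(ltW y0)//; lra.
  lra.
pose n := Num.trunc (1 - f x)^-1.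
have u0 : 0 < 1 - f x by lra.
have /truncn_itv/andP[_ hn] : 0 <= (1 - f x)^-1 by rewrite invr_ge0 ltW.
have n2 : n.+1%:R <= 2 ^+ n.+1 :> R.
  by rewrite -natrX ler_nat ltnW// ltn_expl.
have h1 : 1 < 2 ^+ n.+1 * (1 - f x).
  by rewrite -ltr_pdivrMr// div1r (lt_le_trans hn).
by have := grow n.+1; have := f_gt0 (2 ^+ n.+1 * x); lra.
Qed.

(** For [cosh] this is [(2 sinh x sinh y) ^ 2]. The equation at [x + y] and [x - y] expresses the
    product [f (x + y) f (x - y)] by [f (2 x)] and [f (2 y)], and sum and product determine the
    squared difference. *)
Lemma dalembert_dist x y :
  (f (x + y) - f (x - y)) ^+ 2 = 4 * (f x ^+ 2 - 1) * (f y ^+ 2 - 1).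
Proof.
have h1 := fE x y.
have h2 := fE (x + y) (x - y).
rewrite (_ : x + y + (x - y) = 2 * x) in h2; last by ring.
rewrite (_ : x + y - (x - y) = 2 * y) in h2; last by ring.
rewrite !dalembert_double in h2.
rewrite (_ : (f (x + y) - f (x - y)) ^+ 2 =
  (f (x + y) + f (x - y)) ^+ 2 - 2 * (2 * f (x + y) * f (x - y))); last by ring.
rewrite h1 -h2; ring.
Qed.

(** As [f (2 x) - 1 = 2 (f x - 1) (f x + 1) >= 4 (f x - 1)], each halving of the argument divides
    [f - 1] by at least 4. *)
Lemma dalembert_near0 dl K : 0 < dl -> (forall x, `|x| < dl -> f x <= K) ->
  f y @[y --> 0] --> (1 : R).
Proof.
move=> dl0 hK.
have K1 : 1 <= K by rewrite -dalembert0 hK// normr0.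
have key n x : `|2 ^+ n * x| < dl -> (f x - 1) * 4 ^+ n <= K - 1.
  elim: n x => [|n IH] x h.
    by rewrite expr0 mulr1 lerD2r hK//; rewrite expr0 mul1r in h.
  have := IH (2 * x); rewrite mulrA -exprSr => /(_ h).
  rewrite dalembert_double (exprS 4 n) => h2.
  have f1 := dalembert_ge1 x.
  have p4 : 0 < 4 ^+ n :> R by rewrite exprn_gt0.
  have : (f x - 1) * (4 * 4 ^+ n) <= (2 * f x ^+ 2 - 1 - 1) * 4 ^+ n.
    rewrite mulrA ler_pM2r//; nra.
  lra.
apply/cvgrPdist_lt => e e0.
pose n := Num.trunc (K / e).
have /truncn_itv/andP[_ hn] : 0 <= K / e by rewrite divr_ge0 ?(ltW e0)//; lra.
exists (dl / 2 ^+ n.+1) => /=; first by rewrite divr_gt0// exprn_gt0.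
move=> y /=; rewrite sub0r normrN => hy.
have h : `|2 ^+ n.+1 * y| < dl.
  by rewrite normrM gtr0_norm ?exprn_gt0// mulrC -ltr_pdivlMr ?exprn_gt0.
have := key _ _ h; have f1 := dalembert_ge1 y.
rewrite distrC ger0_norm ?subr_ge0// => h1.
have n4 : n.+1%:R <= 4 ^+ n.+1 :> R by rewrite -natrX ler_nat ltnW// ltn_expl.
have h2 : K < e * 4 ^+ n.+1.
  by rewrite mulrC -ltr_pdivrMr// (lt_le_trans hn).
have p4 : 0 < 4 ^+ n.+1 :> R by rewrite exprn_gt0.
rewrite -(ltr_pM2r p4); lra.
Qed.

Lemma dalembert_continuous : f y @[y --> 0] --> (1 : R) -> continuous f.
Proof.
move=> f1 x.
(* [f (x + y)] is the mean of [f (x + y)] and [f (x - y)] plus half their difference: the equation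
   gives the mean, [dalembert_dist] the difference. *)
pose G y := f x * (f y - 1) + Num.sqrt ((f x ^+ 2 - 1) * (f y ^+ 2 - 1)).
have Gle y : `|f (x + y) - f x| <= G y.
  have h1 := fE x y; have h2 := dalembert_dist x y.
  have h3 : `|f (x + y) - f (x - y)| = 2 * Num.sqrt ((f x ^+ 2 - 1) * (f y ^+ 2 - 1)).
    rewrite -sqrtr_sqr h2 -mulrA sqrtrM// (_ : 4 = 2 ^+ 2 :> R); last by ring.
    by rewrite sqrtr_sqr ger0_norm.
  have fy1 := dalembert_ge1 y; have fx0 := f_gt0 x.
  have fxy : 0 <= f x * (f y - 1) by rewrite mulr_ge0; lra.
  rewrite (_ : f (x + y) - f x = f x * (f y - 1) + (f (x + y) - f (x - y)) / 2); last first.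
    by rewrite (_ : f (x - y) = 2 * f x * f y - f (x + y)); [field|lra].
  rewrite (le_trans (ler_normD _ _))// ger0_norm// lerD2l normrM h3.
  by rewrite (ger0_norm (_ : 0 <= 2^-1 :> R)) ?invr_ge0//; lra.
have G0 : G y @[y --> 0] --> (0 : R).
  have GE : f x * (1 - 1) + Num.sqrt ((f x ^+ 2 - 1) * (1 * 1 - 1)) = 0 :> R.
    by rewrite mulr1 subrr !mulr0 sqrtr0 addr0.
  rewrite -[X in _ --> X]GE; apply: cvgD.
    by apply: cvgM; [exact: cvg_cst|apply: cvgB => //; exact: cvg_cst].
  apply: continuous_cvg; first exact: sqrt_continuous.
  apply: cvgM; [exact: cvg_cst|apply: cvgB; [|exact: cvg_cst]].
  by under eq_cvg do rewrite expr2; exact: cvgM.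
apply/cvgrPdist_lt => e e0.
move/cvgrPdist_lt : G0 => /(_ _ e0)[dl /= dl0 hdl].
exists dl => //= y xy.
rewrite distrC (_ : y = x + (y - x)); last by ring.
apply: (le_lt_trans (Gle _)).
have := hdl (y - x); rewrite /= !sub0r !normrN distrC => /(_ xy).
by apply: le_lt_trans; exact: ler_norm.
Qed.

End PositiveSolution.

Lemma dalembert_unique (f g : R -> R) :
  (forall x, 0 < f x) -> dalembert f -> (forall x, 0 < g x) -> dalembert g ->
  continuous f -> continuous g -> f 1 = g 1 -> f =1 g.
Proof.
move=> f0 fE g0 gE cf cg fg1.
have half n : f (2^-1 ^+ n) = g (2^-1 ^+ n).
  elim: n => [|n IH]; first by rewrite !expr0.
  have h2 : 2 * 2^-1 ^+ n.+1 = 2^-1 ^+ n :> R by rewrite exprS mulrA divff ?mul1r.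
  have := dalembert_double f0 fE (2^-1 ^+ n.+1).
  have := dalembert_double g0 gE (2^-1 ^+ n.+1).
  rewrite h2 IH => -> h.
  have : (g (2^-1 ^+ n.+1) - f (2^-1 ^+ n.+1)) * (g (2^-1 ^+ n.+1) + f (2^-1 ^+ n.+1)) = 0.
    by move: h; set u := g _; set v := f _; rewrite !expr2; lra.
  have p : g (2^-1 ^+ n.+1) + f (2^-1 ^+ n.+1) != 0 by rewrite gt_eqF// addr_gt0.
  by move/eqP; rewrite mulf_eq0 (negbTE p) orbF subr_eq0 => /eqP.
(* The equation is a second-order recursion in [k], hence two consecutive values are carried
   along. *)
have dyad n k : f (k%:R * 2^-1 ^+ n) = g (k%:R * 2^-1 ^+ n) /\
    f (k.+1%:R * 2^-1 ^+ n) = g (k.+1%:R * 2^-1 ^+ n).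
  set v := 2^-1 ^+ n; elim: k => [|k [IH1 IH2]].
    by rewrite !mul0r !mul1r (dalembert0 f0 fE) (dalembert0 g0 gE) half.
  split => //.
  have hf := fE (k.+1%:R * v) v; have hg := gE (k.+1%:R * v) v.
  have e1 : k.+1%:R * v + v = k.+2%:R * v by rewrite -[k.+2%:R]natr1; ring.
  have e2 : k.+1%:R * v - v = k%:R * v by rewrite -[k.+1%:R]natr1; ring.
  rewrite e1 e2 in hf hg; rewrite IH1 IH2 half in hf.
  lra.
have pos x : 0 <= x -> f x = g x.
  move=> x0; apply/eqP; apply/negPn/negP => /eqP fgx.
  have d0 : 0 < `|f x - g x| by rewrite normr_gt0 subr_eq0; exact/eqP.
  have e0 : 0 < `|f x - g x| / 2 by lra.
  have /cvgrPdist_lt/(_ _ e0)[d1 /= d10 h1] := cf x.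
  have /cvgrPdist_lt/(_ _ e0)[d2 /= d20 h2] := cg x.
  pose dm := Num.min d1 d2.
  have dm0 : 0 < dm by rewrite lt_min d10.
  pose n := Num.trunc dm^-1.
  have /truncn_itv/andP[_ hn] : 0 <= dm^-1 by rewrite invr_ge0 ltW.
  have n2 : n.+1%:R <= 2 ^+ n.+1 :> R by rewrite -natrX ler_nat ltnW// ltn_expl.
  have p2 : 0 < 2 ^+ n.+1 :> R by rewrite exprn_gt0.
  have v_dm : 2^-1 ^+ n.+1 < dm.
    rewrite exprVn -[ltRHS]invrK ltf_pV2 ?posrE ?invr_gt0//.
    exact: lt_le_trans hn n2.
  pose k := Num.trunc (x * 2 ^+ n.+1).
  have /truncn_itv/andP[k1 k2] : 0 <= x * 2 ^+ n.+1 by rewrite mulr_ge0// ltW.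
  pose y : R := k%:R * 2^-1 ^+ n.+1.
  have xy : `|x - y| < dm.
    apply: le_lt_trans v_dm; rewrite /y exprVn.
    have y1 : k%:R / 2 ^+ n.+1 <= x by rewrite ler_pdivrMr.
    have y2 : x <= k%:R / 2 ^+ n.+1 + (2 ^+ n.+1)^-1.
      by rewrite -{2}[(2 ^+ n.+1)^-1]mul1r -mulrDl natr1 ler_pdivlMr// ltW.
    by rewrite ger0_norm; lra.
  have [fy _] := dyad n.+1 k.
  have y1 : `|x - y| < d1 by rewrite (lt_le_trans xy)// ge_min lexx.
  have y2 : `|x - y| < d2 by rewrite (lt_le_trans xy)// ge_min lexx orbT.
  have := h1 y y1; have := h2 y y2; rewrite -fy => a1 a2.
  have := ler_normB (f x - f y) (g x - f y).
  rewrite (_ : f x - f y - (g x - f y) = f x - g x); last by ring.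
  lra.
move=> x; have [x0|x0] := leP 0 x; first exact: pos.
by rewrite -(dalembertN f0 fE) -(dalembertN g0 gE) pos// oppr_ge0 ltW.
Qed.

(* Steinhaus: [f <= M] on more than 2/3 of [0, 1], so every small [h] is a difference
   of two points of that set, and [f (x - y) <= 2 f x f y]. *)
Lemma dalembert_locally_bounded (f : R -> R) :
  measurable_fun setT f -> (forall x, 0 < f x) -> dalembert f ->
  exists K, forall h, `|h| < 6^-1 -> f h <= K.
Proof.
move=> mf f0 fE.
pose E (n : nat) := `[0%R : R, 1%R]%classic `&` f @^-1` `]-oo, n%:R]%classic.
have mE n : measurable (E n).
  apply: measurableI; first exact: measurable_itv.
  by rewrite -[_ @^-1` _]setTI; apply: mf => //; exact: measurable_itv.
have UE : \bigcup_n E n = `[0%R : R, 1%R]%classic.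
  apply/seteqP; split => [x [n _ []//]|x x01].
  exists (Num.trunc (f x)).+1 => //; split => //=; rewrite in_itv/= ltW//.
  by have /truncn_itv/andP[] : 0 <= f x by exact: ltW.
have [n hn] : exists n, ((2 / 3)%:E < lebesgue_measure (E n))%E.
  have cv : lebesgue_measure (E n) @[n --> \oo] --> lebesgue_measure (`[0%R : R, 1%R]%classic).
    rewrite -UE; apply: nondecreasing_cvg_mu => //.
      by rewrite UE; exact: measurable_itv.
    move=> i j ij; apply/subsetPset => x [x01 /=]; rewrite in_itv/= => h; split => //=.
    by rewrite in_itv/= (le_trans h)// ler_nat.
  rewrite lebesgue_measure_itv/= lte_fin ltr01 oppr0 adde0 in cv.
  apply: contrapT => /forallNP hn.
  have : (1%:E <= (2 / 3 : R)%:E)%E.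
    apply: (cvge_to_le cv); apply: nearW => n.
    by rewrite leNgt; exact/negP.
  by rewrite lee_fin; lra.
exists (2 * n%:R * n%:R) => h h3.
have [[x [[x01 fx] [y01 fy]]]|dis] := pselect ((E n `&` (fun x => x + h) @^-1` (E n)) !=set0).
  rewrite /= in_itv/= in fx; rewrite /= in_itv/= in fy.
  have := fE (x + h) x; rewrite (_ : x + h - x = h); last by ring.
  have := f0 (x + h + x); have := f0 x; have := f0 (x + h) => a b c e.
  have : f (x + h) * f x <= n%:R * n%:R by apply: ler_pM => //; exact: ltW.
  lra.
have msh : measurable ((fun x => x + h) @^-1` E n).
  by rewrite -[_ @^-1` _]setTI; apply: measurable_funD.
have dj : E n `&` (fun x => x + h) @^-1` (E n) = set0.
  by apply/eqP/negPn/negP => /set0P.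
pose H := (fun x => x + h) @^-1` E n; rewrite -/H in msh dj.
(* If disjoint, [E n] and its translate would have total measure above 4/3 within an interval of
   length [1 + 2 |h| <= 4/3]; this is the origin of 2/3 and [6^-1]. *)
have : (lebesgue_measure (E n `|` H) <= (4 / 3)%:E)%E.
  apply: (@le_trans _ _ (lebesgue_measure `[(- `|h|)%R, (1 + `|h|)%R]%classic)).
    apply: le_measure; rewrite ?inE; [apply: measurableU; [exact: mE|exact: msh]|exact: measurable_itv|].
    have := ler_norm h; have := ler_norm (- h); rewrite normrN => a b.
    have c := normr_ge0 h.
    by move=> x [[/= + _]|[/= + _]]; rewrite !in_itv/= => /andP[? ?]; apply/andP; split; lra.
  rewrite lebesgue_measure_itv/= lte_fin; case: ifP => _; rewrite -?EFinB lee_fin; lra.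
have lH : lebesgue_measure H = lebesgue_measure (E n) by exact: lebesgue_measure_shift.
have -> : lebesgue_measure (E n `|` H) = (lebesgue_measure (E n) + lebesgue_measure (E n))%E.
  by rewrite -{2}lH; apply: measureU ; [exact: mE|exact: msh|exact: dj].
move=> /(lt_le_trans (lteD hn hn)).
by rewrite -EFinD lte_fin; lra.
Qed.

Lemma measurable_dalembert (f : R -> R) :
  measurable_fun setT f -> (forall x, 0 < f x) -> dalembert f ->
  exists l, forall x, f x = hcos (l * x).
Proof.
move=> mf f0 fE.
have [K hK] := dalembert_locally_bounded mf f0 fE.
have cf : continuous f.
  by apply: dalembert_continuous => //; apply: dalembert_near0 hK => //; rewrite invr_gt0.
have [l hl] := hcos_surj (dalembert_ge1 f0 fE 1).
exists l; apply: dalembert_unique => //.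
- by move=> x; exact: hcos_gt0.
- exact: dalembert_hcos.
- move=> x; apply: (cvg_comp ( *%R l) hcos); last exact: continuous_hcos.
  by apply: cvgM; [exact: cvg_cst|exact: cvg_id].
- by rewrite mulr1.
Qed.

End DAlembert.

(** * The heat semigroup *)

Section NormalIntegral.
Local Open Scope ereal_scope.
Context (R : realType) (m s : R).
Local Notation mu := (@lebesgue_measure R).
Local Notation N := (normal_prob m s).
Local Notation pdf := (normal_pdf m s).

Let mpdf : measurable_fun [set: R] (fun x => (pdf x)%:E).
Proof. by apply/measurable_EFinP; exact: measurable_normal_pdf. Qed.

Let pdf0 x : 0 <= (pdf x)%:E.
Proof. by rewrite lee_fin normal_pdf_ge0. Qed.

Let integral_normal_indic (E : set R) : measurable E ->
  \int[N]_x (\1_E x)%:E = \int[mu]_x ((\1_E x)%:E * (pdf x)%:E).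
Proof.
move=> mE; rewrite integral_indic// setIT /normal_prob [LHS]integral_mkcond.
apply: eq_integral => x _; rewrite patchE indicE.
by case: ifPn => _; rewrite ?mul1e ?mul0e.
Qed.

Import HBNNSimple.

Let integral_normal_nnsfun (f : {nnsfun R >-> R}) :
  \int[N]_x (f x)%:E = \int[mu]_x ((f x)%:E * (pdf x)%:E).
Proof.
have mind r : measurable_fun [set: R] (fun x => (r * \1_(f @^-1` [set r]) x)%:E).
  apply/measurable_EFinP; apply: measurable_funM => //; apply: measurable_indic.
under [LHS]eq_integral do rewrite fimfunE -fsumEFin//.
rewrite [LHS]ge0_integral_fsum//; last first.
  - by move=> n x _; rewrite EFinM nnfun_muleindic_ge0.
under [RHS]eq_integral.
  move=> x xD; rewrite fimfunE -fsumEFin// muleC ge0_mule_fsumr; last first.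
    by move=> r; rewrite EFinM nnfun_muleindic_ge0.
  over.
rewrite [RHS]ge0_integral_fsum//; last 2 first.
  - by move=> r; apply: emeasurable_funM; [exact: mpdf|exact: mind].
  - move=> n x _; rewrite EFinM mule_ge0//.
    by rewrite nnfun_muleindic_ge0.
apply: eq_fsbigr => r _.
have [r0|r0] := leP 0%R r; last first.
  have -> : f @^-1` [set r] = set0.
    apply/seteqP; split => x //= fxr.
    by have : (0 <= f x)%R by []; rewrite fxr leNgt r0.
  by rewrite !integral0_eq// => x _; rewrite indic0 mulr0// mule0.
set A := f @^-1` [set r].
have mA : measurable A by rewrite /A -[_ @^-1` _]setTI; exact: measurable_funP.
have mA1 : measurable_fun [set: R] (fun x => (\1_A x : R)%:E).
  by apply/measurable_EFinP; exact: measurable_indic.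
transitivity (r%:E * \int[N]_x (\1_A x)%:E).
  under eq_integral do rewrite EFinM.
  by rewrite ge0_integralZl.
rewrite integral_normal_indic// -ge0_integralZl//.
  by apply: eq_integral => x _; rewrite EFinM muleA [RHS]muleC.
- exact: emeasurable_funM.
- by move=> x _; rewrite mule_ge0// lee_fin.
Qed.

Lemma integral_normal_density (f : R -> \bar R) :
  measurable_fun setT f -> (forall x, 0 <= f x) ->
  \int[N]_x f x = \int[mu]_x (f x * (pdf x)%:E).
Proof.
move=> mf f0.
pose f_ := nnsfun_approx measurableT mf.
have mf_ n : measurable_fun [set: R] (fun x => (f_ n x)%:E).
  by apply/measurable_EFinP; exact: measurable_funP.
have nd_ (x : R) : {homo (fun n => (f_ n x)%:E) : i j / (i <= j)%N >-> i <= j}.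
  by move=> i j ij; rewrite lee_fin; exact/lefP/nd_nnsfun_approx.
transitivity (lim (\int[N]_x (f_ n x)%:E @[n --> \oo])).
  rewrite -monotone_convergence//=.
  - apply: eq_integral => ? /[!inE] xD; apply/esym/cvg_lim => //=.
    exact: cvg_nnsfun_approx.
  - by move=> n ? _; rewrite lee_fin.
transitivity (lim (\int[mu]_x ((f_ n x)%:E * (pdf x)%:E) @[n --> \oo])).
  by apply: congr_lim; apply/funext => n /=; exact: integral_normal_nnsfun.
rewrite -monotone_convergence//=.
- apply: eq_integral => x /[!inE] xD; apply/cvg_lim => //=.
  by apply: cvgeZr => //; exact: cvg_nnsfun_approx.
- by move=> n; apply: emeasurable_funM => //; exact: mf_.
- by move=> n x _; rewrite mule_ge0// lee_fin.
- by move=> x _ i j ij; apply: lee_wpmul2r => //; exact: nd_.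
Qed.

End NormalIntegral.

Lemma integral_lebesgue_shift (R : realType) (h : R) (f : R -> \bar R) :
  measurable_fun setT f -> (forall x, 0 <= f x)%E ->
  (\int[lebesgue_measure]_x f (x + h)%R = \int[lebesgue_measure]_x f x)%E.
Proof.
move=> mf f0.
have msh : measurable_fun [set: measurableTypeR R]
    ((fun x : R => x + h) : measurableTypeR R -> measurableTypeR R).
  by apply: (@measurable_funD _ _ R) => //; exact: measurable_id.
have h1 : {in setT, forall y : R, (0 <= f y)%E} by move=> x _.
have := @ge0_integral_pushforward _ _ _ _ R _ msh lebesgue_measure setT f measurableT mf h1.
rewrite preimage_setT => e; apply: (etrans (esym e)).
apply: (@eq_measure_integral _ _ _ _ lebesgue_measure
  (measure_function_pushforward__canonical__measure_function_Measure lebesgue_measure msh)).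
by move=> A mA _; exact: lebesgue_measure_shift.
Qed.

(** The heat semigroup at time [h], with extended real values so that it can be handled for
    nonnegative [g] before integrability is known. *)
Definition heat (R : realType) (h : R) (g : R -> R) (x : R) : \bar R :=
  (\int[normal_prob 0 (Num.sqrt h)]_y (g (x + y))%:E)%E.

(** The translation moves the dependence on [x] from [g] to the smooth density. *)
Lemma heat_density (R : realType) (h x : R) (g : R -> R) : 0 < h ->
  measurable_fun setT g -> (forall y, 0 <= g y) ->
  heat h g x = (\int[lebesgue_measure]_y (g y * normal_pdf x (Num.sqrt h) y)%:E)%E.
Proof.
move=> h0 mg g0; rewrite /heat.
have s0 : Num.sqrt h != 0 by rewrite gt_eqF// sqrtr_gt0.
have mgx : measurable_fun [set: R] (fun y => (g (x + y))%:E).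
  by apply/measurable_EFinP; apply: measurableT_comp => //; exact: measurable_funD.
have gx0 y : (0 <= (g (x + y))%:E)%E by rewrite lee_fin.
rewrite (integral_normal_density 0 (Num.sqrt h) mgx gx0).
rewrite -(@integral_lebesgue_shift R x (fun y => (g y * normal_pdf x (Num.sqrt h) y)%:E)).
- apply: eq_integral => y _; rewrite -EFinM addrC !normal_pdfE// /normal_fun subr0.
  by rewrite addrK.
- by apply/measurable_EFinP; apply: measurable_funM => //; exact: measurable_normal_pdf.
- by move=> y; rewrite lee_fin mulr_ge0// normal_pdf_ge0.
Qed.

Lemma measurable_expRM (R : realType) (l : R) : measurable_fun [set: R] (fun y => expR (l * y)).
Proof.
by apply: (measurableT_comp (@measurable_expR R)); exact: measurable_funM.
Qed.

(** Completing the square: the factor [exp (l y)] moves the centre of the density from [x] to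
    [x + l h]. *)
Lemma heat_expR (R : realType) (h l x : R) : 0 < h ->
  heat h (fun y => expR (l * y)) x = (expR (l ^+ 2 / 2 * h) * expR (l * x))%:E.
Proof.
move=> h0; rewrite (heat_density _ h0 (measurable_expRM l) (fun y => expR_ge0 _)).
have s0 : Num.sqrt h != 0 by rewrite gt_eqF// sqrtr_gt0.
have s2 : Num.sqrt h ^+ 2 = h by rewrite sqr_sqrtr// ltW.
under eq_integral => y _.
  have -> : expR (l * y) * normal_pdf x (Num.sqrt h) y =
      expR (l ^+ 2 / 2 * h) * expR (l * x) * normal_pdf (x + l * h) (Num.sqrt h) y.
    rewrite !normal_pdfE// /normal_fun s2.
    rewrite mulrCA [RHS]mulrCA; congr (_ * _).
    rewrite -!expRD; congr expR; rewrite -mulr_natr; field; lra.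
  rewrite EFinM; over.
set c := _ * _ : R.
have c0 : (0 <= c%:E)%E by rewrite lee_fin mulr_ge0// expR_ge0.
have mp : measurable_fun [set: R] (fun y => (normal_pdf (x + l * h) (Num.sqrt h) y)%:E).
  by apply/measurable_EFinP; exact: measurable_normal_pdf.
rewrite (ge0_integralZl lebesgue_measure measurableT mp _ c0); last first.
  by move=> y _; rewrite lee_fin normal_pdf_ge0.
by rewrite integral_normal_pdf mule1.
Qed.

(** * The Markov property *)

Section Markov.
Context (R : realType) (d : measure_display) (T : measurableType d).
Variables (P : probability T R) (W : R -> T -> R).
Hypothesis BM : standard_BM P W.

Lemma markov_BM (g : R -> R) s t A : 0 <= s -> s < t ->
  measurable_fun setT g -> (forall x, 0 <= g x) -> nat_filtration W s A ->
  (\int[P]_(w in A) (g (W t w))%:E = \int[P]_(w in A) heat (t - s) g (W s w))%E.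
Proof.
move=> s0 st mg g0 FA.
pose T1 := g_sigma_algebraType (past W s).
have mW : measurable_fun [set: T1] (W s : T1 -> R).
  move=> _ B mB; rewrite setTI; apply: sub_sigma_algebra.
  by exists s; split => //; split => //; exists B.
have mA : measurable_fun [set: T1] (\1_A : T1 -> R) by exact: measurable_indic.
pose h (z : T1 * R) : \bar R := (\1_A z.1 * g (W s z.1 + z.2))%:E.
have mh : measurable_fun setT h.
  apply/measurable_EFinP; apply: measurable_funM.
    exact: (measurableT_comp mA measurable_fst).
  apply: (measurableT_comp mg); apply: measurable_funD.
    exact: (measurableT_comp mW measurable_fst).
  exact: measurable_snd.
have h0 z : (0 <= h z)%E by rewrite lee_fin mulr_ge0.
have := integral_filtration_incr BM s0 st mh h0.
rewrite /h /= => e.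
rewrite [LHS]integral_mkcond [RHS]integral_mkcond.
transitivity (\int[P]_w (\1_A w * g (W s w + incr W s t w))%:E)%E.
  apply: eq_integral => w _; rewrite patchE indicE.
  case: ifPn => _; last by rewrite mul0r.
  by rewrite mul1r /incr; congr (EFin (g _)); ring.
rewrite e; apply: eq_integral => w _; rewrite patchE indicE.
case: ifPn => _; last by apply: integral0_eq => y _; rewrite mul0r.
by apply: eq_integral => y _; rewrite mul1r.
Qed.

Lemma expectation_BM (g : R -> R) t : 0 < t ->
  measurable_fun setT g -> (forall x, 0 <= g x) ->
  (\int[P]_w (g (W t w))%:E = heat t g 0)%E.
Proof.
move=> t0 mg g0; rewrite (markov_BM (lexx 0) t0 mg g0 (A := setT)); last first.
  exact: (@measurableT _ (g_sigma_algebraType (past W 0))).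
rewrite subr0; under eq_integral do rewrite (BM0 BM).
rewrite [LHS](integral_cst P measurableT (heat t g 0)) -[RHS]mule1.
by congr (_ * _)%E; exact: probability_setT.
Qed.

End Markov.

Lemma heat_hcos (R : realType) (h l x : R) : 0 < h ->
  heat h (fun y => hcos (l * y)) x = (expR (l ^+ 2 / 2 * h) * hcos (l * x))%:E.
Proof.
move=> h0.
have m1 k : measurable_fun [set: R] (fun y => (expR (k * (x + y)))%:E).
  apply/measurable_EFinP; apply: (measurableT_comp (@measurable_expR R)).
  by apply: measurable_funM => //; exact: measurable_funD.
have e0 k y : (0 <= (expR (k * (x + y)))%:E)%E by rewrite lee_fin expR_ge0.
have half0 : (0 <= (2^-1)%:E :> \bar R)%E by rewrite lee_fin invr_ge0.
rewrite /heat.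
under eq_integral => y _.
  have -> : hcos (l * (x + y)) = 2^-1 * expR (l * (x + y)) + 2^-1 * expR ((- l) * (x + y)).
    by rewrite /hcos mulNr; field.
  rewrite EFinD !EFinM; over.
have m2 k : measurable_fun [set: R] (fun y => ((2^-1)%:E * (expR (k * (x + y)))%:E)%E).
  by apply: emeasurable_funM.
have e2 k y : [set: R] y -> (0 <= (2^-1)%:E * (expR (k * (x + y)))%:E)%E by move=> _; exact: mule_ge0.
rewrite ge0_integralD; [|exact: measurableT|exact: (e2 l)|exact: (m2 l)
  |exact: (e2 (- l))|exact: (m2 (- l))].
rewrite ge0_integralZl; [|exact: measurableT|exact: (m1 l)|by move=> y _; exact: e0|exact: half0].
rewrite [X in (_ + X)%E]ge0_integralZl; [|exact: measurableT|exact: (m1 (- l))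
  |by move=> y _; exact: e0|exact: half0].
have := heat_expR l x h0; rewrite /heat => ->.
have := heat_expR (- l) x h0; rewrite /heat => ->.
by rewrite -!EFinM -EFinD sqrrN mulNr /hcos; congr EFin; field.
Qed.

Lemma measurable_hcosM (R : realType) (l : R) : measurable_fun [set: R] (fun x => hcos (l * x)).
Proof.
apply: continuous_measurable_fun => x.
apply: (cvg_comp ( *%R l) (@hcos R)); last exact: continuous_hcos.
by apply: cvgM; [exact: cvg_cst|exact: cvg_id].
Qed.

(** * The hyperbolic cosine martingale *)

Section HcosMartingale.
Context (R : realType) (d : measure_display) (T : measurableType d).
Variables (P : probability T R) (W : R -> T -> R).
Hypothesis BM : standard_BM P W.
Variable l : R.
Let f (x : R) : R := hcos (l * x).
Let c (t : R) : R := expR (l ^+ 2 / 2 * t).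

Let mf : measurable_fun setT f. Proof. exact: measurable_hcosM. Qed.
Let f0 x : 0 <= f x. Proof. exact/ltW/hcos_gt0. Qed.
Let c0 t : 0 < c t. Proof. exact: expR_gt0. Qed.

Let mfW t : 0 <= t -> measurable_fun setT (fun w => (f (W t w))%:E).
Proof.
by move=> t0; apply/measurable_EFinP; apply: (measurableT_comp mf); exact: (measurable_BM BM).
Qed.

Let EfW t : 0 <= t -> (\int[P]_w (f (W t w))%:E = (c t)%:E)%E.
Proof.
rewrite le_eqVlt => /orP[/eqP<-|t0].
  under eq_integral do rewrite (BM0 BM) /f mulr0 hcos0.
  rewrite [LHS](integral_cst P measurableT 1%:E) mul1e /c mulr0 expR0.
  exact: probability_setT.
by rewrite (expectation_BM BM t0 mf f0) heat_hcos// mulr0 hcos0 mulr1.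
Qed.

Lemma hcos_integrable t : 0 <= t -> P.-integrable setT (fun w => (f (W t w))%:E).
Proof.
move=> t0; apply/integrableP; split; first exact: mfW.
under eq_integral do rewrite gee0_abs ?lee_fin//.
by rewrite EfW// ltry.
Qed.

Lemma hcos_martingale :
  let N := fun t w => f (W t w) / fine (\int[P]_w0 (f (W t w0))%:E)%E in
  martingale P (nat_filtration W) N /\ right_continuous_process N.
Proof.
move=> N.
have NE t w : 0 <= t -> N t w = f (W t w) * (c t)^-1 by move=> t0; rewrite /N EfW.
split; last first.
  move=> w t t0.
  pose K s : R := f (W (Num.max 0 s) w) * (c s)^-1.
  have cK : K s @[s --> t] --> K t.
    apply: cvgM.
      apply: (cvg_comp (fun s : R => W (Num.max 0 s) w) f); first exact: (continuous_BM_max BM).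
      apply: (cvg_comp ( *%R l) (@hcos R)); last exact: continuous_hcos.
      by apply: cvgM; [exact: cvg_cst|exact: cvg_id].
    apply: cvgV; first by rewrite gt_eqF.
    apply: (cvg_comp (fun s => l ^+ 2 / 2 * s) (@expR R)); last exact: continuous_expR.
    by apply: cvgM; [exact: cvg_cst|exact: cvg_id].
  have /cvg_rightP h : K s @[s --> t^'+] --> K t by exact: cvg_at_right_filter.
  apply/cvg_rightP => e e0; have [dl dl0 hdl] := h e e0.
  exists dl => // s ts sd; have := hdl s ts sd.
  by rewrite /K !max_r ?NE//; lra.
split; [|split].
- move=> t t0 B mB; apply: sub_sigma_algebra.
  exists t; split => //; split => //.
  exists ((fun x => f x * (c t)^-1) @^-1` B); split.
    by rewrite -[_ @^-1` _]setTI; apply: measurable_funM.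
  by apply/seteqP; split => w /=; rewrite NE.
- move=> t t0; have -> : (fun w => (N t w)%:E) = (fun w => ((f (W t w))%:E * ((c t)^-1)%:E)%E).
    by apply/funext => w; rewrite NE// EFinM.
  by apply: integrableZr => //; exact: hcos_integrable.
- move=> s t s0; rewrite le_eqVlt => /orP[/eqP<-//|st] A FA.
  have t0 : 0 <= t by lra.
  have mA : measurable A by exact: (nat_filtration_measurable BM s0).
  have intN u : 0 <= u ->
      (\int[P]_(w in A) (N u w)%:E = ((c u)^-1)%:E * \int[P]_(w in A) (f (W u w))%:E)%E.
    move=> u0; rewrite -ge0_integralZl//.
    - by apply: eq_integral => w _; rewrite NE// mulrC EFinM.
    - by apply: measurable_funTS; exact: mfW.
    - by move=> w _; rewrite lee_fin.
    - by rewrite lee_fin invr_ge0 ltW.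
  rewrite (intN t t0) (intN s s0) (markov_BM BM s0 st mf f0 FA).
  have st0 : 0 < t - s by lra.
  under eq_integral do rewrite heat_hcos// EFinM.
  rewrite ge0_integralZl//.
  + rewrite muleA -EFinM; congr (EFin _ * _)%E.
    rewrite /c -expRN -expRN -expRD; congr expR; ring.
  + by apply: measurable_funTS; exact: mfW.
  + by move=> w _; rewrite lee_fin; exact: f0.
Qed.

End HcosMartingale.

(** * A maximum principle for the heat semigroup *)

(** From [exp (u / 3) >= u / 3]. With [u] of order [1 / h], the third power absorbs a peak of at
    most [1 / h] and still leaves a factor [h ^ 2]. *)
Lemma expRN_le_cube (R : realType) (u : R) : 0 < u -> expR (- u) <= 27 / u ^+ 3.
Proof.
move=> u0; rewrite expRN.
have h : (u / 3) ^+ 3 <= expR u.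
  have -> : expR u = expR (u / 3) ^+ 3.
    by rewrite !exprS expr0 mulr1 -!expRD; congr expR; field.
  by rewrite lerXn2r ?nnegrE ?expR_ge0//; [lra|rewrite (le_trans _ (expR_ge1Dx _))//; lra].
rewrite (_ : 27 / u ^+ 3 = ((u / 3) ^+ 3)^-1); last by field; lra.
by rewrite lef_pV2 ?posrE ?expR_gt0// exprn_gt0; lra.
Qed.

(** For [h <= 1/2], [1 / h - 1 >= 1 / (2 h)], so [y ^ 2 / (2 h)] exceeds [y ^ 2 / 2] by at least
    [r ^ 2 / (4 h)], to which [expRN_le_cube] applies. [5184 = 3 * 27 * 4 ^ 3], the 3 being that of
    [normal_peak_ge]. *)
Lemma normal_pdf_tail (R : realType) (h r y : R) : 0 < h -> h <= 2^-1 -> 0 < r -> r < `|y| ->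
  normal_pdf 0 (Num.sqrt h) y <= 5184 / r ^+ 6 * h ^+ 2 * normal_pdf 0 (Num.sqrt 1) y.
Proof.
move=> h0 h2 r0 ry.
have sh0 : 0 < Num.sqrt h by rewrite sqrtr_gt0.
have s2 : Num.sqrt h ^+ 2 = h by rewrite sqr_sqrtr// ltW.
have peakh : normal_peak (Num.sqrt h) <= h^-1.
  apply: (le_trans (normal_peak_le sh0)); rewrite lef_pV2 ?posrE//.
  rewrite -{1}s2 expr2 ler_piMl ?(ltW sh0)// -sqrtr1 ler_wsqrtr//; lra.
have peak1 : 3^-1 <= normal_peak (1 : R).
  by have := normal_peak_ge (ltr01 : 0 < (1 : R)); rewrite mulr1.
rewrite sqrtr1 !normal_pdfE ?gt_eqF// /normal_fun s2 !subr0 expr1n.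
have y2 : r ^+ 2 <= y ^+ 2.
  by rewrite -(real_normK (num_real y)) lerXn2r ?nnegrE// ltW.
have expo : - y ^+ 2 / (h *+ 2) <= - y ^+ 2 / (1 *+ 2) - r ^+ 2 / (4 * h).
  have -> : - y ^+ 2 / (h *+ 2) = - y ^+ 2 / (1 *+ 2) - y ^+ 2 * (h^-1 - 1) / 2.
    by rewrite -(mulr_natr h 2) -(mulr_natr 1 2); field; lra.
  rewrite lerD2l lerN2.
  have hv : (2 * h)^-1 <= h^-1 - 1.
    have : 1 <= (2 * h)^-1 by rewrite -[leLHS]invr1 lef_pV2 ?posrE; lra.
    have -> : h^-1 = 2 * (2 * h)^-1 by field; lra.
    lra.
  have -> : r ^+ 2 / (4 * h) = r ^+ 2 * (2 * h)^-1 / 2 by field; lra.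
  rewrite ler_pM2r ?invr_gt0//; apply: ler_pM => //; first exact: sqr_ge0.
  by rewrite invr_ge0; lra.
have e1 : expR (- y ^+ 2 / (h *+ 2)) <=
    expR (- y ^+ 2 / (1 *+ 2)) * (1728 * h ^+ 3 / r ^+ 6).
  have rh0 : 0 < r ^+ 2 / (4 * h) by rewrite divr_gt0 ?exprn_gt0//; lra.
  apply: (@le_trans _ _ (expR (- y ^+ 2 / (1 *+ 2) - r ^+ 2 / (4 * h)))).
    by rewrite ler_expR.
  rewrite expRD; apply: ler_wpM2l; first exact: expR_ge0.
  apply: (le_trans (expRN_le_cube rh0)).
  by rewrite (_ : 27 / _ = 1728 * h ^+ 3 / r ^+ 6)//; field; lra.
set E := expR (- y ^+ 2 / (1 *+ 2)) in e1 *.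
have E0 : 0 < E by exact: expR_gt0.
apply: (@le_trans _ _ (h^-1 * (E * (1728 * h ^+ 3 / r ^+ 6)))).
  apply: ler_pM => //; exact: normal_peak_ge0.
rewrite (_ : h^-1 * _ = 5184 / r ^+ 6 * h ^+ 2 * (3^-1 * E)); last by field; lra.
apply: ler_wpM2l; last by rewrite ler_pM2r.
by apply: mulr_ge0; [apply: divr_ge0; [rewrite ler0n|exact/exprn_ge0/ltW]|exact: sqr_ge0].
Qed.

Local Notation gauss h := (normal_prob 0 (Num.sqrt h)).

(* Outside of [[-r, r]] the Gaussian density at time [h] is O(h^2) times the one at time 1,
   so at a local maximum the heat semigroup cannot increase [v] at a linear rate [k]. *)
Lemma heat_max_principle (R : realType) (v : R -> R) (x0 r k : R) :
  measurable_fun setT v -> 0 < r -> 0 < k ->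
  (forall y, `|y| <= r -> v (x0 + y) <= v x0) ->
  (forall h, 0 < h -> (normal_prob 0 (Num.sqrt h)).-integrable setT
     (EFin \o (fun y => v (x0 + y)))) ->
  (forall h, 0 < h -> h <= 2^-1 ->
     k * h <= \int[normal_prob 0 (Num.sqrt h)]_y v (x0 + y) - v x0) ->
  False.
Proof.
move=> mv r0 k0 vmax vint vge.
pose u y := v (x0 + y) - v x0.
have mu : measurable_fun setT u.
  apply: measurable_funB => //; apply: (measurableT_comp mv).
  exact: measurable_funD.
have cint h (a : R) : (gauss h).-integrable setT (EFin \o (fun=> a)).
  exact: finite_measure_integrable_cst.
have uint h : 0 < h -> (gauss h).-integrable setT (EFin \o u).
  move=> h0; rewrite (_ : EFin \o u =
    ((EFin \o (fun y => v (x0 + y)%R)) \- (EFin \o (fun=> v x0)))%E)//.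
  by apply: integrableB => //; [exact: vint|exact: cint].
(* [g] dominates [u], which is nonpositive within distance [r], and lives only where the tail bound
   holds. *)
pose g (y : R) : R := if r < `|y| then `|u y| else 0.
have mg : measurable_fun setT g.
  apply: measurable_fun_if => //.
  - apply: (measurable_fun_bool true).
    rewrite (_ : _ @^-1` _ = (fun y : R => `|y|) @^-1` `]r, +oo[%classic); last first.
      by apply/seteqP; split => y /=; rewrite in_itv/= andbT.
    by apply: normr_measurable => //; exact: measurable_itv.
  - by apply: measurable_funTS; apply: (measurableT_comp (@normr_measurable _ setT)).
have g0 y : 0 <= g y by rewrite /g; case: ifP.
have gu y : g y <= `|u y| by rewrite /g; case: ifP.
have ug y : u y <= g y.
  rewrite /g; case: ltP => h; first exact: ler_norm.
  by rewrite subr_le0 vmax.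
have gint h : 0 < h -> (gauss h).-integrable setT (EFin \o g).
  move=> h0; apply: (le_integrable _ _ _ (uint h h0)) => //.
    exact/measurable_EFinP.
  by move=> y _ /=; rewrite lee_fin (ger0_norm (g0 y)).
pose G : R := \int[gauss 1]_y g y.
have G0 : 0 <= G by apply: Rintegral_ge0.
have [K K0 hK] : exists2 K : R, 0 <= K & forall h y, 0 < h -> h <= 2^-1 -> r < `|y| ->
    normal_pdf 0 (Num.sqrt h) y <= K * h ^+ 2 * normal_pdf 0 (Num.sqrt 1) y.
  exists (5184 / r ^+ 6); last by move=> h y h0 h2; exact: normal_pdf_tail.
  by apply: divr_ge0; [rewrite ler0n|exact/exprn_ge0/ltW].
have gEFin h : 0 < h -> ((\int[gauss h]_y g y)%:E = \int[gauss h]_y (g y)%:E)%E.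
  by move=> h0; rewrite /Rintegral fineK//; exact: integrable_fin_num (gint h h0).
have tail h : 0 < h -> h <= 2^-1 -> \int[gauss h]_y g y <= K * h ^+ 2 * G.
  move=> h0 h2; have kh0 : (0 <= (K * h ^+ 2)%:E)%E by rewrite lee_fin mulr_ge0// sqr_ge0.
  rewrite -lee_fin [leRHS]EFinM [leLHS](gEFin h h0) [X in (_ * X)%E](gEFin 1 ltr01).
  have mgE : measurable_fun setT (fun y => (g y)%:E) by exact/measurable_EFinP.
  have g0E y : (0 <= (g y)%:E)%E by rewrite lee_fin.
  have mp s : measurable_fun setT (fun y => ((g y)%:E * (normal_pdf 0 s y)%:E)%E).
    apply: emeasurable_funM => //; apply/measurable_EFinP; exact: measurable_normal_pdf.
  have p0 s y : (0 <= (g y)%:E * (normal_pdf 0 s y)%:E)%E.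
    by apply: mule_ge0 => //; rewrite lee_fin normal_pdf_ge0.
  rewrite [leLHS](integral_normal_density 0 (Num.sqrt h) mgE g0E).
  rewrite [X in (_ * X)%E](integral_normal_density 0 (Num.sqrt 1) mgE g0E).
  rewrite -(ge0_integralZl lebesgue_measure measurableT (mp _) (fun y _ => p0 _ y) kh0).
  apply: ge0_le_integral; [exact: measurableT|by move=> y _; exact: p0|exact: mp| |].
    by apply: emeasurable_funM; [exact: measurable_cst|exact: mp].
  move=> y _; rewrite -!EFinM lee_fin /g; case: ltP => hy; last by rewrite !mul0r mulr0.
  by rewrite [leRHS]mulrCA; apply: ler_wpM2l => //; exact: hK.
have main h : 0 < h -> h <= 2^-1 -> k <= K * G * h.
  move=> h0 h2; rewrite -(ler_pM2r h0) (le_trans (vge h h0 h2))//.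
  rewrite (_ : K * G * h * h = K * h ^+ 2 * G); last by ring.
  apply: le_trans (tail h h0 h2).
  have -> : \int[gauss h]_y v (x0 + y) - v x0 = \int[gauss h]_y u y.
    rewrite /u RintegralB; [|exact: measurableT|exact: vint|exact: cint].
    congr (_ - _); rewrite [RHS]Rintegral_cst; last exact: measurableT.
    by rewrite -[LHS]mulr1; congr (_ * _); rewrite -[LHS]/(fine 1%:E); congr fine; exact/esym/probability_setT.
  by apply: le_Rintegral => //; [exact: uint|exact: gint].
(* Small enough for [K G h < k]; the [+ 1] keeps the denominator positive when [K G = 0]. *)
pose h := Num.min 2^-1 (k / (2 * (K * G + 1))).
have KG0 : 0 <= K * G by exact: mulr_ge0.
have h0 : 0 < h by rewrite lt_min invr_gt0 ltr0n/= divr_gt0//; lra.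
have h1 : h <= 2^-1 by rewrite ge_min lexx.
have h2 : h <= k / (2 * (K * G + 1)) by rewrite ge_min lexx orbT.
have := main h h0 h1; rewrite leNgt => /negP; apply.
apply: (@le_lt_trans _ _ (K * G * (k / (2 * (K * G + 1))))); first exact: ler_wpM2l.
rewrite mulrA ltr_pdivrMr; last lra.
nra.
Qed.

(** * Eigenfunctions of the heat semigroup *)

Section HeatEigenfunctions.
Context (R : realType).


Definition heat_integrable (v : R -> R) := forall x h, 0 < h ->
  (gauss h).-integrable setT (EFin \o (fun y => v (x + y))).

(** An integrated form of [g'' / 2 = mu g] that involves no derivative. *)
Definition heat_eigen (mu : R) (g : R -> R) := heat_integrable g /\
  forall x h, 0 < h -> \int[gauss h]_y g (x + y) = expR (mu * h) * g x.

Lemma heat_integrableD (u v : R -> R) : heat_integrable u -> heat_integrable v ->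
  heat_integrable (fun y => u y + v y).
Proof.
move=> iu iv x h h0.
by have := integrableD measurableT (iu x h h0) (iv x h h0).
Qed.

Lemma heat_integrableZ a v : heat_integrable v -> heat_integrable (fun y => a * v y).
Proof.
move=> iv x h h0.
by have := integrableZl measurableT a (iv x h h0).
Qed.

Lemma heat_RintegralD u v x h : 0 < h -> heat_integrable u -> heat_integrable v ->
  \int[gauss h]_y (u (x + y) + v (x + y)) =
  \int[gauss h]_y u (x + y) + \int[gauss h]_y v (x + y).
Proof. by move=> h0 iu iv; rewrite RintegralD//; [exact: iu|exact: iv]. Qed.

Lemma heat_RintegralZ a v x h : 0 < h -> heat_integrable v ->
  \int[gauss h]_y (a * v (x + y)) = a * \int[gauss h]_y v (x + y).
Proof. by move=> h0 iv; rewrite RintegralZl//; exact: iv. Qed.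

Lemma heat_eigen_ge0 mu (g : R -> R) : measurable_fun setT g -> (forall x, 0 <= g x) ->
  (forall x h, 0 < h -> heat h g x = (expR (mu * h) * g x)%:E) -> heat_eigen mu g.
Proof.
move=> mg g0 hg; split => x h h0; last by rewrite /Rintegral [X in fine X](hg x h h0).
apply/integrableP; split.
  by apply/measurable_EFinP; apply: (measurableT_comp mg); exact: measurable_funD.
rewrite (_ : (\int[_]_y _)%E = heat h g x); first by rewrite hg// ltry.
by apply: eq_integral => y _; rewrite /= ger0_norm.
Qed.

Lemma heat_eigen_hcos l : heat_eigen (l ^+ 2 / 2) (fun x => hcos (l * x)).
Proof.
apply: heat_eigen_ge0 => [|x|x h h0]; first exact: measurable_hcosM.
  exact/ltW/hcos_gt0.
exact: heat_hcos.
Qed.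

Lemma heat_eigen_expR k : heat_eigen (k ^+ 2 / 2) (fun x => expR (k * x)).
Proof.
apply: heat_eigen_ge0 => [|x|x h h0]; first exact: measurable_expRM.
  exact: expR_ge0.
exact: heat_expR.
Qed.

Lemma heat_eigen_cst a : heat_eigen 0 (fun=> a).
Proof.
split => x h h0; first exact: finite_measure_integrable_cst.
rewrite mul0r expR0 mul1r Rintegral_cst; last exact: measurableT.
rewrite -[RHS]mulr1; congr (_ * _).
by rewrite -[RHS]/(fine 1%:E); congr fine; exact: probability_setT.
Qed.

Lemma hcos_ge1 x : 1 <= hcos x :> R.
Proof.
rewrite -[x]mul1r; apply: (dalembert_ge1 _ (dalembert_hcos 1)) => y; exact: hcos_gt0.
Qed.

(** A positive maximum over [[a, b]] would be interior, and growth at rate [k] there contradicts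
    [heat_max_principle], which asks for a local maximum only: [v] may be large outside [[a, b]]. *)
Lemma heat_comparison (v : R -> R) (a b : R) : a <= b ->
  continuous v -> heat_integrable v -> v a <= 0 -> v b <= 0 ->
  (forall x, a < x < b -> 0 < v x -> exists2 k, 0 < k & forall h, 0 < h -> h <= 2^-1 ->
     k * h <= \int[gauss h]_y v (x + y) - v x) ->
  forall x, a <= x <= b -> v x <= 0.
Proof.
move=> ab cv iv va vb hv x xab.
have [|x0 x0ab x0max] := @EVT_max R v a b ab; first exact: continuous_subspaceT.
apply: le_trans (x0max x _) _; first by rewrite in_itv.
rewrite leNgt; apply/negP => vx0.
rewrite in_itv/= in x0ab; case/andP: x0ab => ax0 x0b.
have ax : a < x0.
  by rewrite lt_neqAle ax0 andbT; apply: contraTneq vx0 => <-; rewrite -leNgt.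
have bx : x0 < b.
  by rewrite lt_neqAle x0b andbT; apply: contraTneq vx0 => ->; rewrite -leNgt.
have [|k k0 hk] := hv x0 _ vx0; first by rewrite ax.
pose r := Num.min (x0 - a) (b - x0).
have r0 : 0 < r by rewrite lt_min !subr_gt0 ax.
apply: (@heat_max_principle R v x0 r k) => //.
- exact: continuous_measurable_fun.
- move=> y; rewrite /r le_min !ler_norml => /andP[/andP[? ?] /andP[? ?]].
  by apply: x0max; rewrite in_itv/=; apply/andP; split; lra.
- by move=> h h0; exact: iv.
Qed.

Section PositiveEven.
Variables (f : R -> R) (mu : R).
Hypotheses (cf : continuous f) (f_gt0 : forall x, 0 < f x)
  (fN : forall x, f (- x) = f x) (f0 : f 0 = 1) (ef : heat_eigen mu f).

(* If [mu < 0], comparing [f] with [exp (- k x)] on [0, b] and letting first [b] grow, then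
   [k] decrease, gives [f >= 1], which contradicts that the mean of [f] is [exp mu < 1]. *)
Lemma heat_eigen_value_ge0 : 0 <= mu.
Proof.
rewrite leNgt; apply/negP => mu0.
have low k b x : 0 < k -> 0 < b -> 0 <= x <= b ->
    (expR (- k * x) - expR (- k * b)) / (1 - expR (- k * b)) <= f x.
  move=> k0 b0 xb.
  have eb1 : expR (- k * b) < 1 by rewrite mulNr expRN invf_lt1 ?expR_gt0// -expR0 ltr_expR mulr_gt0.
  pose A := (1 - expR (- k * b))^-1.
  have A0 : 0 < A by rewrite invr_gt0 subr_gt0.
  (* [A] normalizes [exp (- k y) - exp (- k b)] to be [1 = f 0] at 0; at [b] it vanishes, below
     [f b]. *)
  pose v y := A * expR (- k * y) + ((- A * expR (- k * b)) + (-1) * f y).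
  have ie := (heat_eigen_expR (- k)).1; have ic := (heat_eigen_cst (- A * expR (- k * b))).1.
  have i1 : heat_integrable (fun y => (- A * expR (- k * b)) + (-1) * f y).
    by apply: heat_integrableD => //; apply: heat_integrableZ; exact: ef.1.
  have i0 := heat_integrableZ A ie.
  suff : v x <= 0 by rewrite /v /A => h; lra.
  apply: (@heat_comparison v 0 b) => //.
  - exact: ltW.
  - move=> y; apply: cvgD.
      apply: cvgM; first exact: cvg_cst.
      apply: (cvg_comp ( *%R (- k)) (@expR R)); last exact: continuous_expR.
      by apply: cvgM; [exact: cvg_cst|exact: cvg_id].
    by apply: cvgD; [exact: cvg_cst|apply: cvgM; [exact: cvg_cst|exact: cf]].
  - exact: heat_integrableD.
  - rewrite /v mulr0 expR0 f0 mulr1 mulNr.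
    have : A * (1 - expR (- k * b)) = 1 by rewrite mulVf// gt_eqF// subr_gt0.
    lra.
  - by rewrite /v; have := f_gt0 b; lra.
  move=> z zab vz.
  (* For [h <= 1], [1 - exp (mu h) >= - mu h / (1 - mu h) >= - mu h / (1 - mu)]. The semigroup does
     not decrease the exponential term and preserves the constant. *)
  exists (- mu / (1 - mu) * f z).
    by rewrite mulr_gt0// divr_gt0//; lra.
  move=> h h0 h2.
  rewrite (heat_RintegralD z h0 i0 i1).
  rewrite (heat_RintegralZ A z h0 ie).
  rewrite (heat_RintegralD z h0 ic (heat_integrableZ (-1) ef.1)).
  rewrite (heat_RintegralZ (-1) z h0 ef.1).
  rewrite (heat_eigen_expR (- k)).2// ef.2// (heat_eigen_cst _).2// mul0r expR0 mul1r.
  have E1 : 1 <= expR ((- k) ^+ 2 / 2 * h).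
    by rewrite -expR0 ler_expR; apply: mulr_ge0; [rewrite divr_ge0// sqr_ge0|exact: ltW].
  have E2 : expR (mu * h) <= (1 - mu * h)^-1.
    rewrite -[mu * h]opprK expRN lef_pV2 ?posrE ?expR_gt0 ?opprK//; last nra.
    by rewrite -[1 - mu * h]/(1 + - (mu * h)) expR_ge1Dx.
  have E3 : - mu / (1 - mu) * h <= 1 - expR (mu * h).
    have mh : mu * h < 0 by rewrite nmulr_rlt0.
    have e : 1 - (1 - mu * h)^-1 = - mu * h / (1 - mu * h) by field; lra.
    apply: (@le_trans _ _ (1 - (1 - mu * h)^-1)); last by lra.
    rewrite e mulrAC; apply: ler_wpM2l; first by nra.
    by rewrite lef_pV2 ?posrE; nra.
  have fz := f_gt0 z.
  have ez : 0 < A * expR (- k * z) by rewrite mulr_gt0// expR_gt0.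
  have t1 : - mu / (1 - mu) * h * f z <= (1 - expR (mu * h)) * f z by rewrite ler_pM2r.
  have t2 : A * expR (- k * z) <= expR ((- k) ^+ 2 / 2 * h) * (A * expR (- k * z)).
    by rewrite ler_peMl// ltW.
  rewrite /v; lra.
have fge1 x : 0 < x -> 1 <= f x.
  move=> x0; rewrite leNgt; apply/negP => fx1.
  pose e := 1 - f x.
  have e0 : 0 < e by rewrite subr_gt0.
  (* [k] makes [exp (- k x) >= 1 - e / 2] and [b] makes [exp (- k b) < e / 2], so that [low] yields
     [f x > 1 - e = f x]. *)
  pose k := e / (2 * x).
  have k0 : 0 < k by rewrite divr_gt0//; lra.
  pose b := 2 / (k * e) + x.
  have ke0 : 0 < k * e by exact: mulr_gt0.
  have b0 : 0 < b by rewrite addr_gt0// divr_gt0.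
  have xb : 0 <= x <= b by rewrite (ltW x0)/= lerDr divr_ge0// ltW.
  have := low k b x k0 b0 xb.
  have h1 : 1 - e / 2 <= expR (- k * x).
    apply: le_trans (expR_ge1Dx _).
    by rewrite (_ : - k * x = - (e / 2))// /k; field; lra.
  have h2 : expR (- k * b) < e / 2.
    rewrite mulNr expRN -[ltRHS]invrK ltf_pV2 ?posrE ?expR_gt0 ?invr_gt0 ?divr_gt0//.
    apply: lt_le_trans (expR_ge1Dx _).
    have -> : k * b = (e / 2)^-1 + k * x by rewrite /b; field; lra.
    have : 0 < k * x by exact: mulr_gt0.
    lra.
  have h3 : 0 < expR (- k * b) by exact: expR_gt0.
  have e1 : e < 1 by rewrite /e; have := f_gt0 x; lra.
  have h4 : expR (- k * b) < 1 by lra.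
  have h5 : expR (- k * x) - expR (- k * b) <=
      (expR (- k * x) - expR (- k * b)) / (1 - expR (- k * b)).
    rewrite ler_pdivlMr; last lra.
    have : expR (- k * b) <= expR (- k * x).
      by rewrite ler_expR !mulNr lerN2 ler_pM2l//; case/andP: xb.
    nra.
  move=> h6; have : f x = 1 - e by rewrite /e; ring.
  lra.
have fge x : 1 <= f x.
  have [x0|x0|<-] := ltgtP 0 x; [exact: fge1| |by rewrite f0].
  by rewrite -fN fge1// oppr_gt0.
have := ef.2 0 1 ltr01; rewrite f0 !mulr1 => e1.
have : expR mu < 1 by rewrite -expR0 ltr_expR.
rewrite -e1 ltNge => /negP; apply.
have e1' : \int[gauss 1]_y (1 : R) = 1.
  by have := (heat_eigen_cst 1).2 0 1 ltr01; rewrite mul0r expR0 mulr1.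
rewrite -[leLHS]e1'; apply: le_Rintegral.
- exact: measurableT.
- exact: (heat_eigen_cst 1).1 0 1 ltr01.
- exact: ef.1 0 1 ltr01.
- by move=> y _; exact: fge.
Qed.

Lemma positive_even_heat_eigen : exists l, forall x, f x = hcos (l * x).
Proof.
have mu0 := heat_eigen_value_ge0.
pose l := Num.sqrt (2 * mu).
have l2 : l ^+ 2 / 2 = mu by rewrite sqr_sqrtr ?mulr_ge0//; field.
have ehl := heat_eigen_hcos l; rewrite l2 in ehl.
have eh1 := heat_eigen_hcos 1.
(* The term [w <= 0], of size O(e), turns [s * (f - C * hcos (l * _))] into a strict
   subsolution, because the heat eigenvalues [exp (h / 2)] of [hcos] exceed 1. *)
have main a C s e : 0 < a -> 0 < e -> f a = C * hcos (l * a) ->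
    forall x, - a <= x <= a -> s * (f x - C * hcos (l * x)) <= e * expR a.
  move=> a0 e0 fa x xa.
  have hcH y : - a <= y <= a -> hcos (1 * y) <= expR a.
    move=> /andP[y1 y2]; rewrite mul1r /hcos ler_pdivrMr//.
    have : expR y <= expR a by rewrite ler_expR.
    have : expR (- y) <= expR a by rewrite ler_expR; lra.
    lra.
  pose u y := s * f y + (- (s * C)) * hcos (l * y).
  pose w y := e * hcos (1 * y) + (- (e * expR a)).
  pose v y := u y + w y.
  have iu : heat_integrable u.
    by apply: heat_integrableD; apply: heat_integrableZ; [exact: ef.1|exact: ehl.1].
  have iw : heat_integrable w.
    by apply: heat_integrableD; [apply: heat_integrableZ; exact: eh1.1|exact: (heat_eigen_cst _).1].
  have va : v a <= 0.
    rewrite /v /u /w fa.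
    have : e * hcos (1 * a) <= e * expR a by rewrite ler_pM2l// hcH//; lra.
    lra.
  have vx : v x <= 0.
    apply: (@heat_comparison v (- a) a) => //.
    - lra.
    - have ch (k : R) : continuous (fun y : R => hcos (k * y)).
        move=> y; apply: (cvg_comp ( *%R k) (@hcos R)); last exact: continuous_hcos.
        by apply: cvgM; [exact: cvg_cst|exact: cvg_id].
      move=> y; apply: cvgD; apply: cvgD.
      + by apply: cvgM; [exact: cvg_cst|exact: cf].
      + by apply: cvgM; [exact: cvg_cst|exact: ch].
      + by apply: cvgM; [exact: cvg_cst|exact: ch].
      + exact: cvg_cst.
    - exact: heat_integrableD.
    - by rewrite /v /u /w !mulrN !hcosN fN.
    move=> z /andP[z1 z2] vz; exists (e / 2); first lra.
    move=> h h0 h2.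
    have zH : hcos (1 * z) <= expR a by apply: hcH; rewrite !ltW.
    have z1' := hcos_ge1 (1 * z).
    rewrite (heat_RintegralD z h0 iu iw).
    rewrite (heat_RintegralD z h0 (heat_integrableZ s ef.1) (heat_integrableZ (- (s * C)) ehl.1)).
    rewrite (heat_RintegralZ s z h0 ef.1) (heat_RintegralZ (- (s * C)) z h0 ehl.1).
    rewrite (heat_RintegralD z h0 (heat_integrableZ e eh1.1) (heat_eigen_cst (- (e * expR a))).1).
    rewrite (heat_RintegralZ e z h0 eh1.1) (heat_eigen_cst _).2// mul0r expR0 mul1r.
    rewrite ef.2// ehl.2// eh1.2// expr1n.
    have E1 : 1 <= expR (mu * h) by rewrite -expR0 ler_expR mulr_ge0// ltW.
    have E2 : 1 + 1 / 2 * h <= expR (1 / 2 * h) by exact: expR_ge1Dx.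
    set E := expR (mu * h) in E1 *; set E' := expR (1 / 2 * h) in E2 *.
    (* The second factor is [u z], positive since [v z > 0] and [w z <= 0]; here [mu >= 0] enters,
       through [E >= 1]. *)
    have t1 : 0 <= (E - 1) * (v z + e * (expR a - hcos (1 * z))).
      by rewrite mulr_ge0 ?subr_ge0// addr_ge0 ?(ltW vz)// mulr_ge0 ?subr_ge0// ltW.
    have t2 : e / 2 * h <= e * ((E' - 1) * hcos (1 * z)).
      rewrite -mulrA ler_pM2l//; nra.
    move: t1; rewrite /v /u /w; lra.
  move: vx; rewrite /v /u /w => vx.
  have := hcH x xa => h.
  have eh0 : 0 <= e * hcos (1 * x) by rewrite mulr_ge0 ?(ltW e0)//; exact/ltW/hcos_gt0.
  lra.
exists l => x.
(* [[- a, a]] contains both 0 and [x]. [C] matches the two functions at [a], hence at [- a] by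
   evenness, and the value at 0 then gives [C = 1]. *)
pose a := `|x| + 1.
have a0 : 0 < a by rewrite ltr_wpDl.
pose C := f a / hcos (l * a).
have fa : f a = C * hcos (l * a) by rewrite divfK// gt_eqF// hcos_gt0.
have eq y : - a <= y <= a -> f y = C * hcos (l * y).
  move=> ya; apply/eqP; rewrite -subr_eq0 eq_le; apply/andP; split.
    apply/ler_addgt0Pr => e e0; rewrite add0r.
    have ea : 0 < e / expR a by rewrite divr_gt0// expR_gt0.
    have := main a C 1 (e / expR a) a0 ea fa y ya.
    by rewrite mul1r divfK// gt_eqF// expR_gt0.
  rewrite -oppr_le0; apply/ler_addgt0Pr => e e0; rewrite add0r.
  have ea : 0 < e / expR a by rewrite divr_gt0// expR_gt0.
  have := main a C (-1) (e / expR a) a0 ea fa y ya.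
  by rewrite mulN1r divfK// gt_eqF// expR_gt0.
have C1 : C = 1.
  have := eq 0; rewrite mulr0 hcos0 mulr1 f0 => <-//.
  by apply/andP; split; lra.
rewrite eq ?C1 ?mul1r// /a.
have := ler_norm x; have := ler_norm (- x); rewrite normrN => h1 h2.
by apply/andP; split; lra.
Qed.

End PositiveEven.

End HeatEigenfunctions.

(** Cauchy's equation on positive times: the additive [a] vanishes at positive multiples of
    [1 / (n + 1)], and what remains of [t] tends to 0 from the right, where [a] is small. *)
Lemma multiplicative_expR (R : realType) (c : R -> R) :
  (forall t, 0 < t -> 0 < c t) ->
  (forall s t, 0 < s -> 0 < t -> c (s + t) = c s * c t) ->
  c s @[s --> 0^'+] --> (1 : R) ->
  forall t, 0 < t -> c t = expR (ln (c 1) * t).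
Proof.
move=> c0 cM c1 t t0.
pose a s := ln (c s) - ln (c 1) * s.
suff at0 : a t = 0.
  by rewrite -[LHS]lnK ?posrE ?c0//; congr expR; rewrite /a in at0; lra.
have aD s u : 0 < s -> 0 < u -> a (s + u) = a s + a u.
  by move=> s0 u0; rewrite /a cM// lnM ?posrE ?c0//; ring.
have a1 : a 1 = 0 by rewrite /a; ring.
have aMn n s : 0 < s -> a (n.+1%:R * s) = n.+1%:R * a s.
  move=> s0; elim: n => [|n IH]; first by rewrite !mul1r.
  rewrite -[n.+2%:R]natr1 mulrDl mul1r aD ?IH//; first by ring.
  by rewrite mulr_gt0// ltr0n.
have aV n : a (n.+1%:R^-1) = 0.
  have n0 : 0 < n.+1%:R :> R by rewrite ltr0n.
  have := aMn n (n.+1%:R^-1); rewrite invr_gt0 n0 => /(_ isT).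
  rewrite divff ?gt_eqF// a1 => /esym/eqP.
  by rewrite mulf_eq0 pnatr_eq0/= => /eqP.
have a0 : a s @[s --> 0^'+] --> (0 : R).
  have e : ln (1 : R) - ln (c 1) * 0 = 0 by rewrite ln1 mulr0 subr0.
  rewrite -[X in _ --> X]e; apply: cvgB.
    by apply: continuous_cvg => //; apply: continuous_ln.
  by apply: cvgM; [exact: cvg_cst|apply: cvg_at_right_filter; exact: cvg_id].
apply/eqP; rewrite -normr_eq0 eq_le normr_ge0 andbT.
apply/ler_addgt0Pr => e e0; rewrite add0r.
have /cvg_rightP/(_ e e0)[dl dl0 hdl] := a0.
pose n := Num.trunc dl^-1.
have /truncn_itv/andP[_ hn] : 0 <= dl^-1 by rewrite invr_ge0 ltW.
have n0 : 0 < n.+1%:R :> R by rewrite ltr0n.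
have ndl : n.+1%:R^-1 < dl by rewrite -[ltRHS]invrK ltf_pV2 ?posrE ?invr_gt0.
pose k := Num.trunc (n.+1%:R * t).
have /truncn_itv/andP[k1 k2] : 0 <= n.+1%:R * t by rewrite mulr_ge0// ltW.
pose s := t - k%:R / n.+1%:R.
have s0 : 0 <= s by rewrite subr_ge0 ler_pdivrMr// mulrC.
have sn : s < n.+1%:R^-1.
  rewrite ltrBlDr -[X in X + _]mul1r -mulrDl addrC natr1 ltr_pdivlMr// mulrC.
  exact: k2.
have ak : (0 < k)%N -> a (k%:R / n.+1%:R) = 0.
  by case: k {k1 k2 s s0 sn} => // k _; rewrite aMn ?invr_gt0// aV mulr0.
have tE : t = k%:R / n.+1%:R + s by rewrite /s; ring.
have as_le : 0 < s -> `|a s| <= e.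
  move=> s0'; have := hdl s s0'; rewrite add0r subr0 => h.
  by apply/ltW/h; exact: lt_trans sn ndl.
(* Additivity is known for positive times only, so [k = 0] and [s = 0] are treated apart. *)
have [k0|k0] := posnP k.
  have ts : t = s by rewrite [LHS]tE k0 mul0r add0r.
  by rewrite ts; apply: as_le; rewrite -ts.
have kn0 : 0 < k%:R / n.+1%:R :> R by rewrite divr_gt0// ltr0n.
move: s0; rewrite le_eqVlt => /orP[/eqP s0|s0].
  by rewrite tE -s0 addr0 ak// normr0 ltW.
by rewrite tE aD// ak// add0r; exact: as_le.
Qed.

(** From [(y - 2 x) ^ 2 >= 0]. At the price of doubling the variance, one density centred at 0
    dominates those with centres in [[- M, M]]. *)
Lemma normal_pdf_center_le (R : realType) (h M x y : R) : 0 < h -> `|x| <= M ->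
  normal_pdf x (Num.sqrt h) y <=
  normal_peak (Num.sqrt h) / normal_peak (Num.sqrt (2 * h)) * expR (M ^+ 2 / (2 * h)) *
    normal_pdf 0 (Num.sqrt (2 * h)) y.
Proof.
move=> h0 xM.
have h20 : 0 < 2 * h by lra.
have s1 : Num.sqrt h != 0 by rewrite gt_eqF// sqrtr_gt0.
have s2 : Num.sqrt (2 * h) != 0 by rewrite gt_eqF// sqrtr_gt0.
rewrite !normal_pdfE// /normal_fun !sqr_sqrtr ?(ltW h0) ?(ltW h20)// subr0.
have p2 := normal_peak_gt0 s2.
set p := normal_peak (Num.sqrt (2 * h)) in p2 *.
rewrite (_ : _ / p * _ * _ = normal_peak (Num.sqrt h) *
   (expR (M ^+ 2 / (2 * h)) * expR (- y ^+ 2 / ((2 * h) *+ 2)))); last by field; lra.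
apply: ler_wpM2l; first exact: normal_peak_ge0.
rewrite -expRD ler_expR -(mulr_natr h 2) -(mulr_natr (2 * h) 2).
have xM2 : x ^+ 2 <= M ^+ 2.
  by rewrite -(real_normK (num_real x)) lerXn2r ?nnegrE// (le_trans _ xM).
have sq := sqr_ge0 (y - 2 * x).
rewrite (_ : M ^+ 2 / (2 * h) + - y ^+ 2 / (2 * h * 2) =
  (2 * M ^+ 2 - y ^+ 2) / 2 / (h * 2)); last by field; lra.
apply: ler_wpM2r; first by rewrite invr_ge0; lra.
have -> : (y - x) ^+ 2 = y ^+ 2 - 2 * x * y + x ^+ 2 by ring.
have e : (y - 2 * x) ^+ 2 = y ^+ 2 - 4 * x * y + 4 * x ^+ 2 by ring.
lra.
Qed.

(** Finiteness is assumed at the point 0 only, but at all times; finiteness at time [2 h] supplies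
    the dominating function for time [h] at points near [x]. *)
Lemma heat_continuous (R : realType) (f : R -> R) :
  continuous f -> (forall x, 0 <= f x) ->
  (forall h, 0 < h -> (heat h f 0 < +oo)%E) ->
  forall h, 0 < h -> (forall x, heat h f x \is a fin_num) /\
    continuous (fun x => fine (heat h f x)).
Proof.
move=> cf f0 ffin h h0.
have mf : measurable_fun setT f by exact: continuous_measurable_fun.
have h20 : 0 < 2 * h by lra.
have s1 : Num.sqrt h != 0 by rewrite gt_eqF// sqrtr_gt0.
pose q (x y : R) : R := f y * normal_pdf x (Num.sqrt h) y.
pose K (M : R) := normal_peak (Num.sqrt h) / normal_peak (Num.sqrt (2 * h)) * expR (M ^+ 2 / (2 * h)).
have K0 M : 0 <= K M by rewrite mulr_ge0 ?expR_ge0// divr_ge0// normal_peak_ge0.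
pose g (M y : R) : R := K M * (f y * normal_pdf 0 (Num.sqrt (2 * h)) y).
have mq x s : measurable_fun setT (fun y => f y * normal_pdf x s y).
  by apply: measurable_funM => //; exact: measurable_normal_pdf.
have q0 x s y : 0 <= f y * normal_pdf x s y by rewrite mulr_ge0// normal_pdf_ge0.
have qg M x y : `|x| <= M -> q x y <= g M y.
  move=> xM; rewrite /q /g mulrCA; apply: ler_wpM2l => //.
  exact: normal_pdf_center_le.
have gint M : lebesgue_measure.-integrable setT (EFin \o g M).
  apply/integrableP; split.
    by apply/measurable_EFinP; apply: measurable_funM => //; exact: mq.
  rewrite (_ : (\int[_]_y _)%E = ((K M)%:E * heat (2 * h) f 0)%E).
    by rewrite lte_mul_pinfty// ?lee_fin// ffin.
  rewrite heat_density// -ge0_integralZl//.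
  - apply: eq_integral => y _; rewrite /= ger0_norm; first by rewrite /g EFinM.
    by apply: mulr_ge0; [exact: K0|exact: q0].
  - by apply/measurable_EFinP; exact: mq.
  - by move=> y _; rewrite lee_fin; exact: q0.
  - by rewrite lee_fin; exact: K0.
have qint x : lebesgue_measure.-integrable setT (EFin \o q x).
  apply: (le_integrable _ _ _ (gint `|x|)) => //.
    by apply/measurable_EFinP; exact: mq.
  move=> y _ /=; rewrite lee_fin (ger0_norm (q0 _ _ _)) (le_trans _ (ler_norm _))//.
  exact: qg.
have hE x : heat h f x = (\int[lebesgue_measure]_y (q x y)%:E)%E by rewrite heat_density.
split => [x|x].
  by rewrite hE; exact: (integrable_fin_num _ (qint x)).
have cont := @continuity_under_integral R _ _ lebesgue_measure q setT measurableT
  (x - 1) (x + 1) (fun z _ => qint z) _ (g (`|x| + 1)) (gint _) _.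
rewrite (_ : (fun x => fine (heat h f x)) = (fun x => \int[lebesgue_measure]_y q x y)); last first.
  by apply/funext => z; rewrite /Rintegral hE.
apply: cont.
- apply: aeW => y _ z _; apply: cvgM; first exact: cvg_cst.
  rewrite (_ : (fun z => normal_pdf z (Num.sqrt h) y) =
      fun z => normal_peak (Num.sqrt h) * expR (- (y - z) ^+ 2 / (Num.sqrt h ^+ 2 *+ 2))); last first.
    by apply/funext => w; rewrite normal_pdfE.
  rewrite normal_pdfE// /normal_fun.
  apply: cvgM; first exact: cvg_cst.
  apply: (cvg_comp (fun z => - (y - z) ^+ 2 / (Num.sqrt h ^+ 2 *+ 2)) (@expR R)); last exact: continuous_expR.
  apply: cvgM; last exact: cvg_cst.
  apply: cvgN; apply: (cvg_comp (fun z => y - z) (fun z => z ^+ 2)); last exact: sqr_continuous.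
  by apply: cvgB; [exact: cvg_cst|exact: cvg_id].
- move=> z; rewrite /= in_itv/= => /andP[z1 z2]; apply: aeW => y _.
  rewrite (ger0_norm (q0 _ _ _)); apply: qg.
  have := ler_norm x; have := ler_norm (- x); rewrite normrN => a b.
  by rewrite ler_norml; apply/andP; split; lra.
- by rewrite inE/= in_itv/=; apply/andP; split; lra.
Qed.

(** * From the martingale to the hyperbolic cosine *)

Section MartingaleImpliesHcos.
Context (R : realType) (d : measure_display) (T : measurableType d).
Variables (P : probability T R) (W : R -> T -> R).
Hypothesis BM : standard_BM P W.

(** If [u > v] at [x], then [u >= v + e] on an interval around [x], which [W 1] charges; finiteness
    of the integral of [v] allows the contradiction. *)
Lemma continuous_le_of_BM_integrals (u v : R -> R) :
  continuous u -> continuous v -> (forall x, 0 <= v x) ->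
  (forall a b, (\int[P]_(w in W 1 @^-1` `]a, b[) (u (W 1 w))%:E =
     \int[P]_(w in W 1 @^-1` `]a, b[) (v (W 1 w))%:E)%E) ->
  (forall a b, (\int[P]_(w in W 1 @^-1` `]a, b[) (v (W 1 w))%:E < +oo)%E) ->
  forall x, u x <= v x.
Proof.
move=> cu cv v0 uv vfin x; rewrite leNgt; apply/negP => ltx.
pose e := (u x - v x) / 3.
have e0 : 0 < e by rewrite divr_gt0// subr_gt0.
have /cvgrPdist_lt/(_ _ e0)[d1 /= d10 h1] := cu x.
have /cvgrPdist_lt/(_ _ e0)[d2 /= d20 h2] := cv x.
pose dm := Num.min d1 d2.
have dm0 : 0 < dm by rewrite lt_min d10.
have [m1 m2] : dm <= d1 /\ dm <= d2 by rewrite /dm !ge_min !lexx orbT.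
pose A := W 1 @^-1` `]x - dm, x + dm[.
have mW := measurable_BM BM (ler01 : 0 <= (1 : R)).
have mA : measurable A by rewrite /A -[_ @^-1` _]setTI; apply: mW => //; exact: measurable_itv.
have PA : (0 < P A)%E.
  have -> : A = incr W 0 1 @^-1` `]x - dm, x + dm[.
    by apply/seteqP; split => w; rewrite /A /incr /= (BM0 BM) subr0.
  case: BM => _ [_ [_ [law _]]].
  rewrite (law _ _ (lexx 0) ltr01 _ (measurable_itv _)).
  by apply: normal_prob_itv_gt0; rewrite ?sqrtr_gt0; lra.
have le_on w : A w -> v (W 1 w) + e <= u (W 1 w).
  rewrite /A /= in_itv/= => /andP[w1 w2].
  have a1 : `|u x - u (W 1 w)| < e by apply: h1 => /=; rewrite ltr_norml; apply/andP; split; lra.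
  have a2 : `|v x - v (W 1 w)| < e by apply: h2 => /=; rewrite ltr_norml; apply/andP; split; lra.
  rewrite !ltr_norml in a1 a2; case/andP: a1 => ? ?; case/andP: a2 => ? ?.
  have : u x - v x = 3 * e by rewrite /e; field.
  lra.
have mvW : measurable_fun A (fun w => (v (W 1 w))%:E).
  apply/measurable_EFinP/measurable_funTS; apply: (measurableT_comp _ mW).
  exact: continuous_measurable_fun.
have muW : measurable_fun A (fun w => (u (W 1 w))%:E).
  apply/measurable_EFinP/measurable_funTS; apply: (measurableT_comp _ mW).
  exact: continuous_measurable_fun.
have : (\int[P]_(w in A) (v (W 1 w))%:E + e%:E * P A <= \int[P]_(w in A) (u (W 1 w))%:E)%E.
  have -> : (e%:E * P A = \int[P]_(w in A) e%:E)%E by rewrite (integral_cst P mA).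
  rewrite -ge0_integralD//; last 2 first.
  - by move=> w _; rewrite lee_fin.
  - by move=> w _; rewrite lee_fin ltW.
  apply: ge0_le_integral => //.
  - by move=> w _; rewrite -EFinD lee_fin addr_ge0// ltW.
  - by apply: emeasurable_funD => //; exact: measurable_cst.
rewrite (uv (x - dm) (x + dm)) -/A => le_uv.
have vf : (\int[P]_(w in A) (v (W 1 w))%:E \is a fin_num)%E.
  rewrite ge0_fin_numE; first exact: vfin.
  by rewrite integral_ge0// => w _; rewrite lee_fin.
suff : (\int[P]_(w in A) (v (W 1 w))%:E < \int[P]_(w in A) (v (W 1 w))%:E)%E by rewrite ltxx.
apply: lt_le_trans le_uv.
by rewrite lteDl// mule_gt0// lte_fin.
Qed.

Lemma martingale_hcos (f : R -> R) :
  (forall x, 0 < f x) -> (forall x, f (- x) = f x) -> f 0 = 1 ->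
  (forall t, 0 <= t -> P.-integrable setT (fun w => (f (W t w))%:E)) ->
  let N := fun t w => f (W t w) / fine (\int[P]_w0 (f (W t w0))%:E)%E in
  martingale P (nat_filtration W) N -> right_continuous_process N ->
  exists l, forall x, f x = hcos (l * x).
Proof.
move=> f_gt0 fN f0 fint N [_ [_ mart]] rc.
have fge0 x : 0 <= f x by exact: ltW.
pose c t := fine (\int[P]_w (f (W t w))%:E)%E.
have EfW t : 0 <= t -> (\int[P]_w (f (W t w))%:E = (c t)%:E)%E.
  by move=> t0; rewrite /c fineK//; exact: integrable_fin_num (fint t t0).
have setT_past s : nat_filtration W s setT.
  exact: (@measurableT _ (g_sigma_algebraType (past W s))).
have c0E : c 0 = 1.
  rewrite /c; under eq_integral do rewrite (BM0 BM) f0.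
  rewrite [X in fine X](integral_cst P measurableT 1%:E) mul1e.
  by rewrite [X in fine X](_ : _ = 1%E)//; exact: probability_setT.
(* If [c t] were 0, division by 0 would make [N t] vanish identically, against the constant mean 1
   of the martingale. *)
have c_gt0 t : 0 <= t -> 0 < c t.
  move=> t0; rewrite lt_neqAle fine_ge0 ?andbT; last by apply: integral_ge0 => w _; rewrite lee_fin.
  apply/negP => /eqP ct0.
  have := mart 0 t (lexx _) t0 setT (setT_past 0).
  rewrite /N; under eq_integral do rewrite -/(c t) -ct0 invr0 mulr0.
  under [in RHS]eq_integral do rewrite -/(c 0) c0E (BM0 BM) f0 divr1.
  rewrite [LHS](integral_cst P measurableT 0%:E) mul0e.
  rewrite [RHS](integral_cst P measurableT 1%:E) mul1e => /esym.
  move=> /(etrans (esym (probability_setT P))).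
  by move=> [] /eqP; rewrite oner_eq0.
pose c' s := c (Num.max 0 s).
have c'0 s : 0 < c' s by apply: c_gt0; rewrite le_max lexx.
have rc' : right_continuous_process (fun s w => f (W s w) / c' s).
  move=> w t t0; apply/cvg_rightP => e e0.
  have /cvg_rightP/(_ e e0)[dl dl0 h] := rc w t t0.
  exists dl => // s ts sd; have := h s ts sd.
  by rewrite /N /c' !max_r// ltW//; lra.
have cf := continuous_of_martingale_ratio BM f_gt0 fN c'0 rc'.
have mf : measurable_fun setT f by exact: continuous_measurable_fun.
have c1 : c s @[s --> 0^'+] --> (1 : R).
  apply/cvg_rightP => e e0.
  have /cvg_rightP/(_ e e0)[dl dl0 h] := right_continuous_normalizer BM f_gt0 c'0 rc' (lexx 0).
  exists dl => // s s0 sd; have := h s s0 sd.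
  by rewrite /c' maxxx c0E max_r// ltW.
have heat0 h : 0 < h -> heat h f 0 = (c h)%:E.
  by move=> h0; rewrite -(expectation_BM BM h0 mf fge0) EfW// ltW.
have hfin h : 0 < h -> (heat h f 0 < +oo)%E by move=> h0; rewrite heat0// ltry.
have mW1 := measurable_BM BM (ler01 : 0 <= (1 : R)).
(* Conditioning at time 1, where [W] charges every interval, gives the eigenvalue as
   [c (1 + h) / c 1]; evaluating at 0 identifies it with [c h]. *)
have heatE h x : 0 < h -> heat h f x = (c h * f x)%:E.
  move=> h0; have [dfin cd] := heat_continuous cf fge0 hfin h0.
  pose dd z := fine (heat h f z).
  pose r := c (1 + h) / c 1.
  have h1 : 1 < 1 + h by lra.
  have h10 : 0 <= 1 + h by lra.
  have r0 : 0 < r by rewrite divr_gt0// c_gt0//; lra.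
  have eqI a b : (\int[P]_(w in W 1 @^-1` `]a, b[) (dd (W 1 w))%:E =
      \int[P]_(w in W 1 @^-1` `]a, b[) (r * f (W 1 w))%:E)%E.
    set A := W 1 @^-1` _.
    have FA : nat_filtration W 1 A.
      apply: sub_sigma_algebra; exists 1; split => //; split => //.
      by exists `]a, b[%classic; split => //; exact: measurable_itv.
    have mA : measurable A by exact: (nat_filtration_measurable BM ler01).
    have intN u : 0 <= u ->
      (\int[P]_(w in A) (f (W u w))%:E = (c u)%:E * \int[P]_(w in A) (N u w)%:E)%E.
      move=> u0; rewrite -ge0_integralZl//.
      - by apply: eq_integral => w _; rewrite -EFinM /N -/(c u) mulrC divfK// gt_eqF// c_gt0.
      - apply/measurable_EFinP/measurable_funTS; apply: measurable_funM => //.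
        by apply: (measurableT_comp mf); exact: (measurable_BM BM).
      - by move=> w _; rewrite lee_fin divr_ge0// ltW// c_gt0.
      - by rewrite lee_fin ltW// c_gt0.
    transitivity (\int[P]_(w in A) heat h f (W 1 w))%E.
      by apply: eq_integral => w _; rewrite /dd fineK.
    have -> : (\int[P]_(w in A) heat h f (W 1 w) = \int[P]_(w in A) (f (W (1 + h) w))%:E)%E.
      rewrite (markov_BM BM ler01 h1 mf fge0 FA).
      by rewrite (_ : 1 + h - 1 = h)//; ring.
    rewrite (intN _ h10) (mart 1 (1 + h) ler01 (ltW h1) A FA).
    under [RHS]eq_integral do rewrite EFinM.
    rewrite [RHS]ge0_integralZl//.
    - rewrite (intN 1 ler01) muleA -EFinM /r divfK// gt_eqF// c_gt0//.
    - apply/measurable_EFinP/measurable_funTS; exact: (measurableT_comp mf).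
    - by move=> w _; rewrite lee_fin.
    - by rewrite lee_fin ltW.
  have rfin a b : (\int[P]_(w in W 1 @^-1` `]a, b[) (r * f (W 1 w))%:E < +oo)%E.
    have mA : measurable (W 1 @^-1` `]a, b[%classic).
      by rewrite -[_ @^-1` _]setTI; apply: mW1 => //; exact: measurable_itv.
    apply: (@le_lt_trans _ _ (\int[P]_w (r * f (W 1 w))%:E)%E).
      apply: ge0_subset_integral => //.
      - apply/measurable_EFinP; apply: measurable_funM => //; exact: (measurableT_comp mf).
      - by move=> w _; rewrite lee_fin mulr_ge0// ltW.
    under eq_integral do rewrite EFinM.
    rewrite ge0_integralZl//.
    - by rewrite (EfW 1 ler01) -EFinM ltry.
    - by apply/measurable_EFinP; exact: (measurableT_comp mf).
    - by move=> w _; rewrite lee_fin.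
    - by rewrite lee_fin ltW.
  have crf : continuous (fun z => r * f z).
    by move=> z; apply: cvgM; [exact: cvg_cst|exact: cf].
  have ddE z : dd z = r * f z.
    apply/eqP; rewrite eq_le; apply/andP; split.
      apply: (continuous_le_of_BM_integrals cd crf _ eqI rfin) => y.
      by rewrite mulr_ge0// ltW.
    apply: (continuous_le_of_BM_integrals crf cd) => [y|a b|a b].
    - by apply: fine_ge0; apply: integral_ge0 => y' _; rewrite lee_fin.
    - by rewrite -eqI.
    - by rewrite eqI rfin.
  have rE : r = c h.
    by have := ddE 0; rewrite f0 mulr1 /dd heat0.
  by rewrite -(fineK (dfin x)) -rE; congr EFin; exact: ddE.
have cM s t : 0 < s -> 0 < t -> c (s + t) = c s * c t.
  move=> s0 t0; apply: EFin_inj; rewrite -EfW; last by rewrite addr_ge0// ltW.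
  have st : s < s + t by rewrite ltrDl.
  rewrite (markov_BM BM (ltW s0) st mf fge0 (setT_past s)).
  rewrite (_ : s + t - s = t); last by ring.
  under eq_integral do rewrite heatE// EFinM.
  rewrite ge0_integralZl//.
  - by rewrite (EfW s (ltW s0)) -EFinM mulrC.
  - apply/measurable_EFinP; apply: (measurableT_comp mf).
    by apply: (measurable_BM BM); exact: ltW.
  - by move=> w _; rewrite lee_fin.
  - by rewrite lee_fin ltW// c_gt0// ltW.
have cexp := multiplicative_expR (fun t t0 => c_gt0 t (ltW t0)) cM c1.
apply: (@positive_even_heat_eigen R f (ln (c 1))) => //.
apply: heat_eigen_ge0 => // x h h0.
by rewrite heatE// cexp.
Qed.

End MartingaleImpliesHcos.

Theorem theorem4 (R : realType) (d : measure_display) (T : measurableType d)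
  (P : probability T R) (W : R -> T -> R) (f : R -> R) :
  measure_is_complete P ->
  standard_BM P W ->
  ((* (i) *)
   (measurable_fun setT f /\ (forall x, 0 < f x) /\
    (forall x y, f (x + y) + f (x - y) = 2 * f x * f y))
   <->
   (* (ii) *)
   ((forall x, 0 < f x) /\ (forall x, f (- x) = f x) /\ f 0 = 1 /\
    (forall t, 0 <= t -> P.-integrable setT (fun w => (f (W t w))%:E)) /\
    let N := fun t w => f (W t w) / fine (\int[P]_w0 (f (W t w0))%:E)%E in
    martingale P (nat_filtration W) N /\ right_continuous_process N))
  /\
  ((* (i) *)
   (measurable_fun setT f /\ (forall x, 0 < f x) /\
    (forall x y, f (x + y) + f (x - y) = 2 * f x * f y))
   <->
   (* (iii) *)
   (exists lambda : R, forall x, f x = (expR (lambda * x) + expR (- (lambda * x))) / 2)).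
Proof.
move=> _ BM.
have i_iii : (measurable_fun setT f /\ (forall x, 0 < f x) /\
    (forall x y, f (x + y) + f (x - y) = 2 * f x * f y)) <->
    exists l : R, forall x, f x = hcos (l * x).
  split=> [[mf [f_gt0 fE]]|[l fE]]; first exact: measurable_dalembert.
  rewrite (_ : f = fun x => hcos (l * x)); last exact/funext.
  split; first exact: measurable_hcosM.
  by split=> [x|]; [exact: hcos_gt0|exact: dalembert_hcos].
split=> //; split=> [/i_iii[l fE]|[f_gt0 [fN [f0 [fint [mart rc]]]]]]; last first.
  exact/i_iii/(martingale_hcos BM).
rewrite (_ : f = fun x => hcos (l * x)); last exact/funext.
split=> [x|]; first exact: hcos_gt0.
split=> [x|]; first by rewrite mulrN hcosN.
split; first by rewrite mulr0 hcos0.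
by split; [exact: hcos_integrable|exact: hcos_martingale].
Qed.
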